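(* Fix an integer $n\geq 2$. For each polynomial $p\in\mathbb{C}[x]$ with $p(0)\neq 0$, let $V_{n,p}$ be the affine threefold in $\mathbb{A}^4=\mathrm{Spec}(\mathbb{C}[x,y,z,t])$ defined by the equation $$x^ny+z^2+t^3+xp(x)=0.$$ Then the following hold: (1) For $p_1,p_2\in\mathbb{C}[x]$ with $p_1(0)\neq0$ and $p_2(0)\neq 0$, the algebraic varieties $V_{n,p_1}$ and $V_{n,p_2}$ are isomorphic if and only if there exist $\lambda,\varepsilon\in\mathbb{C}^*$ such that $p_2(x)\equiv\varepsilon\, p_1(\lambda x)\pmod{x^{n-1}}$. (2) The cylinders $V_{n,p}\times\mathbb{A}^1$, where $p$ ranges over the polynomials in $\mathbb{C}[x]$ with $p(0)\neq0$, are all isomorphic as algebraic varieties. (3) The varieties $V_{n,p}$, where $p$ ranges over the polynomials in $\mathbb{C}[x]$ with $p(0)\neq0$, are all isomorphic as complex analytic manifolds.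
   Context: All varieties are complex algebraic varieties, and $\mathbb{A}^d$ denotes affine $d$-space over $\mathbb{C}$. The condition $p(0)\neq0$ ensures that $V_{n,p}$ is smooth. *)

(* Defs.v *)
(* multinomials is loaded without Import because
   its notations conflict with those of MathComp-Analysis. *)
From HB Require Import structures.
From mathcomp Require Import all_boot all_order all_algebra.
From mathcomp Require Import boolp classical_sets functions reals.
From mathcomp Require Import topology normedtype derive.
From mathcomp Require Import complex.
From mathcomp Require mpoly.

Set Implicit Arguments.
Unset Strict Implicit.
Unset Printing Implicit Defensive.

Import Order.TTheory GRing.Theory Num.Theory.
Import numFieldNormedType.Exports.

Local Open Scope classical_set_scope.
Local Open Scope ring_scope.
Local Open Scope complex_scope.

(* Typing R[i] as a numFieldType gives it, and row vectors over it, the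
   topology and norm of MathComp-Analysis. Since the base field is the field of
   complex numbers, [differentiable] below means complex differentiable, with a
   complex linear differential. *)
Definition complexField (R : realType) : numFieldType := R[i].

Section ComplexSpaces.
Variable R : realType.
Let C := complexField R.

(* Closed subvarieties of affine space are represented by their sets of complex
   points; their morphisms are the restrictions of polynomial maps. *)
Definition regular_map (m k : nat) (X : set 'rV[C]_m) (Y : set 'rV[C]_k)
    (f : 'rV[C]_m -> 'rV[C]_k) : Prop :=
  (forall v, X v -> Y (f v)) /\
  exists F : 'I_k -> mpoly.mpoly m C,
    forall v, X v -> forall j, f v 0 j = mpoly.meval (fun i => v 0 i) (F j).

Definition algebraically_isomorphic (m k : nat)
    (X : set 'rV[C]_m) (Y : set 'rV[C]_k) : Prop :=
  exists (f : 'rV[C]_m -> 'rV[C]_k) (g : 'rV[C]_k -> 'rV[C]_m),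
    [/\ regular_map X Y f, regular_map Y X g,
        forall v, X v -> g (f v) = v & forall w, Y w -> f (g w) = w].

(* X x A^1 in A^m x A^1 = A^(m + 1) *)
Definition cylinder (m : nat) (X : set 'rV[C]_m) : set 'rV[C]_(m + 1) :=
  [set v | X (lsubmx v)].

Definition holomorphic_on (m k : nat) (U : set 'rV[C]_m)
    (f : 'rV[C]_m -> 'rV[C]_k) : Prop :=
  open U /\ forall v, U v -> differentiable f v.

(* Locally X is the zero set of m - d holomorphic functions whose differentials
   are linearly independent. *)
Definition complex_submanifold (d m : nat) (X : set 'rV[C]_m) : Prop :=
  (d <= m)%N /\
  forall a, X a ->
    exists (U : set 'rV[C]_m) (F : 'rV[C]_m -> 'rV[C]_(m - d)),
      [/\ holomorphic_on U F, U a,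
          X `&` U = [set v | U v /\ F v = 0] &
          forall v, (X `&` U) v -> range ('d F v) = setT].

(* The complex structure on a submanifold is the induced one: maps between
   submanifolds are holomorphic when they are, near each point, restrictions of
   holomorphic maps defined on open subsets of the ambient space. *)
Definition holomorphic_map (m k : nat) (X : set 'rV[C]_m) (Y : set 'rV[C]_k)
    (f : 'rV[C]_m -> 'rV[C]_k) : Prop :=
  (forall v, X v -> Y (f v)) /\
  forall a, X a ->
    exists (U : set 'rV[C]_m) (F : 'rV[C]_m -> 'rV[C]_k),
      [/\ holomorphic_on U F, U a & forall v, (X `&` U) v -> f v = F v].

(* X and Y are isomorphic as complex analytic manifolds of dimension d. *)
Definition analytically_isomorphic (d m k : nat)
    (X : set 'rV[C]_m) (Y : set 'rV[C]_k) : Prop :=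
  [/\ complex_submanifold d X, complex_submanifold d Y &
    exists (f : 'rV[C]_m -> 'rV[C]_k) (g : 'rV[C]_k -> 'rV[C]_m),
      [/\ holomorphic_map X Y f, holomorphic_map Y X g,
          forall v, X v -> g (f v) = v & forall w, Y w -> f (g w) = w]].

Definition threefold (n : nat) (p : {poly C}) : set 'rV[C]_4 :=
  [set v | let x := v 0 0 in let y := v 0 1 in
           let z := v 0 2%:R in let t := v 0 3%:R in
           x ^+ n * y + z ^+ 2 + t ^+ 3 + x * p.[x] = 0].

End ComplexSpaces.

(* Main.v *)
From HB Require Import structures.
Require Import Defs.
From mathcomp Require Import all_boot all_order all_algebra reals.
From mathcomp Require Import classical_sets complex.
From mathcomp Require mpoly.
Import -(notations) mpoly.
From mathcomp Require Import boolp functions topology normedtype sequences derive realfun exp trigo.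
From mathcomp Require Import ring lra zify.

(** Write A for the coordinate ring of the threefold and G = z^2 + t^3 + x p(x).
   Inside the field of fractions of B = C[x, z, t], the ring A is generated
   over B by y = - G / x^n.

   Algebraic isomorphisms, necessity. Everything rests on the rigidity of B
   inside A: the kernel of a nonzero locally nilpotent derivation D of A is
   contained in B ([lnd_kernel]). To see this, filter the Laurent polynomials
   in x by the order in x and by the weight for which z and t have weights 3
   and 2, so that z^2 + t^3 is homogeneous. The leading part of D is locally
   nilpotent on the leading parts of elements of A, which are spanned by
   monomials in x, z, t and y, where now x^n y + z^2 + t^3 = 0. An element of
   the kernel outside of B has a pole along x = 0, so y divides its leading
   part, and the leading part of D kills y because kernels are factorially
   closed. A degree count in the style of Mason's theorem on the relation
   x^n y + z^2 + t^3 = 0 then shows that x, z, t and z^2 + mu t^3 are not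
   killed, whence the homogeneous elements of the kernel are constant multiples
   of powers of y. So the last nonzero iterates on z^2 and on t^3 are
   proportional to the same power of y. Some combination of z^2 and t^3 is thus
   killed sooner than its bidegree allows, a contradiction.

   The derivations x^n d/dz and x^n d/dt extend to A and their kernels contain x
   and one of z, t. Hence an isomorphism of coordinate rings restricts to an
   automorphism of B ([iso_preserves]). It multiplies x by a constant, has a
   constant Jacobian in z and t, and respects the ideals (x^n, G), which the
   pole orders of elements of A recover ([coordinate_iso]). After composition
   with an automorphism of C[z, t] it is the identity modulo x, and its Jacobian
   is 1. Then it is straightened degree by degree in x by the flows of
   Hamiltonian fields whose Hamiltonians are multiples of G, so that the ideal
   (x^n, G) is kept. In each degree the two polynomials x p(x) must agree,
   because their difference would be a constant in the ideal (z, t)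
   ([normal_form]). Conversely, a scaling of x, z and t and a translation of y
   by a polynomial in x realize every admissible pair.

   Cylinders. Some polynomial a has a^6 p1 = p2 modulo x^n and a(0) != 0. If a
   were invertible, z and t could be multiplied by a^3 and a^2, and y could
   absorb the rest. In general a has only an inverse b modulo x^(2n), and the
   additional coordinate w is used to complete diag(a^3, b^3) and diag(a^2, b^2)
   to matrices of determinant 1 ([cylinder_iso]).

   Analytic isomorphisms. An invertible a does exist among entire functions: it
   is k exp(q) for a constant k and a polynomial q without constant term, chosen
   so that (k exp q)^6 p1 and p2 agree to order n - 1 at 0. The quotient of the
   difference by x^(n-1) is an entire function ([analytic_unit]), and y absorbs
   it. *)

Set Implicit Arguments.
Unset Strict Implicit.
Unset Printing Implicit Defensive.

Import Order.TTheory GRing.Theory Num.Theory.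
Import numFieldNormedType.Exports.
Local Open Scope ring_scope.

(** * Locally nilpotent derivations of a field *)

Section NilpotentDerivations.
Variables (Q : fieldType) (D : Q -> Q).

Definition derivation := (forall a b, D (a + b) = D a + D b) /\
  (forall a b, D (a * b) = D a * b + a * D b).

Hypothesis DD : derivation.

Lemma derD a b : D (a + b) = D a + D b. Proof. exact: DD.1. Qed.
Lemma derM a b : D (a * b) = D a * b + a * D b. Proof. exact: DD.2. Qed.
Lemma der0 : D 0 = 0.
Proof. by apply: (@addrI _ (D 0)); rewrite -derD !addr0. Qed.
Lemma derN a : D (- a) = - D a.
Proof. by apply: (@addrI _ (D a)); rewrite -derD !subrr der0. Qed.
Lemma derB a b : D (a - b) = D a - D b. Proof. by rewrite derD derN. Qed.
Lemma der1 : D 1 = 0.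
Proof. by apply: (@addrI _ (D 1)); rewrite addr0 -[in RHS](mulr1 1) derM mulr1 mul1r. Qed.
Lemma derX a n : D (a ^+ n) = n%:R * a ^+ n.-1 * D a.
Proof.
elim: n => [|n IHn]; first by rewrite expr0 der1 !mul0r.
rewrite exprS derM IHn; case: n {IHn} => [|n] /=; first by rewrite expr0; ring.
rewrite !exprS -[in RHS]natr1; ring.
Qed.

Lemma derV a : a != 0 -> D a^-1 = - D a / a ^+ 2.
Proof.
move=> a0; have : D (a * a^-1) = 0 by rewrite mulfV // der1.
rewrite derM => /eqP; rewrite addr_eq0 => /eqP h.
apply: (mulfI a0); apply: oppr_inj; rewrite -h; field; exact: a0.
Qed.

Lemma derXz (a : Q) (i : int) : a != 0 -> D (a ^ i) = i%:~R * a ^ (i - 1) * D a.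
Proof.
move=> a0; case: i => i.
  case: i => [|i]; first by rewrite expr0z der1 !mul0r.
  have -> : Posz i.+1 - 1 = i :> int by lia.
  by rewrite -!exprnP derX.
rewrite NegzE -exprnN derV ?expf_neq0 // derX.
have -> : - Posz i.+1 - 1 = - Posz i.+2 :> int by lia.
rewrite -exprnN mulrNz /= -pmulrn !exprS.
by field; rewrite a0 expf_neq0.
Qed.

Definition nilp a := exists k, iter k D a = 0.

Lemma iterD0 k : iter k D 0 = 0.
Proof. by elim: k => //= k ->; rewrite der0. Qed.
Lemma iterDD k a b : iter k D (a + b) = iter k D a + iter k D b.
Proof. by elim: k => //= k ->; rewrite derD. Qed.
Lemma iterDcM k c a : D c = 0 -> iter k D (c * a) = c * iter k D a.
Proof. by move=> Dc; elim: k => //= k ->; rewrite derM Dc mul0r add0r. Qed.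
Lemma iterD_ge k l a : (k <= l)%N -> iter k D a = 0 -> iter l D a = 0.
Proof. by move=> /subnK <- h; rewrite iterD h iterD0. Qed.

Lemma nilpD a b : nilp a -> nilp b -> nilp (a + b).
Proof.
move=> [k hk] [l hl]; exists (k + l)%N; rewrite iterDD.
by rewrite (iterD_ge _ hk) ?leq_addr // (iterD_ge _ hl) ?leq_addl // addr0.
Qed.

Lemma nilp_der a : nilp a -> nilp (D a).
Proof. by move=> [k hk]; exists k; rewrite -iterSr /= hk der0. Qed.

Lemma nilpM a b : nilp a -> nilp b -> nilp (a * b).
Proof.
move=> [k hk] [l hl]; exists (k + l)%N.
move: {2}(k + l)%N (erefl (k + l)%N) => N eN.
elim: N k l eN a b hk hl => [|N IH].
  by move=> k l /eqP; rewrite addn_eq0 => /andP[/eqP -> /eqP ->] a b /= -> _; rewrite mul0r.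
move=> [|k] [|l] eN a b hk hl.
- have -> : a = 0 by []; by rewrite mul0r iterD0.
- have -> : a = 0 by []; by rewrite mul0r iterD0.
- have -> : b = 0 by []; by rewrite mulr0 iterD0.
have hk' : iter k D (D a) = 0 by rewrite -iterSr.
have hl' : iter l D (D b) = 0 by rewrite -iterSr.
rewrite addSn iterSr derM iterDD -[X in iter X _ (a * _)]addSnnS (IH k.+1 l) ?(IH k l.+1) ?addr0 //; lia.
Qed.

Lemma nilpX a n : nilp a -> nilp (a ^+ n).
Proof.
move=> ha; elim: n => [|n IH]; first by exists 1%N; rewrite /= expr0 der1.
by rewrite exprS; apply: nilpM.
Qed.

(** The degree of a when D acts as a formal derivative. It is additive on products
   and drops by 1 under D. *)
Definition ldeg a k := iter k D a != 0 /\ iter k.+1 D a = 0.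

Lemma ldeg_ex a : nilp a -> a != 0 -> exists k, ldeg a k.
Proof.
move=> [k hk] a0; elim: k hk => [|k IH] hk; first by move: hk a0 => /= ->; rewrite eqxx.
by have [/eqP|h] := boolP (iter k D a == 0); [exact: IH | exists k].
Qed.

Lemma ldeg_inj a k l : ldeg a k -> ldeg a l -> k = l.
Proof.
move=> [h1 h2] [h3 h4]; apply/eqP; rewrite eqn_leq.
apply/andP; split; rewrite leqNgt; apply/negP => h.
  by move: h1; rewrite (iterD_ge h h4) eqxx.
by move: h3; rewrite (iterD_ge h h2) eqxx.
Qed.

Lemma ldeg_der a k : ldeg a k.+1 -> ldeg (D a) k.
Proof. by rewrite /ldeg -!iterSr. Qed.

Lemma ldeg_derP a k : ldeg a k -> D a != 0 -> exists2 l, k = l.+1 & ldeg (D a) l.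
Proof.
case: k => [|k] h; first by case: h => _ /= ->; rewrite eqxx.
by exists k => //; apply: ldeg_der.
Qed.

Hypothesis char0 : forall n : nat, (n.+1)%:R != 0 :> Q.

(** In the binomial expansion of D^(k + l) (a * b) only the term
   D^k a * D^l b survives, with a binomial coefficient that is not 0 in
   characteristic 0. *)
Lemma ldegM a b k l : ldeg a k -> ldeg b l -> ldeg (a * b) (k + l).
Proof.
move=> [ha ha'] [hb hb'].
suff [h1 h2] : iter (k + l) D (a * b) = 'C(k + l, k)%:R * (iter k D a * iter l D b)
    /\ iter (k + l).+1 D (a * b) = 0.
  split=> //; rewrite h1 !mulf_neq0 //.
  by have := bin_gt0 (k + l) k; rewrite leq_addr; case: binomial.
move: ha' hb'; clear ha hb.
move: {2}(k + l)%N (erefl (k + l)%N) => N eN.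
elim: N k l eN a b => [|N IH].
  move=> k l /eqP; rewrite addn_eq0 => /andP[/eqP -> /eqP ->] a b /= ha hb; rewrite bin0 mul1r; split=> //.
  by rewrite derM ha hb mul0r mulr0 addr0.
move=> k l eN a b ha hb.
rewrite eN !iterSr derM !iterDD.
case: k ha eN => [|k] ha eN.
  move: ha => /= ha; rewrite ha mul0r !iterD0 !add0r.
  case: l hb eN => [|l] // hb [eN].
  have [] := IH 0%N l eN a (D b) ha; first by rewrite -iterSr.
  by rewrite -iterSr -iterSr eN => -> ->; rewrite !bin0.
case: l hb eN => [|l] hb eN.
  rewrite addn0 in eN; case: eN => eN.
  move: hb => /= hb; rewrite hb mulr0 !iterD0 !addr0.
  have [] := IH k 0%N _ (D a) b; rewrite ?addn0 //; try lia.
    by rewrite -iterSr.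
  by rewrite -iterSr -iterSr eN => -> ->; rewrite !binn.
move: eN => [eN].
have [] := IH k l.+1 eN (D a) b; rewrite -?iterSr // => h1 h2.
have [] := IH k.+1 l _ a (D b); rewrite -?iterSr //; first lia.
have eN' : (k.+1 + l = N)%N by lia.
rewrite eN' => h3 h4; rewrite eN in h1 h2.
rewrite iterDD h2 h4 addr0; split=> //.
by rewrite h1 h3 binS natrD; ring.
Qed.

(** Kernels of locally nilpotent derivations are factorially closed, since the
   factors of an element of degree 0 have degree 0. *)
Lemma nilp_neq0M a b : nilp a -> nilp b -> a * b != 0 -> D (a * b) = 0 ->
  D a = 0 /\ D b = 0.
Proof.
rewrite mulf_eq0 negb_or => na nb /andP[a0 b0] Dab.
have [k hk] := ldeg_ex na a0; have [l hl] := ldeg_ex nb b0.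
have h : ldeg (a * b) 0 by split=> //=; rewrite mulf_neq0.
have /eqP := ldeg_inj (ldegM hk hl) h.
by rewrite addn_eq0 => /andP[/eqP k0 /eqP l0]; move: hk hl; rewrite k0 l0 => -[_ ?] [_ ?].
Qed.

Lemma nilp_Xker a n : nilp a -> a != 0 -> D (a ^+ n.+1) = 0 -> D a = 0.
Proof.
move=> na a0; rewrite exprS => /(nilp_neq0M na (nilpX n na)).
by rewrite -exprS expf_neq0 // => /(_ isT)[].
Qed.

Lemma ldegX a k n : ldeg a k -> ldeg (a ^+ n) (n * k).
Proof.
move=> h; elim: n => [|n IH]; first by rewrite expr0 mul0n; split=> /=; rewrite ?oner_neq0 ?der1.
by rewrite exprS mulSn; apply: ldegM.
Qed.

(** The degree count behind Mason's theorem, where w is a weighted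
   Wronskian of a and b. If neither a nor b is in the kernel, then the first
   equation gives deg a < deg b and the second gives deg b < deg a. *)
Lemma wronskian_ker a b w c1 c2 m k : nilp a -> nilp b -> nilp w ->
    D c1 = 0 -> D c2 = 0 -> a != 0 -> b != 0 -> c1 != 0 -> c2 != 0 ->
    a ^+ m.+1 * w = c1 * D b -> b ^+ k.+1 * w = c2 * D a -> D a = 0 /\ D b = 0.
Proof.
move=> na nb nw Dc1 Dc2 a0 b0 c10 c20 e1 e2.
have [w0|w0] := eqVneq w 0.
  move: e1 e2; rewrite w0 !mulr0 => /esym/eqP; rewrite mulf_eq0 (negPf c10) /= => /eqP ->.
  by move=> /esym/eqP; rewrite mulf_eq0 (negPf c20) /= => /eqP ->.
have [da hda] := ldeg_ex na a0; have [db hdb] := ldeg_ex nb b0.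
have [dw hdw] := ldeg_ex nw w0.
have ldegc c : D c = 0 -> c != 0 -> ldeg c 0 by [].
have Da0 : D a != 0.
  by apply: contra_neq (mulf_neq0 (expf_neq0 k.+1 b0) w0) => h; rewrite e2 h mulr0.
have Db0 : D b != 0.
  by apply: contra_neq (mulf_neq0 (expf_neq0 m.+1 a0) w0) => h; rewrite e1 h mulr0.
have [da' eda hda'] := ldeg_derP hda Da0.
have [db' edb hdb'] := ldeg_derP hdb Db0.
have h1 := ldegM (ldegX m.+1 hda) hdw.
rewrite e1 in h1; have := ldeg_inj h1 (ldegM (ldegc _ Dc1 c10) hdb').
have h2 := ldegM (ldegX k.+1 hdb) hdw.
rewrite e2 in h2; have := ldeg_inj h2 (ldegM (ldegc _ Dc2 c20) hda').
rewrite eda edb; nia.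
Qed.

Section Surface.
Variables (x y z t : Q) (n : nat).
Hypotheses (hn : (1 < n)%N) (nx : nilp x) (nz : nilp z) (nt : nilp t).
Hypotheses (x0 : x != 0) (y0 : y != 0) (z0 : z != 0) (t0 : t != 0).
Hypotheses (Dy : D y = 0) (rel : x ^+ n * y + z ^+ 2 + t ^+ 3 = 0).

Let nilpNat k : nilp k%:R.
Proof.
elim: k => [|k IH]; first by exists 0%N.
by rewrite -natr1; apply: nilpD => //; exists 1%N; rewrite /= der1.
Qed.

Let derNat k : D k%:R = 0.
Proof. by elim: k => [|k IH]; rewrite ?der0 // -natr1 derD IH der1 addr0. Qed.

Let nilpB a b : nilp a -> nilp b -> nilp (a - b).
Proof.
move=> na nb; apply: nilpD => //; rewrite -mulN1r; apply: nilpM => //.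
by exists 1%N; rewrite /= derN der1 oppr0.
Qed.

Let drel : n%:R * x ^+ n.-1 * D x * y + 2%:R * z * D z + 3%:R * t ^+ 2 * D t = 0.
Proof. by have := congr1 D rel; rewrite der0 !derD derM Dy !derX mulr0 addr0 => <-. Qed.

(** Elimination between the relation and its derivative expresses D z and D t,
   up to factors in the kernel, as multiples of one weighted Wronskian by powers
   of t and of z, so that [wronskian_ker] applies. When z or t is in the kernel,
   the pair consists of x and the other one. *)
Lemma cusp_ker_trivial mu : mu != 0 -> D mu = 0 -> z ^+ 2 + mu * t ^+ 3 != 0 ->
  D (z ^+ 2 + mu * t ^+ 3) = 0 -> [/\ D x = 0, D z = 0 & D t = 0].
Proof.
move=> mu0 Dmu; set r := _ + _ => r0 Dr.
have dr : 2%:R * z * D z + mu * (3%:R * t ^+ 2 * D t) = 0.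
  by rewrite -Dr derD derM !derX Dmu /=; ring.
have [|||||||||Dz Dt] // := @wronskian_ker z t (2%:R * t * D z - 3%:R * z * D t) (- 3%:R * r) (2%:R * mu^-1 * r) 0 1 nz nt.
- by apply: nilpB; rewrite -mulrA; apply: nilpM => //; apply: nilpM => //; apply: nilp_der.
- by rewrite derM derN derNat Dr; ring.
- by rewrite !derM derNat Dr derV // Dmu; ring.
- by rewrite mulf_neq0 // oppr_eq0 char0.
- by rewrite !mulf_neq0 ?invr_eq0 // char0.
- rewrite /r; apply/eqP; rewrite -subr_eq0; apply/eqP.
  by rewrite -(mulr0 t) -dr; ring.
- rewrite /r; apply/eqP; rewrite -subr_eq0; apply/eqP.
  by rewrite -(mulr0 (- z / mu)) -dr; field.
split=> //; have /eqP := drel; rewrite Dz Dt !mulr0 !addr0 !mulf_eq0.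
by case: (n) hn => // k _; rewrite (negPf (char0 _)) (negPf (expf_neq0 _ x0)) (negPf y0) orbF => /eqP.
Qed.

Lemma x_ker_trivial : D x = 0 -> [/\ D x = 0, D z = 0 & D t = 0].
Proof.
move=> Dx; apply: (@cusp_ker_trivial 1); rewrite ?oner_neq0 ?der1 // mul1r.
  have /eqP := rel; rewrite -addrA addrC addr_eq0 => /eqP ->.
  by rewrite oppr_eq0 mulf_neq0 // expf_neq0.
by have := congr1 D rel; rewrite -addrA derD derM Dy derX Dx !(mulr0, mul0r, add0r) der0.
Qed.

Lemma z_ker_trivial : D z = 0 -> [/\ D x = 0, D z = 0 & D t = 0].
Proof.
move=> Dz; move: hn drel rel; case: n => // -[] // m _ /=; rewrite Dz mulr0 addr0 => dr rl.
have [|||||||||Dx Dt] // := @wronskian_ker x t (m.+2%:R * t * D x - 3%:R * x * D t) (3%:R * z ^+ 2 / y) (- m.+2%:R * z ^+ 2) m 1 nx nt.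
- by apply: nilpB; rewrite -mulrA; apply: nilpM => //; apply: nilpM => //; apply: nilp_der.
- by rewrite !derM derNat derV // Dz Dy; ring.
- by rewrite !derM derN derNat Dz; ring.
- by rewrite !mulf_neq0 ?invr_eq0 ?expf_neq0 // char0.
- by rewrite !mulf_neq0 ?invr_eq0 ?expf_neq0 ?oppr_eq0 // char0.
- apply: (mulIf y0); apply/eqP; rewrite -subr_eq0; apply/eqP.
  have -> : z ^+ 2 = - (x ^+ m.+2 * y + t ^+ 3).
    by apply/eqP; rewrite -subr_eq0; apply/eqP; rewrite -rl; ring.
  by rewrite -(mulr0 t) -dr !exprS; field.
- apply/eqP; rewrite -subr_eq0; apply/eqP.
  have -> : z ^+ 2 = - (x ^+ m.+2 * y + t ^+ 3).
    by apply/eqP; rewrite -subr_eq0; apply/eqP; rewrite -rl; ring.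
  by rewrite -(mulr0 (- x)) -dr !exprS; ring.
Qed.

Lemma t_ker_trivial : D t = 0 -> [/\ D x = 0, D z = 0 & D t = 0].
Proof.
move=> Dt; move: hn drel rel; case: n => // -[] // m _ /=; rewrite Dt mulr0 addr0 => dr rl.
have [|||||||||Dx Dz] // := @wronskian_ker x z (m.+2%:R * z * D x - 2%:R * x * D z) (2%:R * t ^+ 3 / y) (- m.+2%:R * t ^+ 3) m 0 nx nz.
- by apply: nilpB; rewrite -mulrA; apply: nilpM => //; apply: nilpM => //; apply: nilp_der.
- by rewrite !derM derNat derV // Dt Dy; ring.
- by rewrite !derM derN derNat Dt; ring.
- by rewrite !mulf_neq0 ?invr_eq0 ?expf_neq0 // char0.
- by rewrite !mulf_neq0 ?invr_eq0 ?expf_neq0 ?oppr_eq0 // char0.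
- apply: (mulIf y0); apply/eqP; rewrite -subr_eq0; apply/eqP.
  have -> : t ^+ 3 = - (x ^+ m.+2 * y + z ^+ 2).
    by apply/eqP; rewrite -subr_eq0; apply/eqP; rewrite -rl; ring.
  by rewrite -(mulr0 z) -dr !exprS; field.
- apply/eqP; rewrite -subr_eq0; apply/eqP.
  have -> : t ^+ 3 = - (x ^+ m.+2 * y + z ^+ 2).
    by apply/eqP; rewrite -subr_eq0; apply/eqP; rewrite -rl; ring.
  by rewrite -(mulr0 (- x)) -dr !exprS; ring.
Qed.
End Surface.
End NilpotentDerivations.

(** * Derivations and morphisms of a field of fractions *)

Section FractionExtension.
Variables (R : idomainType) (F : fieldType) (iota : {rmorphism R -> F}).
Hypothesis iota_inj : injective iota.
Hypothesis iota_frac : forall u, exists a b, b != 0 /\ u = iota a / iota b.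

Lemma iota_eq a b : (iota a == iota b) = (a == b).
Proof. exact: inj_eq. Qed.

Lemma iota_neq0 a : (iota a != 0) = (a != 0).
Proof. by rewrite -(rmorph0 iota) iota_eq. Qed.

Let frac_pair u : exists ab : R * R, (ab.2 != 0) && (u == iota ab.1 / iota ab.2).
Proof. by have [a [b [b0 ->]]] := iota_frac u; exists (a, b); rewrite b0 eqxx. Qed.

Definition fnum u : R := (xchoose (frac_pair u)).1.
Definition fden u : R := (xchoose (frac_pair u)).2.

Lemma fden_neq0 u : fden u != 0.
Proof. by have /andP[] := xchooseP (frac_pair u). Qed.

Lemma fracK u : u = iota (fnum u) / iota (fden u).
Proof. by have /andP[_ /eqP] := xchooseP (frac_pair u). Qed.

Lemma frac_ind (P : F -> Prop) : (forall a b, b != 0 -> P (iota a / iota b)) -> forall u, P u.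
Proof. by move=> h u; rewrite (fracK u); apply: h; apply: fden_neq0. Qed.

Section Derivation.
Variable d : R -> F.
Hypothesis dD : forall a b, d (a + b) = d a + d b.
Hypothesis dM : forall a b, d (a * b) = d a * iota b + iota a * d b.

Definition frac_der (u : F) : F :=
  (d (fnum u) * iota (fden u) - iota (fnum u) * d (fden u)) / iota (fden u) ^+ 2.

(** The quotient rule does not depend on the representative: differentiating
   a * b' = a' * b gives the equality of the two numerators up to the factor
   b * b'. *)
Lemma frac_derE a b : b != 0 ->
  frac_der (iota a / iota b) = (d a * iota b - iota a * d b) / iota b ^+ 2.
Proof.
move=> b0; rewrite /frac_der; set u := iota a / iota b.
have := fracK u; move: (fden_neq0 u); set a' := fnum u; set b' := fden u => b'0.
have fb0 : iota b != 0 by rewrite iota_neq0.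
have fb'0 : iota b' != 0 by rewrite iota_neq0.
move=> /eqP; rewrite /u eqr_div // => /eqP e.
have := e; rewrite -!rmorphM => /eqP; rewrite iota_eq => /eqP /(congr1 d).
rewrite !dM => e2.
apply/eqP; rewrite eqr_div ?expf_neq0 // -subr_eq0; apply/eqP.
set A := iota a in e e2 *; set B := iota b in e e2 fb0 *; set A' := iota a' in e e2 *.
set B' := iota b' in e e2 fb'0 *.
have -> : (d a' * B' - A' * d b') * B ^+ 2 - (d a * B - A * d b) * B' ^+ 2
  = - B * B' * ((d a * B' + A * d b') - (d a' * B + A' * d b)) +
    (A * B' - A' * B) * (B' * d b + B * d b') by ring.
by rewrite e2 e !subrr mulr0 mul0r addr0.
Qed.

Lemma d0 : d 0 = 0.
Proof. by apply: (@addrI _ (d 0)); rewrite -dD !addr0. Qed.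
Lemma d1 : d 1 = 0.
Proof. by apply: (@addrI _ (d 1)); rewrite addr0 -[in RHS](mulr1 1) dM rmorph1 mulr1 mul1r. Qed.

Lemma frac_der_ext a : frac_der (iota a) = d a.
Proof.
by rewrite -[iota a]divr1 -(rmorph1 iota) frac_derE ?oner_neq0 // d1 rmorph1 !(mulr1, mulr0, subr0, expr1n, divr1).
Qed.

Lemma frac_der_derivation : derivation frac_der.
Proof.
split; elim/frac_ind=> a b b0; elim/frac_ind=> c e e0;
  have fb0 : iota b != 0 by rewrite iota_neq0.
all: have fe0 : iota e != 0 by rewrite iota_neq0.
  have -> : iota a / iota b + iota c / iota e = iota (a * e + c * b) / iota (b * e).
    by rewrite rmorphD !rmorphM; field; rewrite fb0 fe0.
  rewrite !frac_derE ?mulf_neq0 // dD !dM rmorphD !rmorphM; field; by rewrite fb0 fe0.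
have -> : iota a / iota b * (iota c / iota e) = iota (a * c) / iota (b * e).
  by rewrite !rmorphM; field; rewrite fb0 fe0.
rewrite !frac_derE ?mulf_neq0 // !dM !rmorphM; field; by rewrite fb0 fe0.
Qed.
End Derivation.

Section Morphism.
Variables (K : fieldType) (f : {rmorphism R -> K}).
Hypothesis f_inj : forall a, f a = 0 -> a = 0.

Definition frac_map (u : F) : K := f (fnum u) / f (fden u).

Let f_neq0 a : a != 0 -> f a != 0. Proof. by apply: contra_neq => /f_inj. Qed.

Lemma frac_mapE a b : b != 0 -> frac_map (iota a / iota b) = f a / f b.
Proof.
move=> b0; rewrite /frac_map; set u := iota a / iota b.
have := fracK u; move: (fden_neq0 u); set a' := fnum u; set b' := fden u => b'0.
have fb0 : iota b != 0 by rewrite iota_neq0.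
have fb'0 : iota b' != 0 by rewrite iota_neq0.
move=> /eqP; rewrite /u eqr_div // -!rmorphM iota_eq => /eqP /(congr1 f).
by rewrite !rmorphM => e; apply/eqP; rewrite eqr_div ?f_neq0 //; apply/eqP.
Qed.

Lemma frac_map_ext a : frac_map (iota a) = f a.
Proof. by rewrite -[iota a]divr1 -(rmorph1 iota) frac_mapE ?oner_neq0 // rmorph1 divr1. Qed.

Lemma frac_map_rmorph : exists g : {rmorphism F -> K}, forall a, g (iota a) = f a.
Proof.
have fD : {morph frac_map : u v / u - v}.
  elim/frac_ind=> a b b0; elim/frac_ind=> c e e0.
  have fb0 : iota b != 0 by rewrite iota_neq0.
  have fe0 : iota e != 0 by rewrite iota_neq0.
  have -> : iota a / iota b - iota c / iota e = iota (a * e - c * b) / iota (b * e).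
    by rewrite rmorphB !rmorphM; field; rewrite fb0 fe0.
  rewrite !frac_mapE ?mulf_neq0 // rmorphB !rmorphM; field.
  by rewrite !f_neq0.
have fM : monoid_morphism frac_map.
  split; first by rewrite -(rmorph1 iota) frac_map_ext rmorph1.
  elim/frac_ind=> a b b0; elim/frac_ind=> c e e0.
  have fb0 : iota b != 0 by rewrite iota_neq0.
  have fe0 : iota e != 0 by rewrite iota_neq0.
  have -> : iota a / iota b * (iota c / iota e) = iota (a * c) / iota (b * e).
    by rewrite !rmorphM; field; rewrite fb0 fe0.
  rewrite !frac_mapE ?mulf_neq0 // !rmorphM; field.
  by rewrite !f_neq0.
pose m1 := GRing.isZmodMorphism.Build F K frac_map fD.
pose m2 := GRing.isMonoidMorphism.Build F K frac_map fM.
pose g : {rmorphism F -> K} := HB.pack frac_map m1 m2.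
by exists g => a; rewrite -frac_map_ext.
Qed.
End Morphism.
End FractionExtension.

Lemma tofrac_inj (R : idomainType) : injective (@FracField.tofrac R).
Proof. by move=> a b /eqP; rewrite tofrac_eq => /eqP. Qed.

Lemma tofrac_frac (R : idomainType) (u : {fraction R}) :
  exists a b : R, b != 0 /\ u = FracField.tofrac a / FracField.tofrac b.
Proof.
elim/quotW: u => x; exists (frac x).1, (frac x).2; have d0 := denom_ratioP x; split=> //.
have d0' : FracField.tofrac (frac x).2 != 0 by rewrite tofrac_eq0.
apply: (mulIf d0'); rewrite divfK //.
rewrite -[_ * _]/(FracField.mul _ _) !piE; apply/eqmodP.
rewrite /= FracField.equivfE /FracField.mulf.
by rewrite !numden_Ratio ?(oner_eq0, mulf_neq0) // !mulr1 mulrC.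
Qed.

(** * The polynomial ring C[z, t] *)

Section PolyDerivations.
Variables (A : comNzRingType).

Lemma map_polyC0 (d : A -> A) c : d 0 = 0 -> map_poly d c%:P = (d c)%:P.
Proof. by move=> d0; apply/polyP=> i; rewrite coef_map_id0 // !coefC; case: eqP. Qed.

Lemma map_polyX0 (d : A -> A) : d 0 = 0 -> d 1 = 0 -> map_poly d 'X = 0.
Proof. by move=> d0 d1; apply/polyP=> i; rewrite coef_map_id0 // coefX coef0; case: eqP. Qed.

Lemma map_polyD_add (d : A -> A) : d 0 = 0 -> (forall a b, d (a + b) = d a + d b) ->
  forall p q : {poly A}, map_poly d (p + q) = map_poly d p + map_poly d q.
Proof.
by move=> d0 dD p q; apply/polyP=> i; rewrite coefD !coef_map_id0 // coefD dD.
Qed.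

Lemma map_poly_leibniz (d : A -> A) : d 0 = 0 -> (forall a b, d (a + b) = d a + d b) ->
  (forall a b, d (a * b) = d a * b + a * d b) ->
  forall p q : {poly A}, map_poly d (p * q) = map_poly d p * q + p * map_poly d q.
Proof.
move=> d0 dD dM p q; apply/polyP=> i.
rewrite coefD coef_map_id0 // !coefM (big_morph d dD d0) -big_split.
by apply: eq_bigr => j _; rewrite dM !coef_map_id0.
Qed.

Lemma poly_der_ext (E : comNzRingType) (f : {rmorphism {poly A} -> E}) (d d' : {poly A} -> E) :
  (forall a b, d (a + b) = d a + d b) -> (forall a b, d (a * b) = d a * f b + f a * d b) ->
  (forall a b, d' (a + b) = d' a + d' b) -> (forall a b, d' (a * b) = d' a * f b + f a * d' b) ->
  (forall c, d c%:P = d' c%:P) -> d 'X = d' 'X -> d =1 d'.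
Proof.
move=> dD dM d'D d'M dC dX; elim/poly_ind => [|p c IH]; first by rewrite -[0]/(0%:P) dC.
by rewrite dD d'D dM d'M IH dX dC.
Qed.

(** The chain rule. It is stated for scalars with two partial derivatives so that
   it can be used twice, to reach two and then three variables. *)
Lemma poly_der_formula (E : comNzRingType) (f : {rmorphism {poly A} -> E}) (d : {poly A} -> E)
    (d1 d2 : A -> A) (e1 e2 : E) :
  (forall a b, d (a + b) = d a + d b) -> (forall a b, d (a * b) = d a * f b + f a * d b) ->
  (forall a b, d1 (a + b) = d1 a + d1 b) -> (forall a b, d1 (a * b) = d1 a * b + a * d1 b) ->
  (forall a b, d2 (a + b) = d2 a + d2 b) -> (forall a b, d2 (a * b) = d2 a * b + a * d2 b) ->
  (forall c, d c%:P = f (d1 c)%:P * e1 + f (d2 c)%:P * e2) ->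
  forall p, d p = f p^`() * d 'X + f (map_poly d1 p) * e1 + f (map_poly d2 p) * e2.
Proof.
move=> dD dM d1D d1M d2D d2M dC.
have z1 : d1 0 = 0 by apply: (@addrI _ (d1 0)); rewrite -d1D !addr0.
have z2 : d2 0 = 0 by apply: (@addrI _ (d2 0)); rewrite -d2D !addr0.
have u1 : d1 1 = 0 by apply: (@addrI _ (d1 1)); rewrite addr0 -[in RHS](mulr1 1) d1M mulr1 mul1r.
have u2 : d2 1 = 0 by apply: (@addrI _ (d2 1)); rewrite addr0 -[in RHS](mulr1 1) d2M mulr1 mul1r.
pose d' p := f p^`() * d 'X + f (map_poly d1 p) * e1 + f (map_poly d2 p) * e2.
apply: (@poly_der_ext E f d d') => //.
- by move=> a b; rewrite /d' derivD !map_polyD_add // !rmorphD; ring.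
- by move=> a b; rewrite /d' derivM !map_poly_leibniz // !rmorphD !rmorphM; ring.
- by move=> c; rewrite /d' derivC rmorph0 mul0r add0r !map_polyC0.
by rewrite /d' derivX rmorph1 mul1r !map_polyX0 // rmorph0 !mul0r !addr0.
Qed.

Lemma poly_rmorph_ext (E : nzRingType) (f g : {rmorphism {poly A} -> E}) :
  (forall c, f c%:P = g c%:P) -> f 'X = g 'X -> f =1 g.
Proof.
move=> fC fX; elim/poly_ind => [|p c IH]; first by rewrite !rmorph0.
by rewrite !rmorphD !rmorphM /= IH fX fC.
Qed.
End PolyDerivations.

Section Evaluation.
Variables (A : comNzRingType) (E : comNzRingType) (f : {rmorphism A -> E}) (u : E).
Definition pev : {poly A} -> E := horner_morph (fun a => mulrC u (f a)).
HB.instance Definition _ := GRing.RMorphism.on pev.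
Lemma pevC c : pev c%:P = f c. Proof. exact: horner_morphC. Qed.
Lemma pevX : pev 'X = u. Proof. exact: horner_morphX. Qed.
Lemma pevE p : pev p = (map_poly f p).[u]. Proof. by []. Qed.
End Evaluation.

Section Ambient.
Variable C : numClosedFieldType.
Local Notation S := {poly {poly C}}.

Definition sz : S := 'X.
Definition st : S := 'X%:P.
Definition scst (c : C) : S := c%:P%:P.
HB.instance Definition _ := GRing.RMorphism.copy scst (polyC \o polyC).

Definition Sdz (s : S) : S := s^`().
Definition Sdt (s : S) : S := map_poly (@deriv C) s.

Lemma SdzD : {morph Sdz : a b / a + b}. Proof. exact: derivD. Qed.
Lemma SdzM a b : Sdz (a * b) = Sdz a * b + a * Sdz b. Proof. exact: derivM. Qed.
Lemma SdtD : {morph Sdt : a b / a + b}.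
Proof. by apply: map_polyD_add; [exact: deriv0|exact: derivD]. Qed.
Lemma SdtM a b : Sdt (a * b) = Sdt a * b + a * Sdt b.
Proof. by apply: map_poly_leibniz; [exact: deriv0|exact: derivD|exact: derivM]. Qed.
Lemma Sdt0 : Sdt 0 = 0. Proof. exact: map_poly0. Qed.

Lemma SdtC c : Sdt c%:P = c^`()%:P. Proof. by rewrite /Sdt map_polyC0 // deriv0. Qed.
Lemma SdtX : Sdt sz = 0.
Proof. by apply: map_polyX0; [exact: deriv0|rewrite -[1]/(1%:P) derivC]. Qed.

Lemma Sdzz : Sdz sz = 1. Proof. exact: derivX. Qed.
Lemma Sdzt : Sdz st = 0. Proof. exact: derivC. Qed.
Lemma Sdtt : Sdt st = 1. Proof. by rewrite SdtC derivX. Qed.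
Lemma Sdz_cst c : Sdz (scst c) = 0. Proof. exact: derivC. Qed.
Lemma Sdt_cst c : Sdt (scst c) = 0. Proof. by rewrite SdtC derivC polyC0. Qed.

Lemma Sder_formula (E : comNzRingType) (f : {rmorphism S -> E}) (d : S -> E) :
  (forall a b, d (a + b) = d a + d b) -> (forall a b, d (a * b) = d a * f b + f a * d b) ->
  (forall c, d (scst c) = 0) -> forall s, d s = f (Sdz s) * d sz + f (Sdt s) * d st.
Proof.
move=> dD dM dc.
have h1 u : d u%:P = f (u^`())%:P * d st.
  have := @poly_der_formula C E (f \o polyC) (fun u => d u%:P) (fun=> 0) (fun=> 0) 0 0.
  move=> h; refine (etrans (h _ _ _ _ _ _ _ u) _).
  - by move=> a b; rewrite polyCD dD.
  - by move=> a b; rewrite polyCM dM.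
  - by move=> _ _; rewrite addr0.
  - by move=> a b; rewrite mul0r mulr0 addr0.
  - by move=> _ _; rewrite addr0.
  - by move=> a b; rewrite mul0r mulr0 addr0.
  - by move=> c; rewrite !mulr0 addr0 -(dc c).
  - by rewrite !mulr0 !addr0.
have := @poly_der_formula {poly C} E f d (@deriv C) (@deriv C) (d st) 0.
move=> h s; refine (etrans (h _ _ _ _ _ _ _ s) _) => //.
- exact: derivD.
- exact: derivM.
- exact: derivD.
- exact: derivM.
- by move=> c; rewrite mulr0 addr0 (h1 c).
by rewrite mulr0 addr0.
Qed.

(** Weights for which z^2 + t^3 is homogeneous: z has weight 3 and t has weight 2. *)
Definition wle (w : int) (s : S) := forall k l : nat, s`_k`_l != 0 -> Posz (3 * k + 2 * l) <= w.
Definition whom (w : int) (s : S) := forall k l : nat, s`_k`_l != 0 -> Posz (3 * k + 2 * l) = w.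

Lemma wle0 w : wle w 0. Proof. by move=> k l; rewrite !coef0 eqxx. Qed.
Lemma whom0 w : whom w 0. Proof. by move=> k l; rewrite !coef0 eqxx. Qed.
Lemma whom_wle w s : whom w s -> wle w s. Proof. by move=> h k l /h ->. Qed.
Lemma wle_mono w w' s : w <= w' -> wle w s -> wle w' s.
Proof. by move=> le h k l /h h'; apply: le_trans le. Qed.
Lemma wleD w s s' : wle w s -> wle w s' -> wle w (s + s').
Proof.
move=> h h' k l; rewrite !coefD; have [->|/h //] := eqVneq s`_k`_l 0.
by rewrite add0r => /h'.
Qed.
Lemma whomD w s s' : whom w s -> whom w s' -> whom w (s + s').
Proof.
move=> h h' k l; rewrite !coefD; have [->|/h //] := eqVneq s`_k`_l 0.
by rewrite add0r => /h'.
Qed.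
Lemma wleN w s : wle w s -> wle w (- s).
Proof. by move=> h k l; rewrite !coefN oppr_eq0 => /h. Qed.
Lemma whomN w s : whom w s -> whom w (- s).
Proof. by move=> h k l; rewrite !coefN oppr_eq0 => /h. Qed.

Lemma coef2M_neq0 (s s' : S) k l : (s * s')`_k`_l != 0 -> exists k1 l1 k2 l2 : nat,
  [/\ s`_k1`_l1 != 0, s'`_k2`_l2 != 0, (k1 + k2 = k)%N & (l1 + l2 = l)%N].
Proof.
rewrite coefM coef_sum => h.
have [i hi] : exists i : 'I_k.+1, (s`_i * s'`_(k - i))`_l != 0.
  by apply/existsP; apply: contraNT h; rewrite negb_exists => /forallP h; rewrite big1 // => i _; apply/eqP; rewrite -[_ == _]negbK.
move: hi; rewrite coefM => hi.
have [j hj] : exists j : 'I_l.+1, s`_i`_j * s'`_(k - i)`_(l - j) != 0.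
  by apply/existsP; apply: contraNT hi; rewrite negb_exists => /forallP hj; rewrite big1 // => j _; apply/eqP; rewrite -[_ == _]negbK.
move: hj; rewrite mulf_eq0 negb_or => /andP[h1 h2].
exists i, j, (k - i)%N, (l - j)%N; split=> //; rewrite subnKC // -ltnS; exact: ltn_ord.
Qed.

Lemma wleM w w' s s' : wle w s -> wle w' s' -> wle (w + w') (s * s').
Proof.
move=> h h' k l /coef2M_neq0[k1 [l1 [k2 [l2 [/h e /h' e' <- <-]]]]]; lia.
Qed.
Lemma whomM w w' s s' : whom w s -> whom w' s' -> whom (w + w') (s * s').
Proof.
move=> h h' k l /coef2M_neq0[k1 [l1 [k2 [l2 [/h e /h' e' <- <-]]]]]; lia.
Qed.
Lemma wle_dz w s : wle w s -> wle (w - 3) (Sdz s).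
Proof.
move=> h k l; rewrite coef_deriv coefMn mulrn_eq0 /= => /h; lia.
Qed.
Lemma wle_dt w s : wle w s -> wle (w - 2) (Sdt s).
Proof.
move=> h k l; rewrite coef_map_id0 ?deriv0 // coef_deriv mulrn_eq0 /= => /h; lia.
Qed.
Lemma whom_dz w s : whom w s -> whom (w - 3) (Sdz s).
Proof.
move=> h k l; rewrite coef_deriv coefMn mulrn_eq0 /= => /h; lia.
Qed.
Lemma whom_dt w s : whom w s -> whom (w - 2) (Sdt s).
Proof.
move=> h k l; rewrite coef_map_id0 ?deriv0 // coef_deriv mulrn_eq0 /= => /h; lia.
Qed.
Lemma whom_uniq w w' s : whom w s -> whom w' s -> s != 0 -> w = w'.
Proof.
move=> h h' s0; have [/existsP[k /existsP[l nz]]|] := boolP [exists k : 'I_(size s), exists l : 'I_(size s`_k), s`_k`_l != 0].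
  by rewrite -(h _ _ nz) (h' _ _ nz).
have kp : ((size s).-1 < size s)%N by rewrite prednK // size_poly_gt0.
rewrite negb_exists => /forallP /(_ (Ordinal kp)); rewrite negb_exists.
have s0' : s`_(size s).-1 != 0 by rewrite -lead_coefE lead_coef_eq0.
set m := s`_(size s).-1 in s0' *.
have lp : ((size m).-1 < size m)%N by rewrite prednK // size_poly_gt0.
by move=> /forallP /(_ (Ordinal lp)) /=; rewrite negbK -/m -lead_coefE lead_coef_eq0 (negPf s0').
Qed.
Lemma whom_wle_lt0 w s : whom w s -> wle (w - 1) s -> s = 0.
Proof.
move=> h h'; apply/polyP=> k; apply/polyP=> l; rewrite !coef0.
by apply/eqP/negP=> /negP nz; have := h _ _ nz; have := h' _ _ nz; lia.
Qed.
Lemma whomC c : whom 0 c%:P%:P.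
Proof. by move=> [|k] [|l] //; rewrite ?coefC /= ?coefC /= ?coef0 ?eqxx. Qed.
Lemma whom_sz : whom 3 sz.
Proof. by move=> [|[|k]] [|l]; rewrite coefX /= ?coef1 ?coef0 ?eqxx. Qed.
Lemma whom_st : whom 2 st.
Proof. by move=> [|k] [|[|l]]; rewrite coefC /= ?coefX ?coef0 ?eqxx. Qed.

Definition wpart (w : int) (s : S) : S :=
  \poly_(k < size s) \poly_(l < size s`_k) (if Posz (3 * k + 2 * l) == w then s`_k`_l else 0).

Lemma coef_wpart w s k l : (wpart w s)`_k`_l = if Posz (3 * k + 2 * l) == w then s`_k`_l else 0.
Proof.
rewrite coef_poly; case: ltnP => [lk|gk]; last first.
  have -> : s`_k = 0 by apply: nth_default.
  by rewrite !coef0; case: ifP.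
rewrite coef_poly; case: ltnP => [ll|gl] //; have -> : s`_k`_l = 0 by apply: nth_default.
by case: ifP.
Qed.

Lemma whom_wpart w s : whom w (wpart w s).
Proof. by move=> k l; rewrite coef_wpart; case: (Posz _ =P w) => // _; rewrite eqxx. Qed.

Lemma wle_sub_wpart w s : wle w s -> wle (w - 1) (s - wpart w s).
Proof.
move=> h k l; rewrite !coefB coef_wpart; case: (Posz _ =P w) => [_|ne]; first by rewrite subrr eqxx.
by rewrite subr0 => /h; lia.
Qed.

Lemma wle_top s : exists w, wle w s /\ (s != 0 -> wpart w s != 0).
Proof.
have [N hN] : exists N : nat, wle N%:Z s.
  exists (3 * size s + 2 * \sum_(k < size s) size (s`_k)%R)%N => k l nz.
  have lk : (k < size s)%N.
    by rewrite ltnNge; apply: contra_neqN nz => h; rewrite (nth_default 0 h) coef0.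
  have ll : (l < size (s`_k)%R)%N.
    by rewrite ltnNge; apply: contra_neqN nz => h; rewrite (nth_default 0 h).
  have : (size (s`_k)%R <= \sum_(k < size s) size (s`_k)%R)%N.
    by rewrite (bigD1 (Ordinal lk)) //= leq_addr.
  lia.
elim: N hN => [|N IH] hN.
  exists 0; split=> // s0; apply: contra_neq s0 => e.
  have := wle_sub_wpart hN; rewrite e subr0 => h.
  apply/polyP=> k; apply/polyP=> l; rewrite !coef0; apply/eqP/negP=> /negP /h; lia.
have [e|ne] := eqVneq (wpart N.+1%:Z s) 0; last by exists N.+1%:Z.
apply: IH; have := wle_sub_wpart hN; rewrite e subr0; apply: wle_mono; lia.
Qed.

Lemma wle_lead s : exists w c, [/\ whom w c, wle (w - 1) (s - c), wle w s & s != 0 -> c != 0].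
Proof.
have [w [h1 h2]] := wle_top s; exists w, (wpart w s); split=> //; first exact: whom_wpart.
exact: wle_sub_wpart.
Qed.

Lemma coef_mon c k0 l0 k l :
  (scst c * (sz ^+ k0 * st ^+ l0))`_k`_l = if (k == k0) && (l == l0) then c else 0.
Proof.
rewrite /scst /sz /st -polyC_exp mulrCA mulrC -polyCM coefCM coefXn.
case: eqP => _ /=; last by rewrite mulr0 coef0.
by rewrite mulr1 coefCM coefXn; case: eqP; rewrite ?mulr1 ?mulr0.
Qed.

(** If z and t do not divide s, homogeneity makes s a form in z^2 and t^3, which
   splits into linear factors over an algebraically closed field. *)
Lemma whom_factor w s : whom w s -> s != 0 -> (exists c, s = scst c) \/
  exists f s', s = f * s' /\
    [\/ f = sz, f = st | exists2 mu, mu != 0 & f = sz ^+ 2 + scst mu * st ^+ 3].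
Proof.
move=> hs s0.
have [sz0|sz0] := eqVneq s`_0 0.
  right; have /factor_theorem[q eq] : root s 0 by rewrite /root horner_coef0 sz0.
  by exists sz, q; split; [rewrite eq subr0 mulrC|constructor 1].
have [st0|/existsP[k0 hk0]] := boolP [forall k : 'I_(size s), s`_k`_0 == 0].
  right; exists st, (\poly_(k < size s) drop_poly 1 s`_k); split; last by constructor 2.
  apply/polyP=> k; rewrite coefCM coef_poly; case: ltnP => [lk|gk]; last first.
    by rewrite mulr0 nth_default.
  rewrite -[LHS](poly_take_drop 1) -[RHS]add0r mulrC expr1; congr (_ + _).
  apply/polyP=> -[|l]; rewrite coef_take_poly ?coef0 //=.
  by have /forallP /(_ (Ordinal lk)) /eqP := st0.
have [l0 hl0] : exists l0 : nat, s`_0`_l0 != 0.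
  by exists (size (s`_0)%R).-1; rewrite -lead_coefE lead_coef_eq0.
have e1 := hs _ _ hk0; have e2 := hs _ _ hl0.
have [N eN] : exists N : nat, w = (6 * N)%N by exists (k0 %/ 2)%N; lia.
case: N eN => [|N] eN.
  left; exists s`_0`_0; apply/polyP=> k; apply/polyP=> l.
  have := coef_mon s`_0`_0 0 0 k l; rewrite !expr0 !mulr1 => ->.
  case: ifP => [/andP[/eqP -> /eqP ->] //|ne]; apply/eqP/negP => /negP /hs.
  by case: k l ne => [|k] [|l] // _; lia.
(* the form s, dehomogenized as a polynomial in z^2 / t^3 *)
right; pose q := \poly_(j < N.+2) s`_(2 * j)`_(3 * (N.+1 - j)).
have qN : q`_N.+1 != 0.
  rewrite coef_poly ltnS leqnn subnn muln0; have -> : (2 * N.+1 = k0)%N by lia.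
  exact: hk0.
have q0 : q`_0 != 0.
  by rewrite coef_poly /= muln0 subn0; have -> : (3 * N.+1 = l0)%N by lia.
have szq : size q != 1%N.
  have : (N.+1 < size q)%N by rewrite ltnNge; apply: contraNN qN => /leq_sizeP ->.
  by lia.
have [r /eqP hr] := closed_rootP _ szq.
have r0 : r != 0 by apply: contraNneq q0 => r0; move: hr; rewrite r0 horner_coef0 => ->.
exists (sz ^+ 2 + scst (- r) * st ^+ 3).
suff [s' es] : exists s', s = (sz ^+ 2 + scst (- r) * st ^+ 3) * s'.
  by exists s'; split=> //; constructor 3; exists (- r); rewrite ?oppr_eq0.
have -> : s = \sum_(j < N.+2) scst q`_j * ((sz ^+ 2) ^+ j * (st ^+ 3) ^+ (N.+1 - j)).
  apply/polyP=> k; apply/polyP=> l; rewrite !coef_sum.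
  under eq_bigr => j _ do rewrite -!exprM coef_mon coef_poly ltn_ord.
  have [nz|nz] := eqVneq s`_k`_l 0.
    rewrite big1 ?nz // => j _; case: ifP => // /andP[/eqP ek /eqP el].
    by rewrite -ek -el.
  have e3 := hs _ _ nz; have kj : (k./2 < N.+2)%N by lia.
  rewrite (bigD1 (Ordinal kj)) //= big1 ?addr0; last first.
    move=> j /negP nj; case: ifP => // /andP[/eqP ek /eqP el]; case: nj.
    by apply/eqP/val_inj => /=; lia.
  have -> : (k == 2 * k./2)%N by apply/eqP; lia.
  have -> /= : (l == 3 * (N.+1 - k./2))%N by apply/eqP; lia.
  have -> : (2 * k./2 = k)%N by lia.
  by have -> : (3 * (N.+1 - k./2) = l)%N by lia.
have -> : \sum_(j < N.+2) scst q`_j * ((sz ^+ 2) ^+ j * (st ^+ 3) ^+ (N.+1 - j))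
  = \sum_(j < N.+2) scst q`_j * (st ^+ 3) ^+ (N.+1 - j) * ((sz ^+ 2) ^+ j - (scst r * st ^+ 3) ^+ j).
  under [RHS]eq_bigr => j _ do rewrite mulrBr.
  rewrite sumrB -[LHS]subr0; congr (_ - _); first by apply: eq_bigr => j _; ring.
  rewrite (eq_bigr (fun j : 'I_N.+2 => (st ^+ 3) ^+ N.+1 * scst (q`_j * r ^+ j))); last first.
    move=> j _; have eN1 : N.+1 = ((N.+1 - j) + j)%N by rewrite subnK // -ltnS.
    have -> : (st ^+ 3) ^+ N.+1 = (st ^+ 3) ^+ (N.+1 - j) * (st ^+ 3) ^+ j.
      by rewrite -exprD -eN1.
    rewrite (exprMn j (scst r)) rmorphM rmorphXn /=.
    by rewrite mulrACA mulrC.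
  rewrite -mulr_sumr -rmorph_sum /=; have -> : \sum_(i < N.+2) q`_i * r ^+ i = 0; last by rewrite rmorph0 mulr0.
  by move: hr; rewrite (horner_coef_wide _ (size_poly _ _)).
apply: (big_ind (fun u => exists s', u = (sz ^+ 2 + scst (- r) * st ^+ 3) * s')) => [|a b [a' ->] [b' ->]|j _]; first by exists 0; rewrite mulr0.
  by exists (a' + b'); rewrite mulrDr.
rewrite subrXX rmorphN mulNr; eexists; rewrite mulrCA; reflexivity.
Qed.

Lemma S_unit (u : S) : u \is a GRing.unit -> exists c, u = scst c.
Proof.
rewrite poly_unitE => /andP[/eqP su]; rewrite poly_unitE => /andP[/eqP su0 _].
by exists u`_0`_0; rewrite (size1_polyC (eq_leq su)) {1}(size1_polyC (eq_leq su0)) !coefC.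
Qed.

Lemma S_eval (E : comNzRingType) (f : {rmorphism C -> E}) a b :
  exists g : {rmorphism S -> E}, [/\ forall c, g (scst c) = f c, g sz = a & g st = b].
Proof.
exists (pev (pev f b) a); split=> [c||]; [|exact: pevX|].
  by rewrite /= pevC /= pevC.
by rewrite /= pevC /= pevX.
Qed.

Lemma S_rmorph_ext (E : comNzRingType) (f g : {rmorphism S -> E}) :
  (forall c, f (scst c) = g (scst c)) -> f sz = g sz -> f st = g st -> f =1 g.
Proof.
move=> fc fz ft; apply: poly_rmorph_ext => // u.
exact: (@poly_rmorph_ext C E (f \o polyC) (g \o polyC)).
Qed.

Lemma S_ind (K : S -> Prop) : (forall c, K (scst c)) -> K sz -> K st ->
  (forall a b, K a -> K b -> K (a + b)) -> (forall a b, K a -> K b -> K (a * b)) -> forall s, K s.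
Proof.
move=> Kc Kz Kt KD KM.
have Ku (u : {poly C}) : K u%:P.
  elim/poly_ind: u => [|u c IH]; first exact: (Kc 0).
  by rewrite polyCD polyCM; apply: KD; [apply: KM|exact: Kc].
elim/poly_ind=> [|s u IH]; first by rewrite -polyC0.
by apply: KD; [apply: KM|exact: Ku].
Qed.

Lemma poly_prim (p : {poly C}) : exists q, q^`() = p.
Proof.
exists (\poly_(i < (size p).+1) (p`_i.-1 / i%:R)).
apply/polyP=> i; rewrite coef_deriv coef_poly ltnS /=.
case: ltnP => [h|h]; last by rewrite mul0rn nth_default.
by rewrite -(mulr_natr (_ / _)) divfK // pnatr_eq0.
Qed.

Lemma Sdz_prim (s : S) : exists h, Sdz h = s.
Proof.
exists (\poly_(i < (size s).+1) (i%:R^-1%:P * s`_i.-1)).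
apply/polyP=> i; rewrite coef_deriv coef_poly ltnS /=.
case: ltnP => [h|h]; last by rewrite mul0rn nth_default.
by rewrite -(mulr_natl (_ * _)) mulrA -polyC_natr -polyCM divff ?mul1r // pnatr_eq0.
Qed.

Lemma Sdz_eq0 (s : S) : Sdz s = 0 -> exists u, s = u%:P.
Proof.
move=> h; exists s`_0; apply/polyP=> -[|i]; rewrite coefC //=.
have := congr1 (fun p : S => p`_i) h; rewrite coef0 coef_deriv -mulr_natl => /eqP.
by rewrite mulf_eq0 -polyC_natr polyC_eq0 pnatr_eq0 /= => /eqP.
Qed.

Lemma Sdz_dt s : Sdz (Sdt s) = Sdt (Sdz s).
Proof.
apply/polyP=> i; rewrite coef_deriv !coef_map_id0 ?deriv0 // coef_deriv.
by rewrite derivMn.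
Qed.

(** The form g dz - f dt is closed, and polynomials have primitives in
   characteristic 0. *)
Lemma S_poincare (f g : S) : Sdz f + Sdt g = 0 -> exists h, f = Sdt h /\ g = - Sdz h.
Proof.
move=> e; have [h hh] := Sdz_prim (- g).
have [u eu] : exists u, f - Sdt h = u%:P.
  apply: Sdz_eq0; rewrite /Sdz derivB -/(Sdz f) -/(Sdz (Sdt h)) Sdz_dt hh.
  rewrite -[RHS]e; congr (_ + _); apply: (@addrI _ (Sdt (- g))).
  by rewrite subrr -SdtD addNr Sdt0.
have [q hq] := poly_prim u; exists (h + q%:P).
rewrite SdtD SdzD SdtC hq -eu {2}/Sdz derivC addr0 hh opprK; split=> //.
by rewrite addrC subrK.
Qed.

Definition cusp : S := sz ^+ 2 + st ^+ 3.

(** The left side is the derivative of h along the Hamiltonian field of the cusp,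
   which is tangent to the cusp. So h is constant along the parametrization
   u |-> (u^3, - u^2), and the kernel of that parametrization is the ideal of the
   cusp. *)
Lemma S_cusp (h v : S) : 2%:R * sz * Sdt h - 3%:R * st ^+ 2 * Sdz h = v * cusp ->
  exists c w, h = scst c + w * cusp.
Proof.
move=> e.
have [ev [evc evz evt]] := S_eval (@polyC C : {rmorphism C -> {poly C}}) ('X^3) (- 'X^2).
have ev_cusp : ev cusp = 0 by rewrite rmorphD !rmorphXn /= evz evt; ring.
have dev s : (ev s)^`() = 3%:R * 'X^2 * ev (Sdz s) - 2%:R * 'X * ev (Sdt s).
  have := @Sder_formula {poly C} ev (fun s => (ev s)^`()).
  move=> hh; refine (etrans (hh _ _ _ s) _).
  - by move=> a b; rewrite rmorphD derivD.
  - by move=> a b; rewrite rmorphM derivM.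
  - by move=> c; rewrite evc derivC.
  rewrite /= evz evt derivN !derivXn /= expr1; ring.
have : (ev h)^`() = 0.
  have : - 'X^2 * (ev h)^`() = 0.
    rewrite dev; have := congr1 ev e; rewrite [in RHS]rmorphM ev_cusp mulr0.
    rewrite rmorphB !rmorphM !rmorph_nat /= evz evt => <-; ring.
  by move/eqP; rewrite mulf_eq0 oppr_eq0 expf_eq0 /= polyX_eq0 => /eqP.
move=> dh0.
have [c ec] : exists c, ev h = c%:P.
  exists (ev h)`_0; apply/polyP=> -[|i]; rewrite coefC //=.
  have := congr1 (fun p : {poly C} => p`_i) dh0; rewrite coef0 coef_deriv -mulr_natl => /eqP.
  by rewrite mulf_eq0 pnatr_eq0 /= => /eqP.
suff [w ew] : exists w, h - scst c = w * cusp by exists c, w; rewrite -ew addrC subrK.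
have : ev (h - scst c) = 0 by rewrite rmorphB /= evc ec subrr.
move: (h - scst c) => {e dh0 ec} g {h v c}.
(* the remainder r0(t) + r1(t) z modulo the cusp is 0, as it vanishes along the
   parametrization *)
have sc : size cusp = 3%N.
  rewrite /cusp /st -polyC_exp size_polyDl size_polyXn // size_polyC.
  by case: (_ != 0).
have cm : cusp \is monic.
  by rewrite monicE lead_coefE sc /cusp /st -polyC_exp coefD coefXn coefC addr0.
move=> evg; have eg := Pdiv.RingMonic.rdivp_eq cm g.
set r := Pdiv.Ring.rmodp g cusp in eg.
suff r0 : r = 0 by exists (Pdiv.Ring.rdivp g cusp); rewrite {1}eg r0 addr0.
have sr : (size r <= 2)%N.
  by rewrite -ltnS -sc Pdiv.Ring.ltn_rmodpN0 // monic_neq0.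
have er : r = (r`_0)%:P + (r`_1)%:P * sz.
  apply/polyP=> -[|[|i]]; rewrite coefD coefC coefMX ?coefC /= ?addr0 ?add0r //.
  by rewrite nth_default //; apply: leq_trans sr _.
have evr : ev r = 0.
  by move: evg; rewrite {1}eg rmorphD rmorphM /= ev_cusp mulr0 add0r.
have evu (u : {poly C}) : ev u%:P = u \Po (- 'X^2).
  have := @poly_rmorph_ext C {poly C} (ev \o polyC) (comp_poly (- 'X^2)).
  move=> h; apply: h => [c|]; first by rewrite /= evc comp_polyC.
  by rewrite /= evt comp_polyX.
move: evr; rewrite er rmorphD rmorphM /= !evu evz => e1.
(* u |-> - u separates the even and the odd part of the value at the parametrization *)
have inv (u : {poly C}) : (u \Po (- 'X^2)) \Po (- 'X) = u \Po (- 'X^2).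
  rewrite -comp_polyA; congr (_ \Po _).
  by rewrite rmorphN rmorphXn /= comp_polyX sqrrN.
have := congr1 (fun p => p \Po (- 'X)) e1.
rewrite rmorphD rmorphM /= !inv rmorphXn /= comp_polyX rmorph0 => e2.
have X3 : ('X : {poly C}) ^+ 3 != 0 by rewrite expf_neq0 // polyX_eq0.
have s2 : (1 < size (- 'X^2 : {poly C}))%N by rewrite size_polyN size_polyXn.
have e3 : 2%:R * (r`_1 \Po (- 'X^2)) * 'X^3 = 0.
  transitivity (((r`_0 \Po (- 'X^2)) + (r`_1 \Po (- 'X^2)) * 'X^3) - ((r`_0 \Po (- 'X^2)) + (r`_1 \Po (- 'X^2)) * (- 'X) ^+ 3)); first ring.
  by rewrite e1 e2 subrr.
have r1 : r`_1 = 0.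
  move/eqP: e3; rewrite mulf_eq0 (negPf X3) orbF mulf_eq0 -polyC_natr polyC_eq0 pnatr_eq0 /=.
  by rewrite comp_poly_eq0 // => /eqP.
have r00 : r`_0 = 0.
  by move/eqP: e1; rewrite r1 comp_poly0 mul0r addr0 comp_poly_eq0 // => /eqP.
by rewrite r1 r00 !polyC0 mul0r addr0.
Qed.
End Ambient.

(** What the proof needs of C[z, t], as an abstract structure: nested polynomial
   rings are costly to compare up to conversion. *)
Record plane (C : numClosedFieldType) := Plane {
  plane_ring :> idomainType;
  pcst : {rmorphism C -> plane_ring};
  pz : plane_ring;
  pt : plane_ring;
  pdz : plane_ring -> plane_ring;
  pdt : plane_ring -> plane_ring;
  phom : int -> plane_ring -> Prop;
  ple : int -> plane_ring -> Prop;
  pz_neq0 : pz != 0;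
  pt_neq0 : pt != 0;
  pdzD : forall a b, pdz (a + b) = pdz a + pdz b;
  pdzM : forall a b, pdz (a * b) = pdz a * b + a * pdz b;
  pdtD : forall a b, pdt (a + b) = pdt a + pdt b;
  pdtM : forall a b, pdt (a * b) = pdt a * b + a * pdt b;
  pdzz : pdz pz = 1;
  pdzt : pdz pt = 0;
  pdtz : pdt pz = 0;
  pdtt : pdt pt = 1;
  pdz_cst : forall c, pdz (pcst c) = 0;
  pdt_cst : forall c, pdt (pcst c) = 0;
  pdz_dt : forall a, pdz (pdt a) = pdt (pdz a);
  pder_formula : forall (E : comNzRingType) (f : {rmorphism plane_ring -> E}) (d : plane_ring -> E),
    (forall a b, d (a + b) = d a + d b) -> (forall a b, d (a * b) = d a * f b + f a * d b) ->
    (forall c, d (pcst c) = 0) -> forall s, d s = f (pdz s) * d pz + f (pdt s) * d pt;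
  peval : forall (E : comNzRingType) (f : {rmorphism C -> E}) a b,
    exists g : {rmorphism plane_ring -> E}, [/\ forall c, g (pcst c) = f c, g pz = a & g pt = b];
  prmorph_ext : forall (E : comNzRingType) (f g : {rmorphism plane_ring -> E}),
    (forall c, f (pcst c) = g (pcst c)) -> f pz = g pz -> f pt = g pt -> f =1 g;
  pind : forall K : plane_ring -> Prop, (forall c, K (pcst c)) -> K pz -> K pt ->
    (forall a b, K a -> K b -> K (a + b)) -> (forall a b, K a -> K b -> K (a * b)) -> forall s, K s;
  ple0 : forall w, ple w 0;
  ple_mono : forall w w' s, w <= w' -> ple w s -> ple w' s;
  pleD : forall w a b, ple w a -> ple w b -> ple w (a + b);
  pleN : forall w a, ple w a -> ple w (- a);
  pleM : forall w w' a b, ple w a -> ple w' b -> ple (w + w') (a * b);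
  ple_dz : forall w s, ple w s -> ple (w - 3) (pdz s);
  ple_dt : forall w s, ple w s -> ple (w - 2) (pdt s);
  phom_ple : forall w s, phom w s -> ple w s;
  phom0 : forall w, phom w 0;
  phomD : forall w a b, phom w a -> phom w b -> phom w (a + b);
  phomN : forall w a, phom w a -> phom w (- a);
  phomM : forall w w' a b, phom w a -> phom w' b -> phom (w + w') (a * b);
  phom_dz : forall w s, phom w s -> phom (w - 3) (pdz s);
  phom_dt : forall w s, phom w s -> phom (w - 2) (pdt s);
  phom_cst : forall c, phom 0 (pcst c);
  phom_z : phom 3 pz;
  phom_t : phom 2 pt;
  phom_uniq : forall w w' s, phom w s -> phom w' s -> s != 0 -> w = w';
  phom_lt0 : forall w s, phom w s -> ple (w - 1) s -> s = 0;
  ple_lead : forall s, exists w c, [/\ phom w c, ple (w - 1) (s - c), ple w s & s != 0 -> c != 0];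
  phom_factor : forall w s, phom w s -> s != 0 -> (exists c, s = pcst c) \/
    exists f s', s = f * s' /\
      [\/ f = pz, f = pt | exists2 mu, mu != 0 & f = pz ^+ 2 + pcst mu * pt ^+ 3];
  punit : forall u : plane_ring, u \is a GRing.unit -> exists c, u = pcst c;
  ppoincare : forall f g, pdz f + pdt g = 0 -> exists h, f = pdt h /\ g = - pdz h;
  pcusp : forall h v, 2%:R * pz * pdt h - 3%:R * pt ^+ 2 * pdz h = v * (pz ^+ 2 + pt ^+ 3) ->
    exists c w, h = pcst c + w * (pz ^+ 2 + pt ^+ 3)
}.

Lemma sz_neq0 (C : numClosedFieldType) : sz C != 0.
Proof. by rewrite polyX_eq0. Qed.
Lemma st_neq0 (C : numClosedFieldType) : st C != 0.
Proof. by rewrite polyC_eq0 polyX_eq0. Qed.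

Definition affine_plane (C : numClosedFieldType) : plane C :=
  @Plane C {poly {poly C}} (@scst C) (sz C) (st C) (@Sdz C) (@Sdt C) (@whom C) (@wle C)
   (sz_neq0 C) (st_neq0 C)
   (@SdzD C) (@SdzM C) (@SdtD C) (@SdtM C) (Sdzz C) (Sdzt C) (SdtX C) (Sdtt C) (@Sdz_cst C) (@Sdt_cst C)
   (@Sdz_dt C) (@Sder_formula C) (@S_eval C) (@S_rmorph_ext C) (@S_ind C) (@wle0 C) (@wle_mono C) (@wleD C) (@wleN C) (@wleM C)
   (@wle_dz C) (@wle_dt C) (@whom_wle C) (@whom0 C) (@whomD C) (@whomN C) (@whomM C) (@whom_dz C) (@whom_dt C)
   (@whomC C) (@whom_sz C) (@whom_st C) (@whom_uniq C) (@whom_wle_lt0 C) (@wle_lead C) (@whom_factor C)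
   (@S_unit C) (@S_poincare C) (@S_cusp C).

(** * The polynomial ring C[x, z, t] *)

Section Threespace.
Variables (C : numClosedFieldType) (S : plane C).
Local Notation B := {poly S}.

Definition bx : B := 'X.
Definition bz : B := (pz S)%:P.
Definition bt : B := (pt S)%:P.
Definition cst (c : C) : B := (pcst S c)%:P.
HB.instance Definition _ := GRing.RMorphism.copy cst (polyC \o pcst S).

Definition Bdx (b : B) : B := b^`().
Definition Bdz (b : B) : B := map_poly (@pdz C S) b.
Definition Bdt (b : B) : B := map_poly (@pdt C S) b.

Lemma pdz0 : pdz (0 : S) = 0.
Proof. by apply: (@addrI _ (pdz 0)); rewrite -pdzD !addr0. Qed.
Lemma pdt0 : pdt (0 : S) = 0.
Proof. by apply: (@addrI _ (pdt 0)); rewrite -pdtD !addr0. Qed.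
Lemma pdz1 : pdz (1 : S) = 0. Proof. by rewrite -(rmorph1 (pcst S)) pdz_cst. Qed.
Lemma pdt1 : pdt (1 : S) = 0. Proof. by rewrite -(rmorph1 (pcst S)) pdt_cst. Qed.

Lemma BdxD a b : Bdx (a + b) = Bdx a + Bdx b. Proof. exact: derivD. Qed.
Lemma BdxM a b : Bdx (a * b) = Bdx a * b + a * Bdx b. Proof. exact: derivM. Qed.
Lemma BdzD a b : Bdz (a + b) = Bdz a + Bdz b.
Proof. by apply: map_polyD_add; [exact: pdz0|exact: pdzD]. Qed.
Lemma BdzM a b : Bdz (a * b) = Bdz a * b + a * Bdz b.
Proof. by apply: map_poly_leibniz; [exact: pdz0|exact: pdzD|exact: pdzM]. Qed.
Lemma BdtD a b : Bdt (a + b) = Bdt a + Bdt b.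
Proof. by apply: map_polyD_add; [exact: pdt0|exact: pdtD]. Qed.
Lemma BdtM a b : Bdt (a * b) = Bdt a * b + a * Bdt b.
Proof. by apply: map_poly_leibniz; [exact: pdt0|exact: pdtD|exact: pdtM]. Qed.

Lemma BdxX : Bdx bx = 1. Proof. exact: derivX. Qed.
Lemma BdxC s : Bdx s%:P = 0. Proof. exact: derivC. Qed.
Lemma BdzC s : Bdz s%:P = (pdz s)%:P. Proof. by rewrite /Bdz map_polyC0 // pdz0. Qed.
Lemma BdtC s : Bdt s%:P = (pdt s)%:P. Proof. by rewrite /Bdt map_polyC0 // pdt0. Qed.
Lemma BdzX : Bdz bx = 0. Proof. by apply: map_polyX0; rewrite ?pdz0 ?pdz1. Qed.
Lemma BdtX : Bdt bx = 0. Proof. by apply: map_polyX0; rewrite ?pdt0 ?pdt1. Qed.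
Lemma Bdz_coef b i : (Bdz b)`_i = pdz b`_i. Proof. by rewrite coef_map_id0 ?pdz0. Qed.
Lemma Bdt_coef b i : (Bdt b)`_i = pdt b`_i. Proof. by rewrite coef_map_id0 ?pdt0. Qed.

Lemma Bder_formula (E : comNzRingType) (f : {rmorphism B -> E}) (d : B -> E) :
  (forall a b, d (a + b) = d a + d b) -> (forall a b, d (a * b) = d a * f b + f a * d b) ->
  (forall c, d (cst c) = 0) ->
  forall b, d b = f (Bdx b) * d bx + f (Bdz b) * d bz + f (Bdt b) * d bt.
Proof.
move=> dD dM dc.
apply: poly_der_formula => //; [exact: pdzD|exact: pdzM|exact: pdtD|exact: pdtM|].
move=> s; apply: (@pder_formula C S E (f \o polyC) (d \o polyC)) => //= a b.
  by rewrite polyCD dD.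
by rewrite polyCM dM.
Qed.

Lemma B_rmorph_ext (E : comNzRingType) (f g : {rmorphism B -> E}) :
  (forall c, f (cst c) = g (cst c)) -> f bx = g bx -> f bz = g bz -> f bt = g bt -> f =1 g.
Proof.
move=> fc fx fz ft; apply: poly_rmorph_ext => // u.
exact: (@prmorph_ext C S E (f \o polyC) (g \o polyC)).
Qed.

Lemma B_eval (E : comNzRingType) (f : {rmorphism C -> E}) a b c :
  exists g : {rmorphism B -> E}, [/\ forall k, g (cst k) = f k, g bx = a, g bz = b & g bt = c].
Proof.
have [g [gc gz gt]] := peval S f b c.
exists (pev g a); split=> [k|||] /=; [by rewrite pevC|exact: pevX|by rewrite pevC|by rewrite pevC].
Qed.
End Threespace.

Section Fraction.
Variables (C : numClosedFieldType) (S : plane C).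
Local Notation B := {poly S}.
Local Notation bx := (bx S).
Local Notation bz := (bz S).
Local Notation bt := (bt S).
Local Notation cst := (cst S).
Variables (Q : fieldType) (iota : {rmorphism B -> Q}).
Hypothesis iota_inj : injective iota.
Hypothesis iota_frac : forall u, exists a b, b != 0 /\ u = iota a / iota b.

Local Notation X := (iota bx).
Local Notation Z := (iota bz).
Local Notation T := (iota bt).

Let i0 : iota 0 = 0. Proof. exact: rmorph0. Qed.
Let i1 : iota 1 = 1. Proof. exact: rmorph1. Qed.
Let iD a b : iota (a + b) = iota a + iota b. Proof. exact: rmorphD. Qed.
Let iM a b : iota (a * b) = iota a * iota b. Proof. exact: rmorphM. Qed.
Let iX a n : iota (a ^+ n) = iota a ^+ n. Proof. exact: rmorphXn. Qed.

Lemma X_neq0 : X != 0. Proof. by rewrite iota_neq0 // polyX_eq0. Qed.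
Lemma Z_neq0 : Z != 0. Proof. by rewrite iota_neq0 // polyC_eq0 pz_neq0. Qed.
Lemma T_neq0 : T != 0. Proof. by rewrite iota_neq0 // polyC_eq0 pt_neq0. Qed.

Lemma cst_neq0 (c : C) : (iota (cst c) != 0) = (c != 0).
Proof. by rewrite iota_neq0 // polyC_eq0 fmorph_eq0. Qed.

Lemma Qchar0 n : n.+1%:R != 0 :> Q.
Proof.
have := cst_neq0 n.+1%:R; rewrite pnatr_eq0 /= => /idP.
by rewrite !rmorph_nat.
Qed.

Definition scalar_der (D : Q -> Q) := derivation D /\ forall c, D (iota (cst c)) = 0.

Lemma der_iota D : scalar_der D -> forall b,
  D (iota b) = iota (Bdx b) * D X + iota (Bdz b) * D Z + iota (Bdt b) * D T.
Proof.
move=> [DD Dc]; apply: Bder_formula => //= a b; first by rewrite iD derD.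
by rewrite iM derM.
Qed.

Section MkDer.
Variables p q r : Q.
Let d b := iota (Bdx b) * p + iota (Bdz b) * q + iota (Bdt b) * r.
Definition mkder : Q -> Q := frac_der iota_frac d.
Let dD a b : d (a + b) = d a + d b.
Proof. by rewrite /d BdxD BdzD BdtD !iD; ring. Qed.
Let dM a b : d (a * b) = d a * iota b + iota a * d b.
Proof. by rewrite /d BdxM BdzM BdtM !iD !iM; ring. Qed.
Lemma mkder_iota b : mkder (iota b) = iota (Bdx b) * p + iota (Bdz b) * q + iota (Bdt b) * r.
Proof. exact: frac_der_ext. Qed.
Lemma mkderP : scalar_der mkder.
Proof.
split; first exact: frac_der_derivation.
move=> c; rewrite mkder_iota /cst BdxC BdzC BdtC pdz_cst pdt_cst polyC0 i0; ring.
Qed.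
Lemma mkderX : mkder X = p.
Proof. rewrite mkder_iota BdxX BdzX BdtX i1 i0; ring. Qed.
Lemma mkderZ : mkder Z = q.
Proof. rewrite mkder_iota BdxC BdzC BdtC pdzz pdtz polyC0 polyC1 i1 i0; ring. Qed.
Lemma mkderT : mkder T = r.
Proof. rewrite mkder_iota BdxC BdzC BdtC pdzt pdtt polyC0 polyC1 i1 i0; ring. Qed.
End MkDer.

(** The order in x, refined by weights: x^i b with b polynomial in x, where the
   weight bound concerns the coefficient of x^i only. *)
Definition Fil (i w : int) (a : Q) := exists b : B, a = X ^ i * iota b /\ ple w b`_0.

Lemma FilD i w a b : Fil i w a -> Fil i w b -> Fil i w (a + b).
Proof.
move=> [a' [-> ha]] [b' [-> hb]]; exists (a' + b'); rewrite iD mulrDr; split=> //.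
by rewrite coefD; apply: pleD.
Qed.
Lemma Fil0 i w : Fil i w 0.
Proof. by exists 0; rewrite i0 mulr0 coef0; split=> //; apply: ple0. Qed.
Lemma Fil_mono i w w' a : w <= w' -> Fil i w a -> Fil i w' a.
Proof. by move=> le [b [-> h]]; exists b; split=> //; apply: ple_mono h. Qed.
Lemma FilM i w j v a b : Fil i w a -> Fil j v b -> Fil (i + j) (w + v) (a * b).
Proof.
move=> [a' [-> ha]] [b' [-> hb]]; exists (a' * b').
rewrite iM expfzDr ?X_neq0 // coef0M; split; [ring|exact: pleM].
Qed.
Lemma Fil_gt i w j b : i < j -> Fil i w (X ^ j * iota b).
Proof.
move=> lt; have [k ek] : exists k : nat, j = i + k.+1%:Z by exists (absz (j - i - 1)%R); lia.
exists ('X^(k.+1) * b); rewrite ek expfzDr ?X_neq0 // iM iX -exprnP mulrA; split=> //.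
by rewrite coefXnM; apply: ple0.
Qed.
Lemma Fil_intro i w (b : B) : ple w b`_0 -> Fil i w (X ^ i * iota b).
Proof. by exists b. Qed.

(** A derivation whose values on the generators x, z, t, of bidegrees (1, 0),
   (0, 3), (0, 2), are shifted by (d, e) shifts the whole filtration by (d, e). *)
Lemma Fil_der D d e : scalar_der D -> Fil (d + 1) e (D X) -> Fil d (e + 3) (D Z) ->
  Fil d (e + 2) (D T) -> forall i w a, Fil i w a -> Fil (i + d) (w + e) (D a).
Proof.
move=> DD FX FZ FT i w a [b [-> hb]]; have [dD dc] := DD.
rewrite derM // derXz ?X_neq0 // (der_iota DD b) !(mulrDr (X ^ i)).
have H1 : Fil (i + d) (w + e) (X ^ i * (iota (Bdt b) * D T)).
  rewrite mulrA (_ : w + e = (w - 2) + (e + 2)); last ring.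
  by apply: FilM => //; apply: Fil_intro; rewrite Bdt_coef; apply: ple_dt.
have H2 : Fil (i + d) (w + e) (X ^ i * (iota (Bdz b) * D Z)).
  rewrite mulrA (_ : w + e = (w - 3) + (e + 3)); last ring.
  by apply: FilM => //; apply: Fil_intro; rewrite Bdz_coef; apply: ple_dz.
have H3 : Fil (i + d) (w + e) (X ^ i * (iota (Bdx b) * D X)).
  have [c [-> _]] := FX.
  rewrite [G in Fil _ _ G](_ : _ = X ^ (i + (d + 1)) * iota (Bdx b * c)); last first.
    by rewrite expfzDr ?X_neq0 // iM; ring.
  by apply: Fil_gt; lia.
have H4 : Fil (i + d) (w + e) (i%:~R * X ^ (i - 1) * D X * iota b).
  rewrite [G in Fil _ _ G](_ : _ = (X ^ (i - 1) * iota (cst i%:~R * b)) * D X); last first.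
    by rewrite iM !rmorph_int; ring.
  rewrite (_ : i + d = (i - 1) + (d + 1)); last ring.
  apply: FilM => //; apply: Fil_intro.
  rewrite coef0M coefC /=; apply: (ple_mono _ (pleM (phom_ple (phom_cst S _)) hb)).
  by rewrite add0r.
by apply: FilD => //; apply: FilD => //; apply: FilD.
Qed.
End Fraction.

(** * The coordinate ring of the threefold *)

Section Divisibility.
Variable R : idomainType.
Implicit Types b u v w : {poly R}.

Lemma poly_split b : exists b', b = (b`_0)%:P + 'X * b'.
Proof.
have /factor_theorem[q eq] : root (b - (b`_0)%:P) 0.
  by rewrite /root hornerD hornerN hornerC horner_coef0 subrr.
exists q; rewrite -[LHS](subrK (b`_0)%:P) eq subr0 [in RHS]addrC; congr (_ + _); exact: mulrC.
Qed.

Lemma poly_dvdX b : b`_0 = 0 -> exists b', b = 'X * b'.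
Proof. by move=> b0; have [b' e] := poly_split b; exists b'; rewrite e b0 add0r. Qed.

Lemma polyX_reg n u v : 'X^n * u = 'X^n * v -> u = v.
Proof. by apply: mulfI; rewrite expf_neq0 // polyX_eq0. Qed.

Lemma dvdXn_coprime n u v w : 'X^n * u = v * w -> w`_0 != 0 -> exists v', v = 'X^n * v'.
Proof.
move=> e w0; elim: n u v e => [|n IH] u v e; first by exists v; rewrite expr0 mul1r.
have v0 : v`_0 = 0.
  have := congr1 (fun p : {poly R} => p`_0) e; rewrite exprS -mulrA coefXM coef0M /=.
  by move/esym/eqP; rewrite mulf_eq0 (negPf w0) orbF => /eqP.
have [v' ev] := poly_dvdX v0.
have [v'' ev'] : exists v'', v' = 'X^n * v''.
  by apply: (IH u); apply: (@polyX_reg 1); rewrite expr1 !mulrA -exprS -ev.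
by exists v''; rewrite ev ev' mulrA -exprS.
Qed.

Lemma poly_valuation b : b != 0 -> exists k b', b = 'X^k * b' /\ b'`_0 != 0.
Proof.
elim: {b}(size b) {-2}b (leqnn (size b)) => [|m IH] b.
  by rewrite leqn0 size_poly_eq0 => /eqP ->; rewrite eqxx.
move=> sb b0; have [h|h] := eqVneq b`_0 0; last by exists 0%N, b; rewrite expr0 mul1r.
have [b' e] := poly_dvdX h.
have b'0 : b' != 0 by apply: contraNneq b0 => h'; rewrite e h' mulr0.
have [|//|k [b'' [e' h']]] := IH b'.
  by rewrite -ltnS; apply: leq_trans sb; rewrite e mulrC size_mulX.
by exists k.+1, b''; rewrite exprS -mulrA -e'.
Qed.
End Divisibility.

Lemma max2 (P1 P2 : bool) (v1 v2 : int) : P1 || P2 ->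
  exists e, [/\ P1 -> v1 <= e, P2 -> v2 <= e & P1 && (v1 == e) || P2 && (v2 == e)].
Proof.
case: P1; case: P2 => //= _; first (have [h|/ltW h] := leP v1 v2).
- by exists v2; split; rewrite ?eqxx ?orbT.
- by exists v1; split; rewrite ?eqxx ?orbT.
- by exists v1; split; rewrite ?eqxx ?orbT.
- by exists v2; split; rewrite ?eqxx ?orbT.
Qed.

(** Used to select the highest of the weights by which the nonzero components of
   a derivation shift. *)
Lemma max3 (P1 P2 P3 : bool) (v1 v2 v3 : int) : [|| P1, P2 | P3] ->
  exists e, [/\ P1 -> v1 <= e, P2 -> v2 <= e, P3 -> v3 <= e &
    [|| P1 && (v1 == e), P2 && (v2 == e) | P3 && (v3 == e)]].
Proof.
have [h|/negPf h] := boolP (P1 || P2).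
  have [e [h1 h2 h3]] := max2 v1 v2 h.
  have [e' [h4 h5 h6]] : exists e', [/\ true -> e <= e', P3 -> v3 <= e' & true && (e == e') || P3 && (v3 == e')].
    exact: max2.
  move=> _; exists e'; split=> [/h1 k|/h2 k|//|]; first by apply: le_trans k (h4 _).
    by apply: le_trans k (h4 _).
  case/orP: h6 => [/andP[_ /eqP <-]|->]; last by rewrite !orbT.
  by rewrite orbA h3.
rewrite orbA h /= => h3; exists v3; move/negbT: h; rewrite negb_or => /andP[/negPf -> /negPf ->].
by split=> //; rewrite h3 eqxx.
Qed.

Section CoordinateRing.
Variables (C : numClosedFieldType) (S : plane C).
Local Notation B := {poly S}.
Local Notation bx := (bx S).
Local Notation bz := (bz S).
Local Notation bt := (bt S).
Variables (Q : fieldType) (iota : {rmorphism B -> Q}).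
Hypothesis iota_inj : injective iota.
Hypothesis iota_frac : forall u, exists a b, b != 0 /\ u = iota a / iota b.
Local Notation X := (iota bx).
Local Notation Z := (iota bz).
Local Notation X0 := (X_neq0 iota_inj).

Let i0 : iota 0 = 0. Proof. exact: rmorph0. Qed.
Let iD a b : iota (a + b) = iota a + iota b. Proof. exact: rmorphD. Qed.
Let iN a : iota (- a) = - iota a. Proof. exact: rmorphN. Qed.
Let iM a b : iota (a * b) = iota a * iota b. Proof. exact: rmorphM. Qed.
Let iX a n : iota (a ^+ n) = iota a ^+ n. Proof. exact: rmorphXn. Qed.

Definition pcusp_poly : S := pz S ^+ 2 + pt S ^+ 3.
Local Notation P := pcusp_poly.

Lemma P_neq0 : P != 0.
Proof.
have [g [_ gz gt]] := peval S idfun 1 0.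
apply/eqP=> /(congr1 g); rewrite rmorphD !rmorphXn /= gz gt rmorph0 expr1n expr0n addr0.
by apply/eqP; rewrite oner_eq0.
Qed.

Variables (n : nat) (r : B).
Hypothesis hn : (0 < n)%N.

(** The equation is studied with an arbitrary multiple of x in place of x p(x):
   leading parts only see the cusp. *)
Definition cG : B := P%:P + 'X * r.
Local Notation G := cG.
Definition cy : Q := - iota G / X ^+ n.
Local Notation y := cy.

Lemma G_coef0 : G`_0 = P.
Proof. by rewrite coefD coefXM coefC addr0. Qed.

Lemma Xy_rel : X ^+ n * y = - iota G.
Proof. by rewrite mulrCA mulfV ?mulr1 // expf_neq0 // X0. Qed.

Definition evA : {poly B} -> Q := pev iota y.
HB.instance Definition _ := GRing.RMorphism.on evA.
Lemma evAC b : evA b%:P = iota b. Proof. exact: pevC. Qed.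
Lemma evAX : evA 'X = y. Proof. exact: pevX. Qed.

Definition inA a := exists c, a = evA c.

Lemma inA_iota b : inA (iota b). Proof. by exists b%:P; rewrite evAC. Qed.
Lemma inA_y : inA y. Proof. by exists 'X; rewrite evAX. Qed.
Lemma inAD a b : inA a -> inA b -> inA (a + b).
Proof. by move=> [a' ->] [b' ->]; exists (a' + b'); rewrite rmorphD. Qed.
Lemma inAM a b : inA a -> inA b -> inA (a * b).
Proof. by move=> [a' ->] [b' ->]; exists (a' * b'); rewrite rmorphM. Qed.

(** Multiplication by x^(n m) turns y^m into (- G)^m and each lower power of y
   into a multiple of x^n. *)
Lemma evA_clear m (c : {poly B}) : (size c <= m.+1)%N ->
  exists b, X ^+ (n * m) * evA c = iota (c`_m * (- G) ^+ m + 'X^n * b).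
Proof.
move=> sc; rewrite /evA pevE.
have -> : (map_poly iota c).[y] = \sum_(j < m.+1) iota c`_j * y ^+ j.
  rewrite (horner_coef_wide _ (leq_trans (size_poly _ _) sc)).
  by apply: eq_bigr => j _; rewrite coef_map.
rewrite big_ord_recr /= mulrDr mulr_sumr.
exists (\sum_(j < m) c`_j * ('X^(n * (m - j.+1)) * (- G) ^+ j)).
rewrite iD addrC; congr (_ + _).
  by rewrite iM iX iN -Xy_rel (exprMn m (X ^+ n)) -exprM mulrCA.
rewrite iM !rmorph_sum /= mulr_sumr; apply: eq_bigr => j _.
rewrite !iM !iX iN -Xy_rel (exprMn j (X ^+ n)) -exprM.
have -> : (n * m = n + (n * (m - j.+1) + n * j))%N by have := ltn_ord j; nia.
by rewrite !exprD /bx; ring.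
Qed.

Lemma X_int_nat (i : int) (k : nat) (b : B) : Posz k = i -> X ^ i * iota b = iota ('X^k * b).
Proof. by move=> <-; rewrite -exprnP iM iX. Qed.

Definition eqA : {poly B} := ('X^n)%:P * 'X + G%:P.

Lemma evA_eqA : evA eqA = 0.
Proof. by rewrite /eqA rmorphD rmorphM /= !evAC evAX iX Xy_rel addNr. Qed.

(** When the pole is shallower than the degree in y suggests, the leading
   coefficient in y is divisible by x^n, as G is prime to x; then x^n y = - G
   lowers the degree. *)
Lemma evA_reduce m (c : {poly B}) (i : int) b : (size c <= m.+2)%N -> evA c = X ^ i * iota b ->
  n%:Z <= i + (n * m.+1)%N -> exists q : {poly B}, (size (c - q * eqA)%R <= m.+1)%N.
Proof.
move=> sc e h; have [b' eb'] := evA_clear sc.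
have [k ek] : exists k : nat, Posz k = i + (n * m.+1)%N - Posz n by exists (absz (i + Posz (n * m.+1)%N - Posz n)%R); lia.
have e2 : iota ('X^(n + k) * b) = iota (c`_m.+1 * (- G) ^+ m.+1 + 'X^n * b').
  rewrite -eb' e mulrA (exprnP X) -expfzDr ?X0 //; apply/esym/X_int_nat; lia.
have [c' ec'] : exists c', c`_m.+1 = 'X^n * c'.
  apply: (@dvdXn_coprime _ n ('X^k * b - b') _ ((- G) ^+ m.+1)).
    by rewrite mulrBr mulrA -exprD (iota_inj e2) addrK.
  by rewrite -horner_coef0 horner_exp hornerN horner_coef0 G_coef0 expf_neq0 // oppr_eq0 P_neq0.
exists (c'%:P * 'X^m).
have -> : c - c'%:P * 'X^m * eqA = take_poly m.+1 c - (c' * G)%:P * 'X^m.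
  have -> : c = take_poly m.+1 c + (c`_m.+1)%:P * 'X^(m.+1).
    rewrite -{1}(poly_take_drop m.+1 c); congr (_ + _ * _).
    apply/polyP=> j; rewrite coef_drop_poly coefC; case: j => [|j] //=.
    by rewrite nth_default // (leq_trans sc) // addSn ltnS addnS ltnS leq_addl.
  have -> : take_poly m.+1 (take_poly m.+1 c + (c`_m.+1)%:P * 'X^(m.+1)) = take_poly m.+1 c.
    apply/polyP=> j; rewrite !coef_take_poly; case: ltnP => // lt.
    by rewrite coefD coefMXn lt addr0 coef_take_poly lt.
  rewrite ec' /eqA exprS !polyCM; ring.
rewrite (leq_trans (size_polyD _ _)) // geq_max size_take_poly size_polyN.
rewrite andTb; apply: (leq_trans (size_polyMleq _ _)); rewrite size_polyXn addnS /=.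
by rewrite -[leqRHS]add1n leq_add2r size_polyC leq_b1.
Qed.

Lemma evA_eq a b : evA (a - b) = 0 -> evA a = evA b.
Proof. by rewrite rmorphB => /subr0_eq. Qed.

Lemma evA_sub_eqA c q : evA (c - q * eqA) = evA c.
Proof. by rewrite rmorphB rmorphM /= evA_eqA mulr0 subr0. Qed.

(** Without a pole, [evA_reduce] applies down to degree 0 in y. *)
Lemma evA_eq0 c : evA c = 0 -> exists q, c = q * eqA.
Proof.
elim: {c}(size c) {-2}c (leqnSn (size c)) => [|m IH] c sc e.
  exists 0; rewrite mul0r (size1_polyC sc); move: e.
  by rewrite (size1_polyC sc) evAC -i0 => /iota_inj ->; rewrite coefC.
have e0 : evA c = X ^ n%:Z * iota 0 by rewrite e i0 mulr0.
have [|q sq] := evA_reduce sc e0; first by rewrite lerDl.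
have [|q' e'] := IH _ sq; first by rewrite evA_sub_eqA.
by exists (q' + q); rewrite mulrDl -e' subrK.
Qed.

Lemma evA_lead_low m (c : {poly B}) (i : int) b : (size c <= m.+1)%N -> evA c = X ^ i * iota b ->
  i + (n * m)%N < n%:Z -> exists m' c', b`_0 = P ^+ m' * c' /\ 0 <= i + (n * m')%N.
Proof.
move=> sc e h; have [b' eb'] := evA_clear sc.
rewrite e mulrA (exprnP X) -expfzDr ?X0 // in eb'.
have [lt|ge] := ltP (i + (n * m)%N) 0.
  exists (absz i), 0; rewrite mulr0; split; last by nia.
  have [k ek] : exists k : nat, Posz k.+1 = - (i + (n * m)%N) by exists (absz (- (i + Posz (n * m)%N) - 1)%R); lia.
  have /iota_inj -> : iota b = iota ('X^(k.+1) * (c`_m * (- G) ^+ m + 'X^n * b')); last by rewrite coefXnM.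
  by rewrite -(X_int_nat _ ek) -eb' mulrA -expfzDr ?X0 // (_ : _ + _ = 0) ?expr0z ?mul1r //; lia.
have [k ek] : exists k : nat, Posz k = i + (n * m)%N by exists (absz (i + Posz (n * m)%N)%R); lia.
have kn : (k < n)%N by lia.
have e2 : 'X^k * b = c`_m * (- G) ^+ m + 'X^n * b'.
  by apply: iota_inj; rewrite -eb' -(@X_int_nat (i + (n * m)%N)) // addrC.
have G0 : ((- G) ^+ m)`_0 = (- P) ^+ m.
  by rewrite -horner_coef0 horner_exp hornerN horner_coef0 G_coef0.
have e3 : 'X^n = 'X^k * 'X^(n - k) :> B by rewrite -exprD subnKC // ltnW.
have [c' ec'] : exists c', c`_m = 'X^k * c'.
  apply: (@dvdXn_coprime _ k (b - 'X^(n - k) * b') _ ((- G) ^+ m)).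
    by rewrite mulrBr e2 e3 mulrA addrK.
  by rewrite G0 expf_neq0 // oppr_eq0 P_neq0.
exists m, ((-1) ^+ m * c'`_0); split; last lia.
have e4 : b = c' * (- G) ^+ m + 'X^(n - k) * b'.
  by apply: (@polyX_reg _ k); rewrite e2 ec' e3; ring.
by rewrite e4 coefD coef0M G0 coefXnM subn_gt0 kn addr0 -[- P]mulN1r (exprMn m (-1)) mulrA [RHS]mulrC [c'`_0 * _]mulrC.
Qed.

(** A pole comes from a power of y, and each y brings a factor G, whose
   constant term in x is z^2 + t^3: a pole of order k forces at least k / n such
   factors in the leading coefficient. *)
Lemma inA_lead a i b : inA a -> a = X ^ i * iota b ->
  exists m c, b`_0 = P ^+ m * c /\ 0 <= i + (n * m)%N.
Proof.
move=> [c ->]; elim: {c}(size c) {-2}c (leqnSn (size c)) => [|m IH] c sc e.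
  have [lt|ge] := ltP (i + (n * 0)%N) n%:Z; first exact: (evA_lead_low sc e lt).
  by exists 0%N, b`_0; rewrite expr0 mul1r; split=> //; lia.
have [lt|ge] := ltP (i + (n * m.+1)%N) n%:Z; first exact: (evA_lead_low sc e lt).
have [q sq] := evA_reduce sc e ge.
by apply: (IH _ sq); rewrite evA_sub_eqA.
Qed.

(** This recovers the ideal (x^n, G) of B from the inclusion of B in A: it is
   the set of the x^n a, for a in A with a pole of order at most n. *)
Lemma inA_pole_n a b : inA a -> a = X ^ (- n%:Z) * iota b -> exists u v, b = u * G + 'X^n * v.
Proof.
move=> [c ->]; elim: {c}(size c) {-2}c (leq_trans (leqnSn (size c)) (leqnSn _)) => [|m IH] c sc e; last first.
  have [|q sq] := evA_reduce sc e; first by nia.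
  by apply: (IH _ sq); rewrite evA_sub_eqA.
have [b' eb'] := evA_clear sc.
exists (- c`_1), b'; apply: iota_inj; rewrite mulNr -mulrN -[- G]expr1 -eb' e mulrA muln1.
by rewrite (exprnP X) -expfzDr ?X0 // subrr expr0z mul1r.
Qed.
End CoordinateRing.

(** * Leading parts *)

Section TopParts.
Variables (C : numClosedFieldType) (S : plane C).
Local Notation B := {poly S}.
Local Notation bx := (bx S).
Local Notation bz := (bz S).
Local Notation bt := (bt S).
Variables (Q : fieldType) (iota : {rmorphism B -> Q}).
Hypothesis iota_inj : injective iota.
Hypothesis iota_frac : forall u, exists a b, b != 0 /\ u = iota a / iota b.
Local Notation X := (iota bx).
Local Notation Z := (iota bz).
Local Notation X0 := (X_neq0 iota_inj).
Local Notation Fil := (Fil iota).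
Local Notation P := (pcusp_poly S).

Let i0 : iota 0 = 0. Proof. exact: rmorph0. Qed.
Let iM a b : iota (a * b) = iota a * iota b. Proof. exact: rmorphM. Qed.

Lemma top_uniq w w' (s c c' : S) : phom w c -> ple (w - 1) (s - c) -> phom w' c' ->
  ple (w' - 1) (s - c') -> c != 0 -> c' != 0 -> c = c'.
Proof.
move=> hc hs hc' hs' c0 c'0.
wlog le : w w' c c' hc hs hc' hs' c0 c'0 / w <= w'.
  move=> H; have [/H|/ltW /H h] := leP w w'; first exact.
  by apply/esym/h.
have e : c' = (s - c) - (s - c') + c by ring.
have [lt|/eqP] := boolP (w < w').
  case/eqP: c'0; apply: (phom_lt0 hc'); rewrite e; apply: pleD; first apply: pleD.
  - by apply: ple_mono hs; lia.
  - exact: pleN.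
  - by apply: ple_mono (phom_ple hc); lia.
move=> nlt; have {nlt}ew : w = w' by move/eqP: nlt; lia.
rewrite -ew in hc' hs'.
apply/eqP; rewrite -subr_eq0; apply/eqP; apply: (phom_lt0 (phomD hc (phomN hc'))).
rewrite (_ : c - c' = (s - c') - (s - c)); last ring.
by apply: pleD => //; apply: pleN.
Qed.

Definition laurent a := exists (i : int) (b : B), a = X ^ i * iota b.

Lemma laurent_le a : laurent a -> exists N : nat, forall i : int, i <= - N%:Z -> exists b, a = X ^ i * iota b.
Proof.
move=> [j [b ->]]; exists (absz j) => i h.
have [k ek] : exists k : nat, Posz k = j - i by exists (absz (j - i)%R); lia.
exists ('X^k * b); rewrite -(X_int_nat iota b ek) mulrA -expfzDr ?X0 //.
by congr (X ^ _ * _); lia.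
Qed.

Lemma top_at e w (s c : S) : phom w c -> ple (w - 1) (s - c) -> ple w s -> (s != 0 -> c != 0) ->
  (s != 0 -> w <= e) -> exists c', [/\ phom e c', ple (e - 1) (s - c') & s != 0 -> w = e -> c' != 0].
Proof.
move=> hc hs hw hs0 h; have [->|s0] := eqVneq s 0.
  by exists 0; split; rewrite ?subrr //; [exact: phom0|exact: ple0].
have := h s0; rewrite le_eqVlt => /orP[/eqP <-|lt].
  by exists c; split=> // _ _; apply: hs0.
exists 0; rewrite subr0; split; first exact: phom0.
  by apply: ple_mono hw; lia.
by move=> _ ee; move: lt; rewrite ee ltxx.
Qed.

(** Factor out the largest power of x, then take the largest weight shift e of
   the three components. A component that shifts by less has leading part 0. *)
Lemma top_triple p q r : laurent p -> laurent q -> laurent r -> [|| p != 0, q != 0 | r != 0] ->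
  exists d e xi zeta theta, [/\ phom e xi, phom (e + 3) zeta, phom (e + 2) theta,
    [|| xi != 0, zeta != 0 | theta != 0] &
    [/\ Fil (d + 1) (e - 1) (p - X ^ (d + 1) * iota xi%:P),
        Fil d (e + 2) (q - X ^ d * iota zeta%:P) & Fil d (e + 1) (r - X ^ d * iota theta%:P)]].
Proof.
move=> hp hq hr nz.
have [d [b1 [b2 [b3 [e1 e2 e3 nz0]]]]] : exists (d : int) (b1 b2 b3 : B), [/\ p = X ^ (d + 1) * iota b1,
   q = X ^ d * iota b2, r = X ^ d * iota b3 & [|| b1`_0 != 0, b2`_0 != 0 | b3`_0 != 0]].
  have [N1 H1] := laurent_le hp; have [N2 H2] := laurent_le hq; have [N3 H3] := laurent_le hr.
  have [|b1 e1] := H1 (- (N1 + N2 + N3).+1%:Z + 1); first lia.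
  have [|b2 e2] := H2 (- (N1 + N2 + N3).+1%:Z); first lia.
  have [|b3 e3] := H3 (- (N1 + N2 + N3).+1%:Z); first lia.
  move: e1 e2 e3; move: (- _) => d e1 e2 e3.
  have : (size b1 + size b2 + size b3 <= (size b1 + size b2 + size b3))%N by [].
  move: {2}(size b1 + size b2 + size b3)%N => m.
  elim: m d b1 b2 b3 e1 e2 e3 => [|m IH] d b1 b2 b3 e1 e2 e3 sm.
    exfalso; move: sm nz; rewrite leqn0 !addn_eq0 !size_poly_eq0 => /andP[/andP[/eqP z1 /eqP z2] /eqP z3].
    by rewrite e1 e2 e3 z1 z2 z3 i0 !mulr0 eqxx.
  have [h|] := boolP [|| b1`_0 != 0, b2`_0 != 0 | b3`_0 != 0]; first by exists d, b1, b2, b3.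
  rewrite !negb_or !negbK => /and3P[/eqP z1 /eqP z2 /eqP z3].
  have [b1' e1'] := poly_dvdX z1; have [b2' e2'] := poly_dvdX z2; have [b3' e3'] := poly_dvdX z3.
  have step (i : int) (b : B) : X ^ i * iota ('X * b) = X ^ (i + 1) * iota b.
    by rewrite iM expfzDr ?X0 // expr1z mulrA.
  apply: (IH (d + 1) b1' b2' b3').
  - by rewrite e1 e1' step.
  - by rewrite e2 e2' step.
  - by rewrite e3 e3' step.
  have sz (b b' : B) : b = 'X * b' -> (size b' <= size b)%N /\ (b != 0 -> (size b' < size b)%N).
    move=> ->; rewrite mulrC; have [->|b'0] := eqVneq b' 0; first by rewrite mul0r size_poly0 eqxx.
    by rewrite size_mulX // ltnS leqnSn.
  have [s1 t1] := sz _ _ e1'; have [s2 t2] := sz _ _ e2'; have [s3 t3] := sz _ _ e3'.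
  have : [|| b1 != 0, b2 != 0 | b3 != 0].
    by move: nz; rewrite e1 e2 e3 !mulf_eq0 !expfz_eq0 (negPf X0) !andbF /= !iota_neq0.
  by clear -s1 s2 s3 t1 t2 t3 sm; case/or3P=> [/t1|/t2|/t3]; lia.
have [w1 [c1 [h1 g1 l1 k1]]] := ple_lead b1`_0.
have [w2 [c2 [h2 g2 l2 k2]]] := ple_lead b2`_0.
have [w3 [c3 [h3 g3 l3 k3]]] := ple_lead b3`_0.
have [e [m1 m2 m3 mm]] := max3 w1 (w2 - 3) (w3 - 2) nz0.
have [xi [hx gx kx]] := top_at h1 g1 l1 k1 m1.
have [|zeta [hz gz kz]] := @top_at (e + 3) _ _ _ h2 g2 l2 k2; first by move=> /m2 hh; clear -hh; lia.
have [|theta [ht gt kt]] := @top_at (e + 2) _ _ _ h3 g3 l3 k3; first by move=> /m3 hh; clear -hh; lia.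
exists d, e, xi, zeta, theta; split=> //.
  case/or3P: mm => /andP[nzk /eqP ew].
  - by rewrite kx.
  - by rewrite (kz nzk) ?orbT //; clear -ew; lia.
  - by rewrite (kt nzk) ?orbT //; clear -ew; lia.
have fil (i w : int) (b : B) (c : S) : ple w (b`_0 - c) -> Fil i w (X ^ i * iota b - X ^ i * iota c%:P).
  move=> h; rewrite -mulrBr -(rmorphB iota); apply: Fil_intro.
  by rewrite coefB coefC.
rewrite e1 e2 e3; split; apply: fil => //.
  by apply: ple_mono gz; clear; lia.
by apply: ple_mono gt; clear; lia.
Qed.
End TopParts.

(** * Kernels of locally nilpotent derivations *)

Section Kernel.
Variables (C : numClosedFieldType) (S : plane C).
Local Notation B := {poly S}.
Local Notation bx := (bx S).
Local Notation bz := (bz S).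
Local Notation bt := (bt S).
Local Notation cst := (cst S).
Variables (Q : fieldType) (iota : {rmorphism B -> Q}).
Hypothesis iota_inj : injective iota.
Hypothesis iota_frac : forall u, exists a b, b != 0 /\ u = iota a / iota b.
Local Notation X := (iota bx).
Local Notation Z := (iota bz).
Local Notation T := (iota bt).
Local Notation X0 := (X_neq0 iota_inj).
Local Notation Fil := (Fil iota).
Local Notation P := (pcusp_poly S).

Let i0 : iota 0 = 0. Proof. exact: rmorph0. Qed.
Let i1 : iota 1 = 1. Proof. exact: rmorph1. Qed.
Let iD a b : iota (a + b) = iota a + iota b. Proof. exact: rmorphD. Qed.
Let iN a : iota (- a) = - iota a. Proof. exact: rmorphN. Qed.
Let iM a b : iota (a * b) = iota a * iota b. Proof. exact: rmorphM. Qed.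
Let iX a n : iota (a ^+ n) = iota a ^+ n. Proof. exact: rmorphXn. Qed.

Variables (n : nat) (r : B).
Hypothesis hn : (1 < n)%N.
Local Notation A := (inA iota n r).
Let hn0 : (0 < n)%N. Proof. exact: ltnW. Qed.

Variable D : Q -> Q.
Hypothesis DD : scalar_der iota D.
Hypothesis DA : forall a, A a -> A (D a).
Hypothesis Dnil : forall a, A a -> nilp D a.

Variables (d e : int) (xi zeta theta : S).
Hypotheses (hxi : phom e xi) (hzeta : phom (e + 3) zeta) (htheta : phom (e + 2) theta).
Hypothesis nz : [|| xi != 0, zeta != 0 | theta != 0].
Hypotheses (FX : Fil (d + 1) (e - 1) (D X - X ^ (d + 1) * iota xi%:P))
  (FZ : Fil d (e + 2) (D Z - X ^ d * iota zeta%:P))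
  (FT : Fil d (e + 1) (D T - X ^ d * iota theta%:P)).

(** The leading part of D. *)
Definition dtop := mkder iota_frac (X ^ (d + 1) * iota xi%:P) (X ^ d * iota zeta%:P) (X ^ d * iota theta%:P).

Let dtopD : scalar_der iota dtop. Proof. exact: mkderP. Qed.
Let dtopX : dtop X = X ^ (d + 1) * iota xi%:P. Proof. exact: mkderX. Qed.
Let dtopZ : dtop Z = X ^ d * iota zeta%:P. Proof. exact: mkderZ. Qed.
Let dtopT : dtop T = X ^ d * iota theta%:P. Proof. exact: mkderT. Qed.

Definition bihom (i w : int) (h : Q) := exists2 c : S, phom w c & h = X ^ i * iota c%:P.

Lemma bihom_dtop i w h : bihom i w h -> bihom (i + d) (w + e) (dtop h).
Proof.
move=> [c hc ->]; exists (pcst S i%:~R * xi * c + (pdz c * zeta + pdt c * theta)).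
  apply: phomD; last apply: phomD.
  - by rewrite addrC -[e]add0r; apply: phomM => //; apply: phomM => //; apply: phom_cst.
  - by rewrite (_ : w + e = (w - 3) + (e + 3)); [apply: phomM => //; apply: phom_dz|ring].
  - by rewrite (_ : w + e = (w - 2) + (e + 2)); [apply: phomM => //; apply: phom_dt|ring].
rewrite (derM dtopD.1) (derXz dtopD.1) ?X0 // (der_iota dtopD c%:P) BdxC BdzC BdtC.
rewrite dtopX dtopZ dtopT i0 mul0r add0r.
have -> : X ^ (i + d) = X ^ (i - 1) * X ^ (d + 1) by rewrite -expfzDr ?X0 //; congr (_ ^ _); ring.
have -> : X ^ i * (iota (pdz c)%:P * (X ^ d * iota zeta%:P) + iota (pdt c)%:P * (X ^ d * iota theta%:P))
  = X ^ (i - 1) * X ^ (d + 1) * (iota (pdz c)%:P * iota zeta%:P + iota (pdt c)%:P * iota theta%:P).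
  rewrite -expfzDr ?X0 // (_ : i - 1 + (d + 1) = i + d); last ring.
  by rewrite expfzDr ?X0 //; ring.
rewrite !polyCD !polyCM !iD !iM !rmorph_int; ring.
Qed.

Lemma FilX_dtop i w a : Fil i w a -> Fil (i + d) (w + e) (D a).
Proof.
have m w1 w2 i' a' : w1 <= w2 -> Fil i' w1 a' -> Fil i' w2 a' by exact: Fil_mono.
have f i' w' c : phom w' c -> Fil i' w' (X ^ i' * iota c%:P).
  by move=> /phom_ple hc; apply: Fil_intro; rewrite coefC.
apply: Fil_der => //.
- by rewrite -(subrK (X ^ (d + 1) * iota xi%:P) (D X)); apply: FilD; [apply: m FX; lia|exact: f].
- by rewrite -(subrK (X ^ d * iota zeta%:P) (D Z)); apply: FilD; [apply: m FZ; lia|exact: f].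
- by rewrite -(subrK (X ^ d * iota theta%:P) (D T)); apply: FilD; [apply: m FT; lia|exact: f].
Qed.

Lemma Fil_sub_dtop i w h : Fil i w h -> Fil (i + d) (w + e - 1) (D h - dtop h).
Proof.
move=> hh; rewrite -addrA.
have DD' : scalar_der iota (fun a => D a - dtop a).
  split; [split=> a b|move=> c]; last by rewrite DD.2 dtopD.2 subr0.
    by rewrite (derD DD.1) (derD dtopD.1); ring.
  by rewrite (derM DD.1) (derM dtopD.1); ring.
apply: (@Fil_der _ _ _ _ iota_inj _ d (e - 1) DD') => //.
- by rewrite dtopX.
- by rewrite dtopZ (_ : e - 1 + 3 = e + 2) //; ring.
- by rewrite dtopT (_ : e - 1 + 2 = e + 1) //; ring.
Qed.

(** Homogeneous leading parts of elements of A. The local nilpotency of D on A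
   passes to dtop on these elements. *)
Definition leading i w h := bihom i w h /\ exists2 a, A a & Fil i (w - 1) (a - h).

Lemma leading_step i w h a : bihom i w h -> Fil i (w - 1) (a - h) ->
  Fil (i + d) (w + e - 1) (D a - dtop h).
Proof.
move=> [c hc eh] ha; rewrite (_ : D a - dtop h = D (a - h) + (D h - dtop h)); last first.
  by rewrite (derB DD.1) addrA subrK.
apply: FilD; first by rewrite addrAC; apply: FilX_dtop.
by apply: Fil_sub_dtop; rewrite eh; apply: Fil_intro; rewrite coefC; apply: phom_ple.
Qed.

Lemma leading_dtop i w h : leading i w h -> leading (i + d) (w + e) (dtop h).
Proof.
move=> [hh [a Aa ha]]; split; first exact: bihom_dtop.
by exists (D a); [exact: DA|exact: leading_step].
Qed.

Lemma bihom_small i w h : bihom i w h -> Fil i (w - 1) (- h) -> h = 0.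
Proof.
move=> [c hc ->] [b [eb hb]]; suff -> : c = 0 by rewrite polyC0 i0 mulr0.
apply: (phom_lt0 hc); rewrite -[c]opprK; apply: pleN.
suff -> : - c = b`_0 by [].
have /iota_inj <- : iota (- c%:P) = iota b.
  by apply: (mulfI (expfz_neq0 i X0)); rewrite -eb iN mulrN.
by rewrite coefN coefC.
Qed.

(** Iterates of dtop on h are leading parts of iterates of D on a, as long as
   these do not vanish. *)
Lemma leading_nilp i w h : leading i w h -> nilp dtop h.
Proof.
move=> [hh [a Aa ha]]; have [k hk] := Dnil Aa; exists k.
elim: k i w h a hh ha hk {Aa} => [|k IH] i w h a hh ha hk.
  by move: ha; rewrite [a]hk sub0r; apply: bihom_small.
rewrite !iterSr in hk *.
by apply: (IH (i + d) (w + e) _ (D a)) => //; [exact: bihom_dtop|exact: leading_step].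
Qed.

Lemma leading_iter i w h k : leading i w h -> leading (i + k%:Z * d) (w + k%:Z * e) (iter k dtop h).
Proof.
move=> hh; elim: k => [|k IH]; first by rewrite !mul0r !addr0.
have -> : i + k.+1%:Z * d = i + k%:Z * d + d by rewrite -addn1 PoszD; ring.
have -> : w + k.+1%:Z * e = w + k%:Z * e + e by rewrite -addn1 PoszD; ring.
exact: leading_dtop.
Qed.

(** The leading part of y. The terms of G that involve x do not contribute. *)
Definition ytop : Q := - iota P%:P / X ^+ n.

Let ch0 : forall m, m.+1%:R != 0 :> Q. Proof. exact: Qchar0 iota_inj. Qed.

Lemma ytop_rel : X ^+ n * ytop + Z ^+ 2 + T ^+ 3 = 0.
Proof.
rewrite /ytop mulrCA mulfV ?mulr1 ?expf_neq0 ?X0 // /P polyCD !polyC_exp iD !iX /bz /bt; ring.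
Qed.

Lemma ytop_neq0 : ytop != 0.
Proof.
by rewrite mulf_neq0 ?oppr_eq0 ?invr_eq0 ?expf_neq0 ?X0 // iota_neq0 // polyC_eq0 P_neq0.
Qed.

Lemma ytop_pow m : (X ^+ n) ^+ m * ytop ^+ m = iota (cst ((-1) ^+ m)) * iota (P ^+ m)%:P.
Proof.
rewrite -exprMn /ytop mulrCA mulfV ?expf_neq0 ?X0 // mulr1 -(mulN1r (iota _)) (exprMn m (-1)) polyC_exp iX.
have -> : iota (cst ((-1) ^+ m)) = (-1) ^+ m by rewrite (rmorphXn cst) (rmorphXn iota) !rmorphN !rmorph1.
by [].
Qed.

Lemma phomP : phom 6 P.
Proof.
apply: phomD; first exact: (phomM (phom_z S) (phom_z S)).
exact: (phomM (phom_t S) (phomM (phom_t S) (phom_t S))).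
Qed.

Lemma phomPX m : phom (6 * m%:Z) (P ^+ m).
Proof.
elim: m => [|m IH]; first by rewrite mulr0 expr0 -(rmorph1 (pcst S)); apply: phom_cst.
by rewrite exprS (_ : 6 * m.+1%:Z = 6 + 6 * m%:Z); [apply: phomM => //; exact: phomP|lia].
Qed.

Lemma leading_self i w c b : phom w c -> A (X ^ i * iota c%:P) -> b = X ^ i * iota c%:P -> leading i w b.
Proof.
move=> hc Ac ->; split; first by exists c.
by exists (X ^ i * iota c%:P) => //; rewrite subrr; apply: Fil0.
Qed.

Lemma leading_S w c : phom w c -> leading 0 w (iota c%:P).
Proof.
by move=> hc; apply: (leading_self hc); rewrite expr0z mul1r //; apply: inA_iota.
Qed.

Lemma leading_X : leading 1 0 X.
Proof.
have ex : X = X ^ 1 * iota (pcst S 1)%:P by rewrite expr1z rmorph1 polyC1 i1 mulr1.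
by apply: (leading_self (phom_cst S 1)) => //; rewrite -ex; apply: inA_iota.
Qed.

Lemma leading_y : leading (- n%:Z) 6 ytop.
Proof.
have eb (b : B) : - iota b / X ^+ n = X ^ (- n%:Z) * iota (- b).
  by rewrite -exprnN iN mulrC.
split; first by exists (- P); [apply: phomN; exact: phomP|rewrite /ytop eb polyCN].
exists (cy iota n r); first exact: inA_y.
rewrite /cy /ytop !eb -mulrBr -(rmorphB iota); apply: Fil_intro.
rewrite coefB !coefN G_coef0 coefC subrr; exact: ple0.
Qed.

Lemma nilp_S c : nilp dtop (iota c%:P).
Proof.
elim/pind: c => [c|||a b ha hb|a b ha hb].
- by exists 1%N; rewrite /= dtopD.2.
- exact: (leading_nilp (leading_S (phom_z S))).
- exact: (leading_nilp (leading_S (phom_t S))).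
- by rewrite polyCD iD; apply: nilpD; rewrite ?dtopD.1 //; exact: dtopD.1.
- by rewrite polyCM iM; apply: nilpM; rewrite ?dtopD.1 //; exact: dtopD.1.
Qed.

(** By [inA_lead] the coefficient of a pole contains enough factors z^2 + t^3 for
   the negative powers of x to be absorbed in powers of y. *)
Lemma leading_form i w h : leading i w h -> h != 0 -> exists (j m : nat) (c : S) (w' : int),
  [/\ h = X ^+ j * ytop ^+ m * iota c%:P, phom w' c & j%:Z = i + (n * m)%N].
Proof.
move=> [[c hc eh] [a Aa [b' [eb' hb']]]] h0.
have c0 : c != 0 by apply: contraNneq h0 => c0; rewrite eh c0 polyC0 i0 mulr0.
have ea : a = X ^ i * iota (c%:P + b') by rewrite iD mulrDr -eb' -eh addrC subrK.
have [m [c' [ec' hm]]] := inA_lead iota_inj hn0 Aa ea.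
have [w' [c1 [hc1 lc1 _ nc1]]] := ple_lead c'.
have c'0 : c' != 0.
  apply: contraNneq c0 => c'0; move: ec'; rewrite coefD coefC c'0 mulr0 => /eqP.
  rewrite addr_eq0 => /eqP cb; apply/eqP; apply: (phom_lt0 hc); rewrite cb; exact: pleN.
have ec : c = P ^+ m * c1.
  apply: (@top_uniq _ _ w (6 * m%:Z + w') (c + b'`_0)) => //.
  - by rewrite [c + _]addrC addrK.
  - by apply: phomM => //; apply: phomPX.
  - move: ec'; rewrite coefD coefC /= => ->; rewrite -mulrBr -addrA.
    by apply: pleM => //; apply: phom_ple; apply: phomPX.
  - by rewrite mulf_neq0 ?expf_neq0 ?P_neq0 ?nc1.
have [j ej] : exists j : nat, j%:Z = i + (n * m)%N by exists (absz (i + Posz (n * m)%N)%R); lia.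
exists j, m, (pcst S ((-1) ^+ m) * c1), w'; split=> //; last first.
  by rewrite -[w']add0r; apply: phomM => //; apply: phom_cst.
have -> : X ^+ j = X ^ i * (X ^+ n) ^+ m.
  by rewrite -exprM !exprnP -expfzDr ?X0 // ej.
have ey := ytop_pow m.
rewrite eh ec -mulrA -[RHS]mulrA; congr (_ * _).
have kk : iota (cst ((-1) ^+ m)) * iota (cst ((-1) ^+ m)) = 1.
  by rewrite -iM -(rmorphM cst) -expr2 sqrr_sign rmorph1 i1.
by rewrite !polyCM !iM mulrA ey mulrACA kk mul1r.
Qed.

(** The leading part of an element with a pole is killed by dtop and has y as a
   factor, by [leading_form]; kernels are factorially closed. *)
Lemma pole_ytop_ker f : A f -> D f = 0 -> (forall b, f <> iota b) -> dtop ytop = 0.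
Proof.
move=> Af Df nf.
have [i [b [ef b0 i_lt0]]] : exists (i : int) (b : B), [/\ f = X ^ i * iota b, b`_0 != 0 & i < 0].
  have [m [c ec]] : exists (m : nat) (c : B), f = X ^ (- m%:Z) * iota c.
    have [c ->] := Af; have [b' e'] := evA_clear iota_inj r hn0 (leqnSn (size c)).
    exists (n * size c)%N, (c`_(size c) * (- cG r) ^+ size c + 'X^n * b'); rewrite -e' mulrA -exprnN mulVf ?mul1r ?expf_neq0 ?X0 //.
  have c0 : c != 0 by apply/eqP => c0; apply: (nf 0); rewrite ec c0 i0 mulr0.
  have [k [c' [ec' c'0]]] := poly_valuation c0.
  have ef : f = X ^ (k%:Z - m%:Z) * iota c'.
    by rewrite ec ec' -(X_int_nat iota c' (erefl k%:Z)) mulrA -expfzDr ?X0 // addrC.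
  exists (k%:Z - m%:Z), c'; split=> //; rewrite ltNge; apply/negP => ge.
  have [l el] : exists l : nat, l%:Z = k%:Z - m%:Z by exists (k - m)%N; lia.
  by apply: (nf ('X^l * c')); rewrite -(X_int_nat iota c' el).
have [w [c [hc lc lb nc]]] := ple_lead b`_0.
have c0 := nc b0; pose h := X ^ i * iota c%:P.
have bh : bihom i w h by exists c.
have Fh : Fil i (w - 1) (f - h).
  by rewrite ef /h -mulrBr -(rmorphB iota); apply: Fil_intro; rewrite coefB coefC.
have h0 : h != 0 by rewrite mulf_neq0 ?expfz_neq0 ?X0 // iota_neq0 // polyC_eq0.
have dh : dtop h = 0.
  apply: (bihom_small (bihom_dtop bh)).
  by have := leading_step bh Fh; rewrite Df sub0r.
have hl : leading i w h by split=> //; exists f.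
have [j [m [c1 [w' [eh _ ej]]]]] := leading_form hl h0.
have [m' em] : exists m', m = m'.+1 by exists m.-1; rewrite prednK // lt0n; apply/eqP => m0; move: ej; rewrite m0 muln0; lia.
rewrite eh in h0 dh.
have nX : nilp dtop X := leading_nilp leading_X.
have ny : nilp dtop ytop := leading_nilp leading_y.
have nD := dtopD.1.
have [dXy _] := nilp_neq0M nD ch0 (nilpM nD (nilpX nD j nX) (nilpX nD m ny)) (nilp_S c1) h0 dh.
move: h0; rewrite mulf_eq0 negb_or => /andP[h0 _].
have [_ dy] := nilp_neq0M nD ch0 (nilpX nD j nX) (nilpX nD m ny) h0 dXy.
by apply: (@nilp_Xker _ _ nD ch0 _ m' ny ytop_neq0); rewrite -em.
Qed.

Section KernelTop.
Hypothesis dy : dtop ytop = 0.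

Let nD := dtopD.1.
Let nX : nilp dtop X := leading_nilp leading_X.
Let nZ : nilp dtop Z := leading_nilp (leading_S (phom_z S)).
Let nT : nilp dtop T := leading_nilp (leading_S (phom_t S)).

Let dtop_neq0 : ~ [/\ dtop X = 0, dtop Z = 0 & dtop T = 0].
Proof.
have f (i : int) (c : S) : X ^ i * iota c%:P = 0 -> c = 0.
  move/eqP => h; apply/eqP; apply: contraTT h => c0.
  by rewrite mulf_neq0 ?expfz_neq0 ?X0 // iota_neq0 // polyC_eq0.
rewrite dtopX dtopZ dtopT => -[/f e1 /f e2 /f e3].
by move: nz; rewrite e1 e2 e3 eqxx.
Qed.

Lemma linear_comb_neq0 (k1 k2 : C) : k1 != 0 -> pcst S k1 * pz S ^+ 2 + pcst S k2 * pt S ^+ 3 != 0.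
Proof.
move=> h; have [g [gc gz gt]] := peval S idfun 1 0.
apply/eqP=> /(congr1 g); rewrite rmorphD !rmorphM /= gz gt !gc rmorph0 !(mulr0, mul0r, mulr1, addr0).
by apply/eqP.
Qed.

(** The factors of a homogeneous element are y, x, z, t and z^2 + mu t^3, and all
   of them except y are excluded from the kernel by the degree counts. *)
Lemma leading_ker i w h : leading i w h -> h != 0 -> dtop h = 0 ->
  exists (k : C) (m : nat), [/\ k != 0, h = iota (cst k) * ytop ^+ m & i = - (n * m)%N%:Z].
Proof.
move=> hl h0 dh; have [j [m [c [w' [eh hc ej]]]]] := leading_form hl h0.
have ny : nilp dtop ytop := leading_nilp leading_y.
rewrite eh in h0 dh.
have [dXy dc] := nilp_neq0M nD ch0 (nilpM nD (nilpX nD j nX) (nilpX nD m ny)) (nilp_S c) h0 dh.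
move: h0; rewrite mulf_eq0 negb_or => /andP[h0 c0].
have [dXj _] := nilp_neq0M nD ch0 (nilpX nD j nX) (nilpX nD m ny) h0 dXy.
have notker (K : [/\ dtop X = 0, dtop Z = 0 & dtop T = 0]) : False by exact: dtop_neq0.
have j0 : j = 0%N.
  case: j dXj {eh ej h0 dXy dh} => // j dXj; case: notker.
  have dX := nilp_Xker nD ch0 nX X0 dXj.
  exact: (x_ker_trivial nD ch0 hn nZ nT X0 ytop_neq0 (Z_neq0 iota_inj) (T_neq0 iota_inj) dy ytop_rel dX).
move: c0; rewrite iota_neq0 // polyC_eq0 => c0.
have [[k ek]|[f [s' [ef ff]]]] := phom_factor hc c0.
  exists k, m; split.
  - by apply: contraNneq c0 => k0; rewrite ek k0 rmorph0.
  - by rewrite eh j0 expr0 mul1r ek mulrC.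
  - by move: ej; rewrite j0 => /esym/eqP; rewrite addr_eq0 => /eqP.
have [df _] : dtop (iota f%:P) = 0 /\ dtop (iota s'%:P) = 0.
  apply: (nilp_neq0M nD ch0 (nilp_S _) (nilp_S _)).
    by rewrite -iM -polyCM -ef iota_neq0 // polyC_eq0.
  by rewrite -iM -polyCM -ef.
case: notker; case: ff => [ff|ff|[mu mu0 ff]]; rewrite ff in df.
- exact: (z_ker_trivial nD ch0 hn nX nT X0 ytop_neq0 (Z_neq0 iota_inj) (T_neq0 iota_inj) dy ytop_rel df).
- exact: (t_ker_trivial nD ch0 hn nX nZ X0 ytop_neq0 (Z_neq0 iota_inj) (T_neq0 iota_inj) dy ytop_rel df).
have e2 : iota (pz S ^+ 2 + pcst S mu * pt S ^+ 3)%:P = Z ^+ 2 + iota (cst mu) * T ^+ 3.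
  by rewrite polyCD (polyCM (pcst S mu)) !polyC_exp iD (iM (pcst S mu)%:P) !iX.
rewrite e2 in df.
apply: (cusp_ker_trivial nD ch0 hn nZ nT X0 ytop_neq0 (Z_neq0 iota_inj) (T_neq0 iota_inj) dy ytop_rel _ _ _ df).
- by rewrite cst_neq0.
- exact: dtopD.2.
rewrite -e2 iota_neq0 // polyC_eq0.
by have := @linear_comb_neq0 1 mu (oner_neq0 _); rewrite rmorph1 mul1r.
Qed.

(** The last nonzero iterate is in the kernel, so it is a multiple of a power of
   y. The bidegree (0, 6) of h then determines the number N of iterations. *)
Lemma last_derivative h : leading 0 6 h -> h != 0 -> exists (k : C) (N m : nat),
  [/\ k != 0, iter N dtop h = iota (cst k) * ytop ^+ m, iter N.+1 dtop h = 0 &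
      N%:Z * (6 * d + n%:Z * e) = - 6 * n%:Z /\ N%:Z * d = - (n * m)%N%:Z].
Proof.
move=> hl h0; have [N [hN hN1]] := ldeg_ex (leading_nilp hl) h0.
have hlN := leading_iter N hl; have [k [m [k0 ek ei]]] := leading_ker hlN hN hN1.
exists k, N, m; split=> //.
have e1 : N%:Z * d = - (n * m)%N%:Z by rewrite -ei add0r.
have e2 : 6 + N%:Z * e = 6 * m%:Z.
  have [[c hc ec] _] := hlN.
  have : X ^ (- (n * m)%N%:Z) * iota c%:P = X ^ (- (n * m)%N%:Z) * iota (pcst S (k * (-1) ^+ m) * P ^+ m)%:P.
    rewrite -{1}ei -ec ek polyCM iM -/(cst _) (rmorphM cst) iM -mulrA -ytop_pow -exprM.
    by rewrite -exprnN mulrCA mulKf ?expf_neq0 ?X0.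
  move/(mulfI (expfz_neq0 _ X0))/iota_inj/polyC_inj => ec'.
  have c0 : c != 0 by apply: contraNneq hN => c0; rewrite ec c0 polyC0 i0 mulr0.
  apply: (phom_uniq hc _ c0); rewrite ec' -[6 * _]add0r.
  by apply: phomM; [exact: phom_cst|exact: phomPX].
by split=> //; nia.
Qed.

(** The last nonzero iterates of z^2 and t^3 have the same order and are
   proportional. The combination of z^2 and t^3 for which they cancel still has
   bidegree (0, 6), so by [last_derivative] it should have a nonzero iterate of
   that order. *)
Lemma top_contradiction : False.
Proof.
have hz : leading 0 6 (iota (pz S ^+ 2)%:P) by apply: leading_S; apply: (phomM (phom_z S) (phom_z S)).
have ht : leading 0 6 (iota (pt S ^+ 3)%:P) by apply: leading_S; apply: (phomM (phom_t S) (phomM (phom_t S) (phom_t S))).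
have S0 (s : S) : s != 0 -> iota s%:P != 0 by rewrite iota_neq0 // polyC_eq0.
have [k1 [N1 [m1 [k10 e1 z1 [d1 d1']]]]] := last_derivative hz (S0 _ (expf_neq0 2 (pz_neq0 S))).
have [k2 [N2 [m2 [k20 e2 z2 [d2 d2']]]]] := last_derivative ht (S0 _ (expf_neq0 3 (pt_neq0 S))).
pose u : S := pcst S k2 * pz S ^+ 2 + pcst S (- k1) * pt S ^+ 3.
have hu : leading 0 6 (iota u%:P).
  apply: leading_S; rewrite -[6]add0r; apply: phomD; apply: phomM; try exact: phom_cst.
    exact: (phomM (phom_z S) (phom_z S)).
  exact: (phomM (phom_t S) (phomM (phom_t S) (phom_t S))).
have [k3 [N3 [m3 [k30 e3 z3 [d3 d3']]]]] := last_derivative hu (S0 _ (linear_comb_neq0 _ k20)).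
have eN12 : N1 = N2 by nia.
have eN13 : N1 = N3 by nia.
have em : m1 = m2 by nia.
have : iter N3 dtop (iota u%:P) = 0.
  rewrite /u polyCD (polyCM (pcst S k2)) (polyCM (pcst S (- k1))) iD.
  rewrite (iM (pcst S k2)%:P) (iM (pcst S (- k1))%:P) (iterDD nD).
  rewrite (iterDcM nD _ _ (dtopD.2 k2)) (iterDcM nD _ _ (dtopD.2 (- k1))).
  by rewrite -eN13 e1 eN12 e2 em (rmorphN cst) iN; ring.
apply/eqP; rewrite e3 mulf_neq0 //; last by rewrite expf_neq0 // ytop_neq0.
by rewrite cst_neq0.
Qed.
End KernelTop.
End Kernel.

(** If an element with a pole were in the kernel, then y would be in the kernel
   of the leading part of D, by [pole_ytop_ker]; this is excluded by
   [top_contradiction]. *)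
Theorem lnd_kernel (C : numClosedFieldType) (S : plane C) (Q : fieldType) (iota : {rmorphism {poly S} -> Q}) :
  injective iota -> (forall u, exists a b, b != 0 /\ u = iota a / iota b) ->
  forall (n : nat) (r : {poly S}) (D : Q -> Q), (1 < n)%N -> scalar_der iota D ->
  (forall a, inA iota n r a -> inA iota n r (D a)) -> (forall a, inA iota n r a -> nilp D a) ->
  (exists2 a, inA iota n r a & D a <> 0) ->
  forall f, inA iota n r f -> D f = 0 -> exists b, f = iota b.
Proof.
move=> inj frac n r D hn DD DA Dnil [a Aa Da] f Af Df.
have X0 := X_neq0 inj.
have LA c : inA iota n r c -> laurent iota c.
  move=> [c' ->]; have [b' e'] := evA_clear inj r (ltnW hn) (leqnSn (size c')).
  exists (- (n * size c')%N%:Z), (c'`_(size c') * (- cG r) ^+ size c' + 'X^n * b').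
  by rewrite -e' mulrA -exprnN mulVf ?mul1r ?expf_neq0 ?X0.
have nz : [|| D (iota (bx S)) != 0, D (iota (bz S)) != 0 | D (iota (bt S)) != 0].
  apply/contraPT: Da; rewrite !negb_or !negbK => /and3P[/eqP e1 /eqP e2 /eqP e3].
  have Db b : D (iota b) = 0 by rewrite (der_iota DD) e1 e2 e3 !mulr0 !addr0.
  have [u [v [v0 ->]]] := frac a.
  by rewrite (derM DD.1) (derV DD.1) ?iota_neq0 // !Db oppr0 !mul0r mulr0 addr0.
have [d [e [xi [zeta [theta [h1 h2 h3 h4 [h5 h6 h7]]]]]]] :=
  top_triple inj (LA _ (DA _ (inA_iota _ _ _ _))) (LA _ (DA _ (inA_iota _ _ _ _))) (LA _ (DA _ (inA_iota _ _ _ _))) nz.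
apply: boolp.contrapT => nf.
have nf' b : f <> iota b by move=> fb; apply: nf; exists b.
have dy := pole_ytop_ker inj frac hn DD Dnil h1 h2 h3 h4 h5 h6 h7 Af Df nf'.
exact: (top_contradiction inj hn DD DA Dnil h1 h2 h3 h4 h5 h6 h7 dy).
Qed.

(** * Hamiltonian flows modulo a power of x *)

Lemma triangular_sum (V : zmodType) (F : nat -> nat -> V) n :
  \sum_(0 <= N < n) \sum_(0 <= i < N.+1) F i (N - i)%N = \sum_(0 <= i < n) \sum_(0 <= l < n - i) F i l.
Proof.
elim: n => [|n IH]; first by rewrite !big_geq.
rewrite big_nat_recr //= IH [in RHS]big_nat_recr //= subSnn big_nat1.
rewrite [X in _ + X = _]big_nat_recr //= subnn addrA; congr (_ + _).
rewrite -big_split /=; apply: eq_big_nat => i /andP[_ lt].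
by rewrite subSn 1?ltnW // big_nat_recr.
Qed.

Section Flow.
Variables (C : numClosedFieldType) (S : plane C).
Local Notation B := {poly S}.
Local Notation cst := (cst S).
Local Notation P := (pcusp_poly S).
Implicit Types a b c : B.

Definition cong (n : nat) a b := exists q, a = b + 'X^n * q.

Lemma cong_refl n a : cong n a a. Proof. by exists 0; rewrite mulr0 addr0. Qed.
Lemma cong_sym n a b : cong n a b -> cong n b a.
Proof. by move=> [q ->]; exists (- q); rewrite mulrN addrK. Qed.
Lemma cong_trans n a b c : cong n a b -> cong n b c -> cong n a c.
Proof. by move=> [q ->] [q' ->]; exists (q' + q); rewrite mulrDr addrA. Qed.
Lemma congD n a b a' b' : cong n a b -> cong n a' b' -> cong n (a + a') (b + b').
Proof. by move=> [q ->] [q' ->]; exists (q + q'); ring. Qed.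
Lemma congM n a b a' b' : cong n a b -> cong n a' b' -> cong n (a * a') (b * b').
Proof. by move=> [q ->] [q' ->]; exists (q * b' + b * q' + 'X^n * q * q'); ring. Qed.
Lemma cong_le m n a b : (m <= n)%N -> cong n a b -> cong m a b.
Proof.
by move=> le [q ->]; exists ('X^(n - m) * q); rewrite mulrA -exprD subnKC.
Qed.
Lemma cong_sum0 n (I : eqType) (s : seq I) (Pr : pred I) (F : I -> B) :
  (forall i, i \in s -> Pr i -> cong n (F i) 0) -> cong n (\sum_(i <- s | Pr i) F i) 0.
Proof.
move=> h; rewrite big_seq_cond; apply: (big_ind (fun a => cong n a 0)); first exact: cong_refl.
  by move=> a b ha hb; rewrite -[0](addr0 0); apply: congD.
by move=> i /andP[]; apply: h.
Qed.

(** The Poisson bracket in z and t. *)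
Definition br a b := Bdz a * Bdt b - Bdt a * Bdz b.

Lemma Bdz0 : Bdz (0 : B) = 0. Proof. exact: map_poly0. Qed.
Lemma Bdt0 : Bdt (0 : B) = 0. Proof. exact: map_poly0. Qed.
Lemma pdzN (u : S) : pdz (- u) = - pdz u.
Proof. by apply: (@addrI _ (pdz u)); rewrite -pdzD !subrr pdz0. Qed.
Lemma pdtN (u : S) : pdt (- u) = - pdt u.
Proof. by apply: (@addrI _ (pdt u)); rewrite -pdtD !subrr pdt0. Qed.
Lemma BdzN a : Bdz (- a) = - Bdz a.
Proof. by apply/polyP=> i; rewrite coefN !Bdz_coef coefN pdzN. Qed.
Lemma BdtN a : Bdt (- a) = - Bdt a.
Proof. by apply/polyP=> i; rewrite coefN !Bdt_coef coefN pdtN. Qed.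
Lemma BdzXn n a : Bdz ('X^n * a) = 'X^n * Bdz a.
Proof.
have h : Bdz ('X^n) = 0 :> B.
  elim: n => [|n IH]; first by rewrite expr0 -[1]/(1%:P) BdzC pdz1 polyC0.
  by rewrite exprS BdzM IH mulr0 addr0 (BdzX S) mul0r.
by rewrite BdzM h mul0r add0r.
Qed.
Lemma BdtXn n a : Bdt ('X^n * a) = 'X^n * Bdt a.
Proof.
have h : Bdt ('X^n) = 0 :> B.
  elim: n => [|n IH]; first by rewrite expr0 -[1]/(1%:P) BdtC pdt1 polyC0.
  by rewrite exprS BdtM IH mulr0 addr0 (BdtX S) mul0r.
by rewrite BdtM h mul0r add0r.
Qed.
Lemma Bdzt a : Bdz (Bdt a) = Bdt (Bdz a).
Proof. by apply/polyP=> i; rewrite !(Bdz_coef, Bdt_coef) pdz_dt. Qed.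

Lemma brDl a a' b : br (a + a') b = br a b + br a' b.
Proof. rewrite /br BdzD BdtD; ring. Qed.
Lemma brDr a b b' : br a (b + b') = br a b + br a b'.
Proof. rewrite /br BdzD BdtD; ring. Qed.
Lemma brMr a b b' : br a (b * b') = br a b * b' + b * br a b'.
Proof. rewrite /br BdzM BdtM; ring. Qed.
Lemma brMl a a' b : br (a * a') b = br a b * a' + a * br a' b.
Proof. rewrite /br BdzM BdtM; ring. Qed.
Lemma braa a : br a a = 0. Proof. rewrite /br; ring. Qed.
Lemma br0r b : br b 0 = 0. Proof. by rewrite /br ?Bdz0 ?Bdt0; ring. Qed.
Lemma brXnl n a b : br ('X^n * a) b = 'X^n * br a b.
Proof. rewrite /br BdzXn BdtXn; ring. Qed.
Lemma brXnr n a b : br a ('X^n * b) = 'X^n * br a b.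
Proof. rewrite /br BdzXn BdtXn; ring. Qed.
Lemma br_jacobi a b c : br a (br b c) = br (br a b) c + br b (br a c).
Proof.
rewrite /br !BdzD !BdtD !BdzN !BdtN !BdzM !BdtM !Bdzt; ring.
Qed.
Lemma Bdz_cst u : Bdz (cst u) = 0. Proof. by rewrite /cst BdzC pdz_cst polyC0. Qed.
Lemma Bdt_cst u : Bdt (cst u) = 0. Proof. by rewrite /cst BdtC pdt_cst polyC0. Qed.
Lemma br_cstl u a b : br (cst u * a) b = cst u * br a b.
Proof. rewrite brMl /br Bdz_cst Bdt_cst; ring. Qed.
Lemma br_cstr u a b : br a (cst u * b) = cst u * br a b.
Proof. rewrite brMr /br Bdz_cst Bdt_cst; ring. Qed.
Lemma br_coef0 a b : (br a b)`_0 = pdz a`_0 * pdt b`_0 - pdt a`_0 * pdz b`_0.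
Proof. by rewrite coefB !coef0M !Bdz_coef !Bdt_coef. Qed.

Section Exponential.
Variables (n k : nat) (H : B).
Hypothesis k0 : (0 < k)%N.
(** The Hamiltonian field of x^k H. Each application raises the order in x by at
   least k > 0, so that its exponential is a finite sum modulo x^n. *)
Definition fl a := 'X^k * br H a.

Lemma flD a b : fl (a + b) = fl a + fl b. Proof. by rewrite /fl brDr mulrDr. Qed.
Lemma fl0 : fl 0 = 0. Proof. by rewrite /fl br0r mulr0. Qed.
Lemma flXn m a : fl ('X^m * a) = 'X^m * fl a. Proof. by rewrite /fl brXnr mulrCA. Qed.
Lemma flM a b : fl (a * b) = fl a * b + a * fl b. Proof. rewrite /fl brMr; ring. Qed.
Lemma fl_br a b : fl (br a b) = br (fl a) b + br a (fl b).
Proof. by rewrite /fl br_jacobi brXnl brXnr mulrDr. Qed.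
Lemma fl_iter_Xn j m a : iter j fl ('X^m * a) = 'X^m * iter j fl a.
Proof. by elim: j => //= j ->; rewrite flXn. Qed.
Lemma fl_iterD j a b : iter j fl (a + b) = iter j fl a + iter j fl b.
Proof. by elim: j => //= j ->; rewrite flD. Qed.
Lemma fl_iter_dvd j a : exists b, iter j fl a = 'X^(k * j) * b.
Proof.
elim: j => [|j [b IH]]; first by exists a; rewrite muln0 expr0 mul1r.
exists (br H b); rewrite iterS IH flXn /fl mulrA -exprD.
by congr ('X^_ * _); rewrite mulnS addnC.
Qed.
Lemma fl_cst u a : fl (cst u * a) = cst u * fl a.
Proof. by rewrite /fl br_cstr mulrCA. Qed.

(** Divided powers of the derivation. *)
Definition dp j a := cst (j`!%:R^-1) * iter j fl a.

Lemma dp0 a : dp 0 a = a. Proof. by rewrite /dp invr1 rmorph1 mul1r. Qed.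
Lemma fl_dp j a : fl (dp j a) = cst j.+1%:R * dp j.+1 a.
Proof.
rewrite /dp fl_cst /= mulrA -rmorphM; congr (cst _ * _).
by rewrite factS natrM invfM mulrA divff ?mul1r // pnatr_eq0.
Qed.
Lemma dp_dvd j a : exists b, dp j a = 'X^(k * j) * b.
Proof.
have [b e] := fl_iter_dvd j a; exists (cst (j`!%:R^-1) * b).
by rewrite /dp e mulrCA.
Qed.

(** An operation for which the derivation satisfies the Leibniz rule; the product
   and the bracket are both needed. *)
Section Bilinear.
Variable m : B -> B -> B.
Hypotheses (mDl : forall a a' b, m (a + a') b = m a b + m a' b)
  (mDr : forall a b b', m a (b + b') = m a b + m a b')
  (mXl : forall j a b, m ('X^j * a) b = 'X^j * m a b)
  (mXr : forall j a b, m a ('X^j * b) = 'X^j * m a b)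
  (mcl : forall u a b, m (cst u * a) b = cst u * m a b)
  (mcr : forall u a b, m a (cst u * b) = cst u * m a b)
  (mfl : forall a b, fl (m a b) = m (fl a) b + m a (fl b)).

Let m0l b : m 0 b = 0.
Proof. by apply: (@addrI _ (m 0 b)); rewrite -mDl !addr0. Qed.
Let m0r a : m a 0 = 0.
Proof. by apply: (@addrI _ (m a 0)); rewrite -mDr !addr0. Qed.

Lemma dp_leibniz N a b : dp N (m a b) = \sum_(0 <= i < N.+1) m (dp i a) (dp (N - i) b).
Proof.
elim: N => [|N IH]; first by rewrite big_nat1 !dp0.
have cN : cst (N.+1%:R : C) != 0 by rewrite polyC_eq0 fmorph_eq0 pnatr_eq0.
apply: (mulfI cN); rewrite -fl_dp IH (big_morph fl flD fl0).
have e i : fl (m (dp i a) (dp (N - i) b)) =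
    cst i.+1%:R * m (dp i.+1 a) (dp (N - i) b) + cst (N - i).+1%:R * m (dp i a) (dp (N - i).+1 b).
  by rewrite mfl !fl_dp mcl mcr.
under eq_bigr => i _ do rewrite e.
rewrite big_split /= mulr_sumr.
pose F i := m (dp i a) (dp (N.+1 - i) b).
rewrite [RHS](eq_big_nat _ _ (F2 := fun i => cst i%:R * F i + cst (N.+1 - i)%:R * F i)); last first.
  move=> i /andP[_ lt]; rewrite -mulrDl -rmorphD -natrD subnKC // -ltnS //.
rewrite big_split /=; congr (_ + _).
  rewrite [RHS]big_nat_recl // rmorph0 mul0r add0r.
  by apply: eq_bigr => i _; rewrite /F subSS.
rewrite [RHS]big_nat_recr //= subnn rmorph0 mul0r addr0.
by apply: eq_big_nat => i /andP[_ lt]; rewrite /F subSn // -ltnS.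
Qed.

Definition flexp a := \sum_(0 <= j < n) dp j a.

(** The Leibniz rule for divided powers, up to products of divided powers of total
   order at least n; these are divisible by x^n. *)
Lemma flexp_morph a b : cong n (flexp (m a b)) (m (flexp a) (flexp b)).
Proof.
pose F i l := m (dp i a) (dp l b).
have -> : flexp (m a b) = \sum_(0 <= i < n) \sum_(0 <= l < n - i) F i l.
  by rewrite -triangular_sum; apply: eq_bigr => N _; rewrite dp_leibniz.
have -> : m (flexp a) (flexp b) = \sum_(0 <= i < n) \sum_(0 <= l < n) F i l.
  rewrite /flexp (big_morph (fun a => m a _) (fun x y => mDl x y _) (m0l _)).
  by apply: eq_bigr => i _; rewrite (big_morph (m _) (mDr _) (m0r _)).
have -> : \sum_(0 <= i < n) \sum_(0 <= l < n) F i l = \sum_(0 <= i < n) \sum_(0 <= l < n - i) F i l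
   + \sum_(0 <= i < n) \sum_(n - i <= l < n) F i l.
  by rewrite -big_split /=; apply: eq_bigr => i _; rewrite -big_cat_nat ?leq_subr.
rewrite -[X in cong _ X _]addr0; apply: congD; first exact: cong_refl.
apply: cong_sym; apply: cong_sum0 => i _ _; apply: cong_sum0 => l; rewrite mem_index_iota => /andP[le _] _.
rewrite /F; have [a' ->] := dp_dvd i a; have [b' ->] := dp_dvd l b.
rewrite mXl mXr mulrA -exprD; apply: (@cong_le n (k * i + k * l)); first by nia.
by exists (m a' b'); rewrite add0r.
Qed.
End Bilinear.

Lemma flexpM a b : cong n (flexp (a * b)) (flexp a * flexp b).
Proof. apply: flexp_morph => *; rewrite ?flM; ring. Qed.
Lemma flexp_br a b : cong n (flexp (br a b)) (br (flexp a) (flexp b)).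
Proof.
apply: (@flexp_morph br); [exact: brDl|exact: brDr|move=> *; exact: brXnl|move=> *; exact: brXnr|exact: br_cstl|exact: br_cstr|exact: fl_br].
Qed.
Lemma dpD j a b : dp j (a + b) = dp j a + dp j b.
Proof. by rewrite /dp fl_iterD mulrDr. Qed.
Lemma flexpD a b : flexp (a + b) = flexp a + flexp b.
Proof. by rewrite /flexp -big_split; apply: eq_bigr => j _; rewrite dpD. Qed.
Lemma flexp_Xn m a : flexp ('X^m * a) = 'X^m * flexp a.
Proof.
by rewrite /flexp mulr_sumr; apply: eq_bigr => j _; rewrite /dp fl_iter_Xn mulrCA.
Qed.
Lemma cong_flexp a b : cong n a b -> cong n (flexp a) (flexp b).
Proof. by move=> [q ->]; exists (flexp q); rewrite flexpD flexp_Xn. Qed.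
Lemma flexp_inv a : (0 < n)%N -> fl a = 0 -> flexp a = a.
Proof.
move=> n0 h; rewrite /flexp -(prednK n0) big_nat_recl // dp0 big1 ?addr0 // => j _.
rewrite /dp (_ : iter j.+1 fl a = 0) ?mulr0 //.
by elim: j => //= j ->; exact: fl0.
Qed.
End Exponential.
End Flow.

(** * Normal forms modulo x^n *)

Section NormalForm.
Variables (C : numClosedFieldType) (S : plane C).
Local Notation B := {poly S}.
Local Notation bz := (bz S).
Local Notation bt := (bt S).
Local Notation cst := (cst S).
Local Notation P := (pcusp_poly S).

Definition in_x (q : {poly C}) : B := map_poly (pcst S) q.
HB.instance Definition _ := GRing.RMorphism.copy in_x (map_poly (pcst S)).

Lemma in_x_coef q i : (in_x q)`_i = pcst S q`_i. Proof. exact: coef_map. Qed.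
Lemma in_x_Xn k : in_x 'X^k = 'X^k. Proof. exact: map_polyXn. Qed.
Lemma Bdz_in_x q : Bdz (in_x q) = 0.
Proof. by apply/polyP=> i; rewrite Bdz_coef in_x_coef pdz_cst coef0. Qed.
Lemma Bdt_in_x q : Bdt (in_x q) = 0.
Proof. by apply/polyP=> i; rewrite Bdt_coef in_x_coef pdt_cst coef0. Qed.
Lemma br_in_x a q : br a (in_x q) = 0.
Proof. by rewrite /br Bdz_in_x Bdt_in_x !mulr0 subrr. Qed.

Variables (n : nat) (q1 q2 : {poly C}).
Hypotheses (q10 : q1`_0 = 0) (q20 : q2`_0 = 0).
Let G : B := P%:P + in_x q1.
Let G0 : G`_0 = P. Proof. by rewrite coefD coefC in_x_coef q10 rmorph0 addr0. Qed.

(** An approximation of order k: the map (z, t) |-> (Z, T) is the identity modulo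
   x^k, has Jacobian 1 modulo x^n, and carries the equation with q2 into the
   ideal (x^n, G) of the equation with q1. *)
Definition nform k := exists Z T u : B, [/\ cong k Z bz, cong k T bt, cong n (br Z T) 1,
  cong n (Z ^+ 2 + T ^+ 3 + in_x q2) (u * G) & forall j, (j < k)%N -> q1`_j = q2`_j].

Lemma bPE : P%:P = bz ^+ 2 + bt ^+ 3.
Proof. by rewrite polyCD !polyC_exp. Qed.

Lemma br_bz b : br bz b = Bdt b.
Proof. rewrite /br (BdzC (pz S)) (BdtC (pz S)) pdzz pdtz polyC0 polyC1; ring. Qed.
Lemma br_bt b : br b bt = Bdz b.
Proof. rewrite /br (BdzC (pt S)) (BdtC (pt S)) pdzt pdtt polyC0 polyC1; ring. Qed.
Lemma br_bzt : br bz bt = 1. Proof. by rewrite br_bz BdtC pdtt polyC1. Qed.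

(** Let (f, g) be the term of degree k of (Z, T). The Jacobian condition makes it
   Hamiltonian, with Hamiltonian h. The equation in degree k says that the
   derivative of the cusp along (f, g) plus the difference of the coefficients
   of q1 and q2 is a multiple of the cusp. Both the cusp and its
   derivatives vanish at the origin, so the coefficients agree; and then
   h = c + w (z^2 + t^3) by [pcusp]. The flow of the Hamiltonian x^k w G removes
   (f, g), and preserves the ideal of G because it is a multiple of G. *)
Lemma nform_step k : (0 < k)%N -> (k < n)%N -> nform k -> nform k.+1.
Proof.
move=> k0 kn [Z [T [u [[f' eZ] [g' eT] [qj ej] [qe ee] eq]]]].
set f := f'`_0; set g := g'`_0.
have k1 : 'X^k = 'X * 'X^(k.-1) :> B by rewrite -exprS prednK.
have kn1 : 'X^n = 'X^k * 'X * 'X^(n - k.+1) :> B.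
  by rewrite -exprSr -exprD subnKC.
have jac : pdz f + pdt g = 0.
  have : 'X^k * (Bdz f' + Bdt g' + 'X * ('X^(k.-1) * br f' g' - 'X^(n - k.+1) * qj)) = 0.
    move: ej; rewrite eZ eT brDl !brDr !brXnl !brXnr br_bzt br_bz br_bt => ej.
    apply: (@addrI _ 1); rewrite addr0 -[RHS](addrK ('X^n * qj)) -ej kn1 k1; ring.
  move/eqP; rewrite mulf_eq0 expf_eq0 polyX_eq0 andbF /= => /eqP /(congr1 (fun p : B => p`_0)).
  by rewrite !coefD coefXM Bdz_coef Bdt_coef coef0 addr0.
have [h [hf hg]] := ppoincare jac.
pose sg := \poly_(i < size (q2 - q1)) (q2 - q1)`_(i + k).
have esg : q2 = q1 + 'X^k * sg.
  apply/polyP=> i; rewrite coefD coefXnM; case: ltnP => [/eq ->|le]; first by rewrite addr0.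
  rewrite coef_poly subnK //; case: ltnP => [_|ge]; first by rewrite coefB addrC subrK.
  have : (q2 - q1)`_i = 0 by rewrite nth_default // (leq_trans ge) // leq_subr.
  by rewrite coefB addr0 => /eqP; rewrite subr_eq0 => /eqP.
have exs : in_x q2 = in_x q1 + 'X^k * in_x sg by rewrite esg rmorphD rmorphM /= in_x_Xn.
have main : 'X^k * (2%:R * bz * f' + 3%:R * bt ^+ 2 * g' + in_x sg + 'X * ('X^(k.-1) * (f' ^+ 2 + 3%:R * bt * g' ^+ 2 + 'X^k * g' ^+ 3) - 'X^(n - k.+1) * qe)) = (u - 1) * G.
  move: ee; rewrite eZ eT exs => ee.
  rewrite mulrBl mul1r -[u * G](addrK ('X^n * qe)) -ee /G bPE kn1 k1; ring.
have [v' ev] : exists v', u - 1 = 'X^k * v'.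
  by apply: (dvdXn_coprime main); rewrite G0 P_neq0.
have main0 : 2%:R * pz S * f + 3%:R * pt S ^+ 2 * g + pcst S sg`_0 = v'`_0 * P.
  rewrite ev in main; have := polyX_reg (etrans main (esym (mulrA _ _ _))) => /(congr1 (fun p : B => p`_0)).
  have cN m : (m%:R : B)`_0 = m%:R by rewrite -polyC_natr coefC.
  have cz : bz`_0 = pz S by rewrite coefC.
  have ct : bt`_0 = pt S by rewrite coefC.
  rewrite expr2 !coefD coefXM addr0 !coef0M G0 in_x_coef !cN cz ct /= => <-.
  by rewrite expr2.
have sg0 : sg`_0 = 0.
  have [o [oc oz ot]] := peval S idfun 0 0.
  have oP : o P = 0 by rewrite rmorphD !rmorphM oz ot; ring.
  by have := congr1 o main0; rewrite !rmorphD !rmorphM oP oz ot oc /= !(mulr0, mul0r, add0r, addr0).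
have [c [w ehw]] : exists c w, h = pcst S c + w * P.
  apply: (@pcusp _ _ h v'`_0); rewrite -main0 sg0 rmorph0 addr0 hf hg; ring.
(* G and z^2 + t^3 agree modulo x, so w G gives the same term of degree k as h;
   unlike w (z^2 + t^3), its flow keeps the ideal of G *)
pose H := w%:P * G.
have H0 : H`_0 = w * P by rewrite coef0M coefC G0.
have flG : exists R, flexp n k H G = R * G.
  have st a : exists a', fl k H (a * G) = a' * G.
    exists (fl k H a + a * 'X^k * br w%:P G); rewrite flM mulrDl; congr (_ + _).
    by rewrite /fl /H brMl braa mulr0 addr0; ring.
  have it j : exists a', iter j (fl k H) G = a' * G.
    by elim: j => [|j [a' ih]]; [exists 1; rewrite mul1r|rewrite iterS ih; exact: st].
  rewrite /flexp; apply: (big_ind (fun b : B => exists R, b = R * G)).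
  - by exists 0; rewrite mul0r.
  - by move=> a b [a' ->] [b' ->]; exists (a' + b'); rewrite mulrDl.
  - by move=> j _; have [a' e] := it j; exists (cst (j`!%:R^-1) * a'); rewrite /dp e mulrA.
have [R eR] := flG.
have ehz : pdz h = pdz (w * P) by rewrite ehw pdzD pdz_cst add0r.
have eht : pdt h = pdt (w * P) by rewrite ehw pdtD pdt_cst add0r.
have step (Y y' b0 : B) : Y = b0 + 'X^k * y' -> y'`_0 + (br H b0)`_0 = 0 -> cong k.+1 (flexp n k H Y) b0.
  move=> eY ey; rewrite /flexp; have -> : n = n.-2.+2 by lia.
  rewrite !big_nat_recl // dp0 addrA -[X in cong _ _ X]addr0; apply: congD; last first.
    apply: cong_sum0 => j _ _; have [b ->] := dp_dvd k H j.+2 Y.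
    by apply: (@cong_le _ _ k.+1 (k * j.+2)); [nia|exists b; rewrite add0r].
  have -> : dp k H 1 Y = 'X^k * br H b0 + 'X^k * ('X^k * br H y').
    by rewrite /dp invr1 rmorph1 mul1r /= /fl eY brDr brXnr mulrDr.
  have [y'' ey''] : exists y'', y' + br H b0 = 'X * y'' by apply: poly_dvdX; rewrite coefD.
  exists (y'' + 'X^(k.-1) * br H y'); rewrite eY exprS -[k in 'X^k * br H y']prednK //.
  transitivity (b0 + 'X^k * (y' + br H b0) + 'X^k * ('X^(k.-1.+1) * br H y')); first ring.
  by rewrite ey'' [in 'X^(k.-1.+1)]exprS; ring.
exists (flexp n k H Z), (flexp n k H T), (flexp n k H u * R); split.
- apply: (step Z f') => //; rewrite br_coef0 H0 coefC /= pdzz pdtz -/f hf eht; ring.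
- apply: (step T g') => //; rewrite br_coef0 H0 coefC /= pdzt pdtt -/g hg ehz; ring.
- apply: (cong_trans (cong_sym (flexp_br n H k0 Z T))).
  have := @cong_flexp _ _ n k H (br Z T) 1 (ex_intro _ qj ej).
  rewrite (flexp_inv (a := 1)) //; first lia.
  by rewrite /fl -(rmorph1 cst) /br Bdz_cst Bdt_cst; ring.
- have h1 := @cong_flexp _ _ n k H _ _ (ex_intro _ qe ee).
  rewrite !flexpD in h1.
  have h2 : flexp n k H (in_x q2) = in_x q2.
    by apply: flexp_inv; [lia|rewrite /fl br_in_x mulr0].
  rewrite h2 in h1.
  have hX (a : B) m : cong n (flexp n k H (a ^+ m.+1)) (flexp n k H a ^+ m.+1).
    elim: m => [|m IH]; first by rewrite !expr1; exact: cong_refl.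
    rewrite exprS [X in cong _ _ X]exprS; apply: cong_trans (flexpM n H k0 _ _) _.
    by apply: congM => //; exact: cong_refl.
  apply: cong_trans (_ : cong n _ (flexp n k H (Z ^+ 2) + flexp n k H (T ^+ 3) + in_x q2)) _.
    by apply: congD; [apply: congD; apply: cong_sym; exact: hX|exact: cong_refl].
  apply: cong_trans h1 _; apply: cong_trans (flexpM n H k0 _ _) _.
  by rewrite eR mulrA; exact: cong_refl.
move=> j; rewrite ltnS leq_eqVlt => /orP[/eqP ->|/eq //].
by rewrite esg coefD coefXnM ltnn subnn sg0 addr0.
Qed.

Lemma normal_form Z T u : cong 1 Z bz -> cong 1 T bt -> cong n (br Z T) 1 ->
  cong n (Z ^+ 2 + T ^+ 3 + in_x q2) (u * G) -> forall j, (j < n)%N -> q1`_j = q2`_j.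
Proof.
move=> hZ hT hj he j jn.
suff h k : (0 < k)%N -> (k <= n)%N -> nform k.
  by have [|Z' [T' [u' [_ _ _ _ eq]]]] := h n _ (leqnn n); [exact: leq_ltn_trans jn|exact: eq].
elim: k => // k IH _ kn; case: k kn IH => [|k] kn IH; last by apply: nform_step => //; apply: IH => //; exact: ltnW.
exists Z, T, u; split=> //; by case=> // _; rewrite q10 q20.
Qed.
End NormalForm.

(** * Shears of the threefold *)

Section Shear.
Variables (C : numClosedFieldType) (S : plane C).
Local Notation B := {poly S}.
Local Notation bx := (bx S).
Local Notation bz := (bz S).
Local Notation bt := (bt S).
Local Notation cst := (cst S).
Local Notation P := (pcusp_poly S).
Variables (Q : fieldType) (iota : {rmorphism B -> Q}).
Hypothesis iota_inj : injective iota.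
Hypothesis iota_frac : forall u, exists a b, b != 0 /\ u = iota a / iota b.
Local Notation X := (iota bx).
Local Notation Z := (iota bz).
Local Notation T := (iota bt).
Local Notation X0 := (X_neq0 iota_inj).

Let i0 : iota 0 = 0. Proof. exact: rmorph0. Qed.
Let iD a b : iota (a + b) = iota a + iota b. Proof. exact: rmorphD. Qed.
Let iN a : iota (- a) = - iota a. Proof. exact: rmorphN. Qed.
Let iM a b : iota (a * b) = iota a * iota b. Proof. exact: rmorphM. Qed.
Let iX a n : iota (a ^+ n) = iota a ^+ n. Proof. exact: rmorphXn. Qed.

Section Derivation.
Variables (n : nat) (r : B) (k1 k2 : C).
Hypothesis hn : (0 < n)%N.
(** The derivation x^n (k1 d/dz + k2 d/dt) of B. It maps y into B, hence it
   extends to A and is locally nilpotent there. *)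
Definition shear := mkder iota_frac 0 (X ^+ n * iota (cst k1)) (X ^+ n * iota (cst k2)).
Let DD : scalar_der iota shear. Proof. exact: mkderP. Qed.
Lemma shear_iota b : shear (iota b) = X ^+ n * iota (Bdz b * cst k1 + Bdt b * cst k2).
Proof. rewrite /shear mkder_iota // iD !iM; ring. Qed.
Lemma shearX : shear X = 0. Proof. exact: mkderX. Qed.
Lemma shearZ : shear Z = X ^+ n * iota (cst k1). Proof. exact: mkderZ. Qed.
Lemma shearT : shear T = X ^+ n * iota (cst k2). Proof. exact: mkderT. Qed.
Lemma shear_y : shear (cy iota n r) = - iota (Bdz (cG r) * cst k1 + Bdt (cG r) * cst k2).
Proof.
have Xn0 : X ^+ n != 0 by rewrite expf_neq0 // X0.
apply: (mulfI Xn0); have := congr1 shear (Xy_rel iota_inj n r).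
rewrite (derM DD.1) (derX DD.1) shearX mulr0 mul0r add0r => ->.
by rewrite (derN DD.1) shear_iota mulrN.
Qed.
Lemma shear_inA a : inA iota n r a -> inA iota n r (shear a).
Proof.
move=> [c ->]; elim/poly_ind: c => [|c b IH]; first by rewrite rmorph0 (der0 DD.1) -i0; apply: inA_iota.
rewrite rmorphD rmorphM /= evAC evAX (derD DD.1) (derM DD.1) shear_y.
apply: inAD; first apply: inAD.
- by apply: inAM => //; apply: inA_y.
- by apply: inAM; [exists c|rewrite -iN; apply: inA_iota].
- by rewrite shear_iota -iX -iM; apply: inA_iota.
Qed.
Let nilp0 a : shear a = 0 -> nilp shear a. Proof. by exists 1%N. Qed.
Let nilp_shear_x : nilp shear X. Proof. by apply: nilp0; exact: shearX. Qed.
Let nilpXn k : nilp shear (X ^+ n * iota (cst k)).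
Proof.
by apply: (nilpM DD.1); [apply: (nilpX DD.1); exact: nilp_shear_x|apply: nilp0; exact: DD.2].
Qed.
Let nilpS u : nilp shear (iota u%:P).
Proof.
have der_nil a : nilp shear (shear a) -> nilp shear a by move=> [k hk]; exists k.+1; rewrite iterSr.
elim/pind: u => [c|||a b ha hb|a b ha hb].
- by apply: nilp0; exact: DD.2.
- by apply: der_nil; rewrite -/bz shearZ.
- by apply: der_nil; rewrite -/bt shearT.
- by rewrite polyCD iD; apply: (nilpD DD.1).
- by rewrite polyCM iM; apply: (nilpM DD.1).
Qed.
Lemma nilp_shear_iota b : nilp shear (iota b).
Proof.
elim/poly_ind: b => [|b u IH]; first by apply: nilp0; rewrite i0 (der0 DD.1).
by rewrite iD iM; apply: (nilpD DD.1) => //; apply: (nilpM DD.1).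
Qed.
Lemma nilp_shear a : inA iota n r a -> nilp shear a.
Proof.
have ny : nilp shear (cy iota n r).
  have [k hk] := nilp_shear_iota (- (Bdz (cG r) * cst k1 + Bdt (cG r) * cst k2)).
  by exists k.+1; rewrite iterSr shear_y -iN.
move=> [c ->]; elim/poly_ind: c => [|c b IH]; first by apply: nilp0; rewrite rmorph0 (der0 DD.1).
rewrite rmorphD rmorphM /= evAC evAX; apply: (nilpD DD.1); last exact: nilp_shear_iota.
exact: (nilpM DD.1).
Qed.
End Derivation.

Lemma inA_pole n r a : (0 < n)%N -> inA iota n r a -> (forall b, a <> iota b) ->
  exists (k : nat) b, iota b = X ^+ k.+1 * a /\ b`_0 != 0.
Proof.
move=> hn Aa na.
have [m [c ec]] : exists (m : nat) (c : B), iota c = X ^+ m * a.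
  have [c ->] := Aa; have [b' e'] := evA_clear iota_inj r hn (leqnSn (size c)).
  by exists (n * size c)%N; eexists; rewrite e'.
have c0 : c != 0.
  apply/eqP => c0; apply: (na 0); apply: (mulfI (expf_neq0 m X0)).
  by rewrite -ec c0 i0 mulr0.
have [k [c' [ec' c'0]]] := poly_valuation c0.
have eX : iota c = X ^+ k * iota c' by rewrite ec' iM iX.
have [le|lt] := leqP m k; last first.
  exists (m - k).-1, c'; split=> //; apply: (mulfI (expf_neq0 k X0)).
  by rewrite -eX ec mulrA -exprD prednK ?subn_gt0 // subnKC // ltnW.
case: (na ('X^(k - m) * c')); apply: (mulfI (expf_neq0 m X0)).
by rewrite -ec eX iM iX mulrA -exprD subnKC.
Qed.

(** Each of x, z, t is killed by a nonzero shear, so its image is killed by the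
   conjugate derivation, and [lnd_kernel] locates the image in C[x, z, t]. *)
Lemma iso_preserves n r1 r2 (th th' : {rmorphism Q -> Q}) : (1 < n)%N ->
  (forall c, th (iota (cst c)) = iota (cst c)) -> (forall c, th' (iota (cst c)) = iota (cst c)) ->
  cancel th th' -> cancel th' th ->
  (forall a, inA iota n r2 a -> inA iota n r1 (th a)) ->
  (forall a, inA iota n r1 a -> inA iota n r2 (th' a)) ->
  exists s : {rmorphism B -> B}, forall b, th (iota b) = iota (s b).
Proof.
move=> hn thc th'c thK th'K hA hA'.
have key k1 k2 b : (k1 != 0) || (k2 != 0) -> shear n k1 k2 (iota b) = 0 -> exists b', th (iota b) = iota b'.
  move=> nz db; pose D a := th (shear n k1 k2 (th' a)).
  have sD : scalar_der iota (shear n k1 k2) := mkderP iota_inj iota_frac 0 (X ^+ n * iota (cst k1)) (X ^+ n * iota (cst k2)).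
  have DD : scalar_der iota D.
    split; [split=> u v|move=> c]; rewrite /D.
    - by rewrite rmorphD (derD sD.1) rmorphD.
    - by rewrite rmorphM (derM sD.1) rmorphD !rmorphM /= !th'K.
    - by rewrite th'c sD.2 rmorph0.
  have Dit k a : iter k D a = th (iter k (shear n k1 k2) (th' a)).
    by elim: k => [|k IH]; rewrite ?th'K //= IH /D thK.
  apply: (lnd_kernel iota_inj iota_frac hn DD).
  - by move=> a Aa; apply: hA; apply: shear_inA => //; apply: hA'.
  - move=> a Aa; have [k hk] := nilp_shear k1 k2 (hA' _ Aa).
    by exists k; rewrite Dit hk rmorph0.
  - have h c : c != 0 -> X ^+ n * iota (cst c) != 0.
      by move=> c0; rewrite mulf_neq0 ?expf_neq0 ?X0 // cst_neq0.
    have [h1|h1] := boolP (k1 != 0).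
      exists (th Z); first by apply: hA; apply: inA_iota.
      by apply/eqP; rewrite /D thK shearZ // fmorph_eq0 h.
    move: nz; rewrite (negPf h1) /= => h2; exists (th T); first by apply: hA; apply: inA_iota.
    by apply/eqP; rewrite /D thK shearT // fmorph_eq0 h.
  - by apply: hA; apply: inA_iota.
  by rewrite /D thK db rmorph0.
have [X1 eX] : exists b, th X = iota b.
  by apply: (key 1 0); rewrite ?oner_neq0 // shearX.
have [Z1 eZ] : exists b, th Z = iota b.
  by apply: (key 0 1); rewrite ?oner_neq0 ?orbT // shearZ // rmorph0 i0 mulr0.
have [T1 eT] : exists b, th T = iota b.
  by apply: (key 1 0); rewrite ?oner_neq0 // shearT // rmorph0 i0 mulr0.
have [s [sc sx sz st]] := B_eval S cst X1 Z1 T1.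
exists s; apply: (@B_rmorph_ext _ _ _ (th \o iota) (iota \o s)) => [c|||] /=.
- by rewrite thc sc.
- by rewrite sx.
- by rewrite sz.
- by rewrite st.
Qed.
End Shear.

(** * Isomorphisms of coordinate rings *)

Lemma coef_comp_scale (K : comNzRingType) (p : {poly K}) k i : (p \Po (k *: 'X))`_i = k ^+ i * p`_i.
Proof.
elim/poly_ind: p i => [|p c IH] i; first by rewrite comp_poly0 !coef0 mulr0.
rewrite comp_polyD comp_polyM comp_polyX comp_polyC -scalerAr !coefD coefZ !coefMX !coefC.
case: i => [|i] /=; first by rewrite expr0 !mul1r mulr0.
by rewrite IH !addr0 exprS mulrA.
Qed.

Section Halves.
Variables (C : numClosedFieldType) (S : plane C).
Local Notation B := {poly S}.
Local Notation bx := (bx S).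
Local Notation cst := (cst S).
Variables (Q : fieldType) (iota : {rmorphism B -> Q}).
Hypothesis iota_inj : injective iota.
Local Notation X := (iota bx).
Local Notation X0 := (X_neq0 iota_inj).

Let iN a : iota (- a) = - iota a. Proof. exact: rmorphN. Qed.
Let iM a b : iota (a * b) = iota a * iota b. Proof. exact: rmorphM. Qed.
Let iX a n : iota (a ^+ n) = iota a ^+ n. Proof. exact: rmorphXn. Qed.

Variables (n : nat) (r1 r2 : B) (th th' : {rmorphism Q -> Q}) (s s' : {rmorphism B -> B}).
Hypotheses (hn : (0 < n)%N) (thK : cancel th th').
Hypothesis hA : forall a, inA iota n r2 a -> inA iota n r1 (th a).
Hypotheses (ths : forall b, th (iota b) = iota (s b)) (ths' : forall b, th' (iota b) = iota (s' b)).

(** The element w, image of x^(n-1) y, has a pole because x^(n-1) y is not in B.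
   The product of w and the image of x has none, so the image of x vanishes
   where x does. *)
Lemma iso_x_root : (s bx)`_0 = 0.
Proof.
pose w := th (X ^+ n.-1 * cy iota n r2).
have ew : X ^+ n.-1 * cy iota n r2 * X = - iota (cG r2).
  by rewrite mulrAC -exprSr prednK // Xy_rel.
have Aw : inA iota n r1 w.
  by apply/hA/inAM; [rewrite -iX; apply: inA_iota|exact: inA_y].
have [k [b [eb b0]]] : exists (k : nat) b, iota b = X ^+ k.+1 * w /\ b`_0 != 0.
  apply: (inA_pole iota_inj hn Aw) => b /(congr1 th'); rewrite thK ths' => e.
  have := ew; rewrite e -iM -iN => /iota_inj /(congr1 (fun p : B => p`_0)).
  rewrite coefN G_coef0 coefMX /= => /esym/eqP; rewrite oppr_eq0.
  by rewrite (negPf (P_neq0 S)).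
have : s bx * b = 'X^(k.+1) * - s (cG r2).
  apply: iota_inj; rewrite !iM iN iX -!ths -(rmorphN th) -ew rmorphM /= eb -/w; ring.
move/(congr1 (fun p : B => p`_0)); rewrite coef0M coefXnM /= => /eqP.
by rewrite mulf_eq0 (negPf b0) orbF => /eqP.
Qed.

(** The ideal (x^n, G) is determined by the inclusion of B in A, by
   [inA_pole_n]. *)
Lemma iso_G lam : s bx = cst lam * bx -> exists u v, s (cG r2) = u * cG r1 + 'X^n * v.
Proof.
move=> sx; have Ay : inA iota n r1 (iota (cst (lam ^+ n)) * th (cy iota n r2)).
  by apply: inAM; [exact: inA_iota|apply: hA; exact: inA_y].
have [u [v e]] : exists u v, - s (cG r2) = u * cG r1 + 'X^n * v.
  have e1 : th X ^+ n = iota (cst (lam ^+ n)) * X ^+ n.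
    by rewrite ths sx iM (exprMn n (iota _)) (rmorphXn cst) iX.
  apply: (inA_pole_n iota_inj hn Ay); rewrite -exprnN iN -ths -(rmorphN th) -(Xy_rel iota_inj n).
  rewrite (rmorphM th (X ^+ n)) (rmorphXn th) e1 -mulrA mulrCA mulKf //.
  by rewrite expf_neq0 // X0.
by exists (- u), (- v); rewrite mulNr mulrN -opprD -e opprK.
Qed.
End Halves.

Section Forward.
Variables (C : numClosedFieldType) (S : plane C).
Local Notation B := {poly S}.
Local Notation bx := (bx S).
Local Notation bz := (bz S).
Local Notation bt := (bt S).
Local Notation cst := (cst S).
Local Notation P := (pcusp_poly S).
Variables (Q : fieldType) (iota : {rmorphism B -> Q}).
Hypothesis iota_inj : injective iota.
Hypothesis iota_frac : forall u, exists a b, b != 0 /\ u = iota a / iota b.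

Lemma B_unit (b b' : B) : b * b' = 1 -> exists2 c, c != 0 & b = cst c.
Proof.
move=> e; have : b \is a GRing.unit by apply/unitrPr; exists b'.
rewrite poly_unitE => /andP[/eqP sb /punit[c ec]].
have eb : b = cst c by rewrite [LHS]size1_polyC ?sb // ec.
exists c => //; apply/eqP => c0; move: e; rewrite eb c0 rmorph0 mul0r => /esym/eqP.
by rewrite oner_eq0.
Qed.

(** The chain rule; as s only scales x, the derivative with respect to x does not
   contribute. *)
Lemma br_comp (s : {rmorphism B -> B}) lam a b : (forall c, s (cst c) = cst c) -> s bx = cst lam * bx ->
  br (s a) (s b) = s (br a b) * br (s bz) (s bt).
Proof.
move=> sc sx.
have hz c : Bdz (s c) = s (Bdz c) * Bdz (s bz) + s (Bdt c) * Bdz (s bt).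
  rewrite (@Bder_formula _ _ _ s (fun c => Bdz (s c))).
  - by rewrite sx BdzM Bdz_cst BdzX; ring.
  - by move=> u v; rewrite rmorphD BdzD.
  - by move=> u v; rewrite rmorphM BdzM.
  - by move=> k; rewrite sc Bdz_cst.
have ht c : Bdt (s c) = s (Bdz c) * Bdt (s bz) + s (Bdt c) * Bdt (s bt).
  rewrite (@Bder_formula _ _ _ s (fun c => Bdt (s c))).
  - by rewrite sx BdtM Bdt_cst BdtX; ring.
  - by move=> u v; rewrite rmorphD BdtD.
  - by move=> u v; rewrite rmorphM BdtM.
  - by move=> k; rewrite sc Bdt_cst.
rewrite /br (hz a) (hz b) (ht a) (ht b) rmorphB !(rmorphM s); ring.
Qed.

(** The restriction s of the isomorphism to C[x, z, t] scales x and has a constant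
   Jacobian. Compose it with the automorphism tau of C[z, t] that inverts it
   modulo x: the result is the identity modulo x, and its Jacobian, which is a
   constant, is 1. Then [normal_form] compares the coefficients. *)
Theorem coordinate_iso n (p1 p2 : {poly C}) (th th' : {rmorphism Q -> Q}) : (1 < n)%N ->
  (forall c, th (iota (cst c)) = iota (cst c)) -> (forall c, th' (iota (cst c)) = iota (cst c)) ->
  cancel th th' -> cancel th' th ->
  (forall a, inA iota n (in_x S p2) a -> inA iota n (in_x S p1) (th a)) ->
  (forall a, inA iota n (in_x S p1) a -> inA iota n (in_x S p2) (th' a)) ->
  exists lam eps : C, [/\ lam != 0, eps != 0 &
    forall i, (i < n.-1)%N -> p2`_i = eps * lam ^+ i * p1`_i].
Proof.
move=> hn thc th'c thK th'K hA hA'; have hn0 := ltnW hn.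
have [s ths] := iso_preserves iota_inj iota_frac hn thc th'c thK th'K hA hA'.
have [s' ths'] := iso_preserves iota_inj iota_frac hn th'c thc th'K thK hA' hA.
have sK b : s' (s b) = b by apply: iota_inj; rewrite -ths' -ths thK.
have s'K b : s (s' b) = b by apply: iota_inj; rewrite -ths -ths' th'K.
have sc c : s (cst c) = cst c by apply: iota_inj; rewrite -ths thc.
have s'c c : s' (cst c) = cst c by apply: iota_inj; rewrite -ths' th'c.
have [e ee] := poly_dvdX (iso_x_root iota_inj hn0 thK hA ths ths').
have [e' ee'] := poly_dvdX (iso_x_root iota_inj hn0 th'K hA' ths' ths).
have [lam lam0 sx] : exists2 lam, lam != 0 & s bx = cst lam * bx.
  have [|lam l0 el] := @B_unit e (s e'); last by exists lam; rewrite // ee el mulrC.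
  have X0 : bx != 0 by rewrite polyX_eq0.
  apply: (mulfI X0); rewrite mulr1 mulrA -[in RHS](s'K bx) ee' rmorphM /=; congr (_ * _).
  by rewrite -ee.
have s'x : s' bx = cst lam^-1 * bx.
  have : s' (s bx) = cst lam * s' bx by rewrite sx rmorphM /= s'c.
  by rewrite sK => {2}->; rewrite mulrA -rmorphM mulVf // rmorph1 mul1r.
have [u1 [v1 eG]] := iso_G iota_inj hn0 hA ths sx.
have [u2 [v2 eG']] := iso_G iota_inj hn0 hA' ths' s'x.
set G1 := cG (in_x S p1) in eG eG'; set G2 := cG (in_x S p2) in eG eG'.
have cG10 : G1`_0 = P := G_coef0 _.
have cG20 : G2`_0 = P := G_coef0 _.
have s0 b : (s b)`_0 = (s (b`_0)%:P)`_0.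
  have [b' e0] := poly_split b; rewrite {1}e0 rmorphD rmorphM /= -/bx sx coefD.
  by rewrite !coef0M coefX mulr0 mul0r addr0.
have s'0 b : (s' b)`_0 = (s' (b`_0)%:P)`_0.
  have [b' e0] := poly_split b; rewrite {1}e0 rmorphD rmorphM /= -/bx s'x coefD.
  by rewrite !coef0M coefX mulr0 mul0r addr0.
have [kap kap0 eu2] : exists2 k, k != 0 & u2`_0 = pcst S k.
  have h : (s' u1 * u2)`_0 = 1.
    have := sK G2; rewrite eG rmorphD !rmorphM eG' rmorphXn /= -/bx s'x.
    move/(congr1 (fun p : B => p`_0)); rewrite exprMn coefD !coef0M coefD coef0M cG20 !coefXnM hn0.
    have -> : (bx ^+ n)`_0 = 0 by rewrite coefXn; case: (n) hn0.
    rewrite !(mulr0, mul0r, addr0) mulrA => /eqP; rewrite -subr_eq0 -{2}[P]mul1r -mulrBl.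
    by rewrite mulf_eq0 (negPf (P_neq0 S)) orbF subr_eq0 => /eqP.
  have : u2`_0 \is a GRing.unit by apply/unitrPr; exists (s' u1)`_0; rewrite mulrC -coef0M.
  move=> /punit[k ek]; exists k => //; apply/eqP => k0; move/eqP: h.
  by rewrite coef0M ek k0 rmorph0 mulr0 eq_sym oner_eq0.
have [c1 c10 ej] : exists2 c, c != 0 & br (s bz) (s bt) = cst c.
  apply: (@B_unit _ (s (br (s' bz) (s' bt)))).
  by rewrite mulrC -(br_comp _ _ sc sx) !s'K br_bzt.
(* tau is the reduction of the inverse s' modulo x, extended by the identity on x *)
pose t0 (u : S) := (s' u%:P)`_0.
have [tau [tauc taux tauz taut]] : exists tau : {rmorphism B -> B}, [/\ forall c, tau (cst c) = cst c,
    tau bx = bx, tau bz = (t0 (pz S))%:P & tau bt = (t0 (pt S))%:P].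
  exact: (B_eval S cst).
have tauC u : tau u%:P = (t0 u)%:P.
  have [g [gc gz gt]] := peval S (pcst S) (t0 (pz S)) (t0 (pt S)).
  have t0g : t0 =1 g.
    pose f := horner_eval (0 : S) \o (s' \o polyC).
    have ft u' : t0 u' = f u' by rewrite /f /= /horner_eval horner_coef0.
    move=> u'; rewrite ft; apply: (@prmorph_ext C S S f g) => [c||].
    - by apply: (etrans (esym (ft _))); rewrite gc /t0 -/(cst c) s'c coefC.
    - by apply: (etrans (esym (ft _))); rewrite gz.
    - by apply: (etrans (esym (ft _))); rewrite gt.
  rewrite t0g; apply: (@prmorph_ext C S B (tau \o polyC) (polyC \o g)) => [c||] /=.
  - by rewrite -/(cst c) tauc gc.
  - by rewrite tauz t0g.
  - by rewrite taut t0g.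
have tau0 b : (tau b)`_0 = t0 b`_0.
  have [b' e0] := poly_split b; rewrite {1}e0 rmorphD rmorphM /= tauC -/bx taux.
  by rewrite coefD coefC coefXM addr0.
have t0s u : t0 (s u%:P)`_0 = u.
  by rewrite /t0 -s'0 sK coefC.
have taubx : tau bx = cst 1 * bx by rewrite taux rmorph1 mul1r.
have tx : tau (s bx) = cst lam * bx by rewrite sx rmorphM /= tauc taux.
have txs p : tau (s (in_x S p)) = in_x S (p \Po (lam *: 'X)).
  apply: (@poly_rmorph_ext C B (tau \o (s \o in_x S)) (in_x S \o comp_poly (lam *: 'X))) => [c|] /=.
    by rewrite comp_polyC /in_x !map_polyC /= -/(cst c) sc tauc.
  by rewrite comp_polyX /in_x map_polyZ !map_polyX /= -/bx tx -mul_polyC.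
have Z1 : (tau (s bz))`_0 = pz S by rewrite tau0 t0s.
have T1 : (tau (s bt))`_0 = pt S by rewrite tau0 t0s.
have jac : br (tau (s bz)) (tau (s bt)) = 1.
  rewrite (br_comp _ _ tauc taubx) ej tauc.
  have e1 : br (tau bz) (tau bt) = ((br (tau bz) (tau bt))`_0)%:P.
    by rewrite tauz taut /br !BdzC !BdtC -!polyCM -polyCB coefC.
  have := congr1 (fun p : B => p`_0) (br_comp bz bt tauc taubx).
  have := br_coef0 (tau (s bz)) (tau (s bt)).
  rewrite Z1 T1 pdzz pdtt pdzt pdtz mulr0 subr0 mulr1.
  rewrite (br_comp _ _ tauc taubx) ej tauc => e2 _.
  by rewrite e1 -[cst c1]/((pcst S c1)%:P) -polyCM; move: e2; rewrite coefCM => ->.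
have etG1 : tau G1 = cst kap * (P%:P + in_x S (kap^-1 *: ('X * p1))).
  have e1 : t0 P = pcst S kap * P.
    have := congr1 (fun p : B => p`_0) eG'; rewrite s'0 cG10 -/(t0 P) => ->.
    by rewrite coefD coef0M eu2 cG20 coefXnM hn0 addr0.
  have e2 : tau (in_x S p1) = in_x S p1.
    apply: (@poly_rmorph_ext C B (tau \o in_x S) (in_x S)) => [c|] /=.
      by rewrite /in_x !map_polyC /= -/(cst c) tauc.
    by rewrite /in_x !map_polyX /= -/bx taux.
  rewrite /G1 /cG rmorphD rmorphM /= tauC e1 -/bx taux e2 polyCM mulrDr; congr (_ + _).
  rewrite /in_x map_polyZ -mul_polyC mulrA -polyCM -rmorphM mulfV // rmorph1 mul1r.
  by rewrite rmorphM /= map_polyX.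
have main : cong n (tau (s bz) ^+ 2 + tau (s bt) ^+ 3 + in_x S (('X * p2) \Po (lam *: 'X)))
    ((tau u1 * cst kap) * (P%:P + in_x S (kap^-1 *: ('X * p1)))).
  exists (tau v1); rewrite -txs -mulrA -etG1.
  have e4 := congr1 tau eG.
  rewrite (rmorphD tau (u1 * G1)) (rmorphM tau u1) (rmorphM tau 'X^n) (rmorphXn tau) -/bx taux in e4.
  rewrite -e4.
  have e3 : G2 = bz ^+ 2 + bt ^+ 3 + in_x S ('X * p2) by rewrite /G2 /cG (bPE S) rmorphM /= /in_x map_polyX.
  by rewrite e3 !(rmorphD s) !(rmorphD tau) !(rmorphXn s) !(rmorphXn tau).
have q10 : (kap^-1 *: ('X * p1))`_0 = 0 by rewrite coefZ coefXM mulr0.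
have q20 : (('X * p2) \Po (lam *: 'X))`_0 = 0.
  by rewrite -horner_coef0 horner_comp !hornerE.
have cZ : cong 1 (tau (s bz)) bz.
  have [b' e0] := poly_split (tau (s bz)); exists b'; rewrite {1}e0 Z1 //.
have cT : cong 1 (tau (s bt)) bt.
  have [b' e0] := poly_split (tau (s bt)); exists b'; rewrite {1}e0 T1 //.
have cJ : cong n (br (tau (s bz)) (tau (s bt))) 1 by rewrite jac; apply: cong_refl.
have fin := normal_form q10 q20 cZ cT cJ main.
exists lam^-1, (kap * lam)^-1; split; rewrite ?invr_eq0 ?mulf_neq0 // => i hi.
have := fin i.+1; rewrite -ltn_predRL => /(_ hi).
rewrite coefZ coefXM /= => e1.
have e2 : (('X * p2) \Po (lam *: 'X))`_i.+1 = lam ^+ i.+1 * p2`_i.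
  by rewrite coef_comp_scale coefXM.
rewrite e2 in e1; apply: (mulfI (expf_neq0 i.+1 lam0)); rewrite -e1 exprS.
by rewrite exprVn; field; rewrite kap0 lam0 expf_neq0.
Qed.
End Forward.

(** * From polynomial maps to morphisms of coordinate rings *)

Section ConcreteEvaluation.
Variable C : numClosedFieldType.
Local Notation S := (affine_plane C).

Lemma poly_vanish (p : {poly C}) : (forall x, x != 0 -> p.[x] = 0) -> p = 0.
Proof.
move=> h; apply/eqP/negPn/negP => p0.
pose rs := [seq i.+1%:R : C | i <- iota 0 (size p)].
have := @max_poly_roots _ p rs p0; rewrite size_map size_iota ltnn => H.
have : false by apply: H; [apply/allP => _ /mapP[i _ ->]; rewrite /root h ?pnatr_eq0|
  rewrite map_inj_uniq ?iota_uniq // => i j /eqP; rewrite eqr_nat => /eqP[]].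
by [].
Qed.

Definition evS (z t : C) : {poly {poly C}} -> C := pev (pev (idfun : {rmorphism C -> C}) t) z.
HB.instance Definition _ z t := GRing.RMorphism.on (evS z t).
Lemma evS_cst z t c : evS z t (pcst S c) = c.
Proof. exact: (etrans (pevC _ _ _) (pevC _ _ _)). Qed.
Lemma evS_z z t : evS z t (pz S) = z. Proof. exact: pevX. Qed.
Lemma evS_t z t : evS z t (pt S) = t.
Proof. exact: (etrans (pevC _ _ _) (pevX _ _)). Qed.
Lemma evS_vanish (s : {poly {poly C}}) : (forall z t, evS z t s = 0) -> s = 0.
Proof.
move=> h; apply/polyP=> k; rewrite coef0; apply: poly_vanish => t _.
have : map_poly (pev (idfun : {rmorphism C -> C}) t) s = 0.
  by apply: poly_vanish => z _; exact: h.
move/(congr1 (fun p : {poly C} => p`_k)); rewrite coef_map coef0 /= => <-.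
by rewrite pevE map_poly_id.
Qed.

(** The evaluation at a point, with its morphism structure in the type. *)
Definition eval_plane (z t : C) : {rmorphism S -> C} := evS z t.
End ConcreteEvaluation.

Section Points.
Variables (C : numClosedFieldType) (S : plane C).
Local Notation B := {poly S}.
Variable evS : C -> C -> {rmorphism S -> C}.
Hypothesis evS_cst : forall z t c, evS z t (pcst S c) = c.
Hypothesis evS_z : forall z t, evS z t (pz S) = z.
Hypothesis evS_t : forall z t, evS z t (pt S) = t.
Hypothesis evS_vanish : forall s, (forall z t, evS z t s = 0) -> s = 0.

Definition evB (x z t : C) : B -> C := pev (evS z t) x.
HB.instance Definition _ x z t := GRing.RMorphism.on (evB x z t).
Definition evP (x y z t : C) : {poly B} -> C := pev (evB x z t) y.
HB.instance Definition _ x y z t := GRing.RMorphism.on (evP x y z t).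

Lemma evB_cst x z t c : evB x z t (cst S c) = c. Proof. exact: (etrans (pevC _ _ _) (evS_cst _ _ _)). Qed.
Lemma evB_x x z t : evB x z t (bx S) = x. Proof. exact: pevX. Qed.
Lemma evB_z x z t : evB x z t (bz S) = z. Proof. exact: (etrans (pevC _ _ _) (evS_z _ _)). Qed.
Lemma evB_t x z t : evB x z t (bt S) = t. Proof. exact: (etrans (pevC _ _ _) (evS_t _ _)). Qed.
Lemma evPC x y z t b : evP x y z t b%:P = evB x z t b. Proof. exact: pevC. Qed.
Lemma evP_y x y z t : evP x y z t 'X = y. Proof. exact: pevX. Qed.

Lemma evB_in_x x z t (p : {poly C}) : evB x z t (in_x S p) = p.[x].
Proof.
elim/poly_ind: p => [|p c IH]; first by rewrite !rmorph0 horner0.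
rewrite rmorphD rmorphM /= !(rmorphD, rmorphM) /= IH hornerMXaddC; congr (_ * _ + _).
  by rewrite /in_x map_polyX; exact: pevX.
by rewrite /in_x map_polyC; exact: evB_cst.
Qed.

Lemma evB_vanish (b : B) : (forall x z t, x != 0 -> evB x z t b = 0) -> b = 0.
Proof.
move=> h; apply/polyP=> k; rewrite coef0; apply: evS_vanish => z t.
have : map_poly (evS z t) b = 0 by apply: poly_vanish => x x0; exact: h.
by move/(congr1 (fun p : {poly C} => p`_k)); rewrite coef_map coef0.
Qed.

Definition onV n (p : {poly C}) (x y z t : C) := x ^+ n * y + z ^+ 2 + t ^+ 3 + x * p.[x] = 0.

Lemma evB_G x z t p : evB x z t (cG (in_x S p)) = z ^+ 2 + t ^+ 3 + x * p.[x].
Proof. by rewrite /cG (bPE S) !rmorphD !rmorphXn rmorphM /= evB_z evB_t evB_in_x; congr (_ + _ * _); exact: evB_x. Qed.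

Lemma evP_eqA n p x y z t : onV n p x y z t -> evP x y z t (eqA n (in_x S p)) = 0.
Proof.
move=> <-; rewrite /eqA rmorphD rmorphM /= !evPC evP_y rmorphXn /= evB_G.
by rewrite (_ : evB x z t 'X = x) ?evB_x //; ring.
Qed.

(** The coordinate y is set apart: over the points of B it is a polynomial
   variable. *)
Lemma mpoly_poly (F : mpoly.mpoly 4 C) : exists c : {poly B}, forall v : 'I_4 -> C,
  mpoly.meval v F = evP (v 0) (v 1) (v 2%:R) (v 3%:R) c.
Proof.
pose K (F : mpoly.mpoly 4 C) := exists c : {poly B}, forall v : 'I_4 -> C,
  mpoly.meval v F = evP (v 0) (v 1) (v 2%:R) (v 3%:R) c.
have KD F1 F2 : K F1 -> K F2 -> K (F1 + F2).
  by move=> [c1 h1] [c2 h2]; exists (c1 + c2) => v; rewrite mpoly.mevalD h1 h2 rmorphD.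
have KM F1 F2 : K F1 -> K F2 -> K (F1 * F2).
  by move=> [c1 h1] [c2 h2]; exists (c1 * c2) => v; rewrite mpoly.mevalM h1 h2 rmorphM.
have KC c : K (mpoly.mpolyC 4 c).
  by exists ((cst S c)%:P) => v; rewrite mpoly.mevalC evPC evB_cst.
have KX i : K (mpoly.mpolyX C (mpoly.mnm1 i)).
  have : exists c : {poly B}, forall v : 'I_4 -> C, v i = evP (v 0) (v 1) (v 2%:R) (v 3%:R) c.
    case: i => -[|[|[|[|]]]] // h.
    - by exists (bx S)%:P => v; rewrite evPC evB_x; congr v; apply: val_inj.
    - by exists 'X => v; rewrite evP_y; congr v; apply: val_inj.
    - by exists (bz S)%:P => v; rewrite evPC evB_z; congr v; apply: val_inj.
    - by exists (bt S)%:P => v; rewrite evPC evB_t; congr v; apply: val_inj.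
  by move=> [c hc]; exists c => v; rewrite mpoly.mevalXU hc.
rewrite -/(K F) [F]mpoly.mpolyE; apply: (big_ind K) => [||m _]; [|exact: KD|].
  by rewrite -(mpoly.mpolyC0 4 C).
rewrite -mpoly.mul_mpolyC; apply: (KM _ _); first exact: KC.
rewrite mpoly.mpolyXE_id; apply: (big_ind K) => [||i _]; [exact: (KC 1)|exact: KM|].
by elim: (m i) => [|k IH]; [rewrite expr0; exact: (KC 1)|rewrite exprS; apply: KM].
Qed.

Section Vanishing.
Variables (Q : fieldType) (iota : {rmorphism B -> Q}).
Hypothesis iota_inj : injective iota.
Variables (n : nat) (p : {poly C}).
Hypothesis hn : (0 < n)%N.
Local Notation ev := (evA iota n (in_x S p)).

Lemma ev_clear_points (c : {poly B}) : exists (M : nat) (b : B), iota (bx S) ^+ M * ev c = iota b /\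
  forall x y z t, onV n p x y z t -> evB x z t b = x ^+ M * evP x y z t c.
Proof.
elim/poly_ind: c => [|c b [M [b' [e h]]]].
  by exists 0%N, 0; rewrite !rmorph0 mulr0; split=> // x y z t _; rewrite !rmorph0 mulr0.
exists (M + n)%N, (- b' * cG (in_x S p) + bx S ^+ (M + n) * b); split.
  have -> : evA iota n (in_x S p) (c * 'X + b%:P) = ev c * cy iota n (in_x S p) + iota b.
    by rewrite rmorphD rmorphM /= evAX evAC.
  have -> : iota (- b' * cG (in_x S p) + bx S ^+ (M + n) * b) =
      iota b' * (- iota (cG (in_x S p))) + iota (bx S) ^+ (M + n) * iota b.
    by rewrite (rmorphD iota) (rmorphM iota (- b')) (rmorphM iota (_ ^+ _)) (rmorphN iota) (rmorphXn iota) mulNr mulrN.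
  by rewrite -e -(Xy_rel iota_inj n) exprD; ring.
move=> x y z t hV.
have -> : evB x z t (- b' * cG (in_x S p) + bx S ^+ (M + n) * b) =
    - evB x z t b' * (z ^+ 2 + t ^+ 3 + x * p.[x]) + x ^+ (M + n) * evB x z t b.
  by rewrite rmorphD (rmorphM _ (- b')) (rmorphM _ (_ ^+ _)) rmorphN rmorphXn /= evB_x evB_G.
have -> : evP x y z t (c * 'X + b%:P) = evP x y z t c * y + evB x z t b.
  by rewrite rmorphD rmorphM /= evP_y evPC.
rewrite (h _ _ _ _ hV).
have e2 : x ^+ n * y = - (z ^+ 2 + t ^+ 3 + x * p.[x]).
  by apply/eqP; rewrite -addr_eq0 !addrA; apply/eqP.
have e3 : z ^+ 2 + t ^+ 3 + x * p.[x] = - (x ^+ n * y) by rewrite e2 opprK.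
rewrite e3 exprD; ring.
Qed.

(** The points with x != 0 suffice: there y is a function of x, z and t, and
   these are independent. *)
Lemma ev_vanish (c : {poly B}) : (forall x y z t, x != 0 -> onV n p x y z t -> evP x y z t c = 0) -> ev c = 0.
Proof.
move=> h; have [M [b [e hb]]] := ev_clear_points c.
have X0 := X_neq0 iota_inj.
apply: (mulfI (expf_neq0 M X0)); rewrite mulr0 e (_ : b = 0) ?rmorph0 //.
apply: evB_vanish => x z t x0.
have hV : onV n p x (- (z ^+ 2 + t ^+ 3 + x * p.[x]) / x ^+ n) z t.
  by rewrite /onV mulrCA mulfV ?expf_neq0 //; ring.
by rewrite (hb _ _ _ _ hV) h // mulr0.
Qed.

Lemma ev_zero (c : {poly B}) x y z t : ev c = 0 -> onV n p x y z t -> evP x y z t c = 0.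
Proof.
by move=> /(evA_eq0 iota_inj hn)[q ->] hV; rewrite rmorphM /= (evP_eqA hV) mulr0.
Qed.
End Vanishing.

Section Bridge.
Variable n : nat.
Hypothesis hn : (1 < n)%N.

Lemma subst_ex (a0 a1 a2 a3 : {poly B}) : exists g : {rmorphism {poly B} -> {poly B}},
  [/\ forall c, g (cst S c)%:P = (cst S c)%:P, g (bx S)%:P = a0, g 'X = a1, g (bz S)%:P = a2 & g (bt S)%:P = a3].
Proof.
have [g [gc gx gz gt]] := B_eval S (polyC \o cst S) a0 a2 a3.
by exists (pev g a1); split=> [c||||]; rewrite /= ?pevC ?pevX ?gc.
Qed.

Lemma subst_ev (a0 a1 a2 a3 : {poly B}) (g : {rmorphism {poly B} -> {poly B}}) :
  [/\ forall c, g (cst S c)%:P = (cst S c)%:P, g (bx S)%:P = a0, g 'X = a1, g (bz S)%:P = a2 & g (bt S)%:P = a3] ->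
  forall x y z t c, evP x y z t (g c) = evP (evP x y z t a0) (evP x y z t a1) (evP x y z t a2) (evP x y z t a3) c.
Proof.
move=> [gc gx gy gz gt] x y z t.
apply: (@poly_rmorph_ext B C (evP x y z t \o g) (evP _ _ _ _)) => [b|] /=; last by rewrite gy evP_y.
rewrite evPC; apply: (@B_rmorph_ext C S C (evP x y z t \o (g \o polyC)) (evB _ _ _)) => [c|||] /=.
- by rewrite gc evPC !evB_cst.
- by rewrite gx evB_x.
- by rewrite gz evB_z.
- by rewrite gt evB_t.
Qed.

Definition maps_to (p1 p2 : {poly C}) (c0 c1 c2 c3 d0 d1 d2 d3 : {poly B}) :=
  forall x y z t, onV n p1 x y z t ->
  let X := evP x y z t c0 in let Y := evP x y z t c1 in
  let Z := evP x y z t c2 in let T := evP x y z t c3 in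
  onV n p2 X Y Z T /\ [/\ evP X Y Z T d0 = x, evP X Y Z T d1 = y, evP X Y Z T d2 = z & evP X Y Z T d3 = t].

Variables (Q : fieldType) (iota : {rmorphism B -> Q}).
Hypothesis iota_inj : injective iota.
Hypothesis iota_frac : forall u, exists a b, b != 0 /\ u = iota a / iota b.
Local Notation ev p := (evA iota n (in_x S p)).

(** Pullback of functions. It extends to fractions because the inverse map makes
   it injective. *)
Lemma induced_morphism (p1 p2 : {poly C}) (c0 c1 c2 c3 d0 d1 d2 d3 : {poly B})
    (g : {rmorphism {poly B} -> {poly B}}) :
  [/\ forall c, g (cst S c)%:P = (cst S c)%:P, g (bx S)%:P = c0, g 'X = c1, g (bz S)%:P = c2 & g (bt S)%:P = c3] ->
  maps_to p1 p2 c0 c1 c2 c3 d0 d1 d2 d3 -> maps_to p2 p1 d0 d1 d2 d3 c0 c1 c2 c3 ->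
  exists th : {rmorphism Q -> Q}, forall a, th (ev p2 a) = ev p1 (g a).
Proof.
move=> hg hc hd; have hn0 := ltnW hn; have gev := subst_ev hg.
have K1 a : ev p2 a = 0 -> ev p1 (g a) = 0.
  move=> e; apply: (ev_vanish iota_inj) => x y z t _ /hc[hV _].
  by rewrite gev; apply: (ev_zero iota_inj hn0 e).
have K2 b : ev p1 (g b%:P) = 0 -> b = 0.
  move=> e; have h : ev p2 b%:P = 0.
    apply: (ev_vanish iota_inj) => x y z t _ /hd[hV [e0 e1 e2 e3]].
    by have := ev_zero iota_inj hn0 e hV; rewrite gev e0 e1 e2 e3.
  by move: h; rewrite evAC -(rmorph0 iota) => /iota_inj.
have [th thE] := frac_map_rmorph iota_inj iota_frac (f := ev p1 \o (g \o polyC)) K2.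
exists th; apply: (@poly_rmorph_ext B Q (th \o ev p2) (ev p1 \o g)) => [b|] /=.
  by rewrite evAC thE.
have e0 : th (iota (bx S)) ^+ n != 0.
  rewrite expf_neq0 // thE /=; apply/eqP => /K2 /eqP; by rewrite polyX_eq0.
have thb b : th (iota b) = ev p1 (g b%:P) by rewrite thE.
have e1 : th (iota (bx S)) ^+ n = ev p1 (g ('X^n)%:P).
  by rewrite -(rmorphXn th) -(rmorphXn iota) thb.
have hA : ev p1 (g ('X^n)%:P) * ev p1 (g 'X) + ev p1 (g (cG (in_x S p2))%:P) = 0.
  have := K1 _ (evA_eqA iota_inj n (in_x S p2)); rewrite /eqA.
  by rewrite (rmorphD g) (rmorphM g _ 'X) (rmorphD (ev p1)) (rmorphM (ev p1)).
apply: (mulfI e0); transitivity (th (iota (bx S) ^+ n * cy iota n (in_x S p2))).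
  by rewrite evAX (rmorphM th (_ ^+ n)) (rmorphXn th).
rewrite Xy_rel // (rmorphN th) e1 thb; apply/esym/eqP; rewrite -addr_eq0; apply/eqP; exact: hA.
Qed.

Theorem bridge (p1 p2 : {poly C}) (c0 c1 c2 c3 d0 d1 d2 d3 : {poly B}) :
  maps_to p1 p2 c0 c1 c2 c3 d0 d1 d2 d3 -> maps_to p2 p1 d0 d1 d2 d3 c0 c1 c2 c3 ->
  exists lam eps : C, [/\ lam != 0, eps != 0 &
    forall i, (i < n.-1)%N -> p2`_i = eps * lam ^+ i * p1`_i].
Proof.
move=> hc hd; have hn0 := ltnW hn.
have [g hg] := subst_ex c0 c1 c2 c3; have [g' hg'] := subst_ex d0 d1 d2 d3.
have gev := subst_ev hg; have gev' := subst_ev hg'.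
have [th thE] := induced_morphism hg hc hd; have [th' thE'] := induced_morphism hg' hd hc.
have fix_cst p g0 (h0 : {rmorphism Q -> Q}) q : (forall a, h0 (ev p a) = ev q (g0 a)) ->
    (forall c, g0 (cst S c)%:P = (cst S c)%:P) -> forall c, h0 (iota (cst S c)) = iota (cst S c).
  move=> hE gc c; apply: (etrans (congr1 h0 (esym (evAC iota n (in_x S p) _)))).
  by rewrite hE gc evAC.
have canc (h0 h1 : {rmorphism Q -> Q}) : (forall b, h1 (h0 (iota b)) = iota b) -> cancel h0 h1.
  by move=> h u; have [a [b [b0 ->]]] := iota_frac u; rewrite !fmorph_div !h.
apply: (coordinate_iso iota_inj iota_frac (th := th) (th' := th') hn).
- by case: hg => gc _ _ _ _; apply: fix_cst thE gc.
- by case: hg' => gc _ _ _ _; apply: fix_cst thE' gc.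
- apply: (canc th th') => b.
  have e : ev p2 (g' (g b%:P) - b%:P) = 0.
    apply: (ev_vanish iota_inj) => x y z t _ hV.
    have [_ [e0 e1 e2 e3]] := hd _ _ _ _ hV.
    have := gev' x y z t (g b%:P).
    have := gev (evP x y z t d0) (evP x y z t d1) (evP x y z t d2) (evP x y z t d3) b%:P.
    rewrite e0 e1 e2 e3 => h1 h2.
    by rewrite (rmorphB (evP x y z t)) /= h2 h1 subrr.
  have e' : ev p2 (g' (g b%:P)) = ev p2 b%:P by exact: evA_eq e.
  by rewrite -[in LHS](evAC iota n (in_x S p2)) thE thE' e' evAC.
- apply: (canc th' th) => b.
  have e : ev p1 (g (g' b%:P) - b%:P) = 0.
    apply: (ev_vanish iota_inj) => x y z t _ hV.
    have [_ [e0 e1 e2 e3]] := hc _ _ _ _ hV.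
    have := gev x y z t (g' b%:P).
    have := gev' (evP x y z t c0) (evP x y z t c1) (evP x y z t c2) (evP x y z t c3) b%:P.
    rewrite e0 e1 e2 e3 => h1 h2.
    by rewrite (rmorphB (evP x y z t)) /= h2 h1 subrr.
  have e' : ev p1 (g (g' b%:P)) = ev p1 b%:P by exact: evA_eq e.
  by rewrite -[in LHS](evAC iota n (in_x S p1)) thE' thE e' evAC.
- by move=> _ [c ->]; exists (g c); rewrite -thE.
- by move=> _ [c ->]; exists (g' c); rewrite -thE'.
Qed.
End Bridge.
End Points.

(** * Algebraic isomorphisms of threefolds *)

(** The same type as [complexField R], seen as an algebraically closed field. *)
Definition closedComplex (R : realType) : numClosedFieldType := R[i]%C.

Section PolynomialMaps.
Variables (R : realType) (m : nat).
Local Notation C := (complexField R).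

Definition polynomial_fun (f : 'rV[C]_m -> C) :=
  exists F : mpoly.mpoly m C, forall v, f v = mpoly.meval (fun i => v 0 i) F.

Lemma polynomial_fun_cst c : polynomial_fun (fun=> c).
Proof. by exists (mpoly.mpolyC m c) => v; rewrite mpoly.mevalC. Qed.
Lemma polynomial_fun_coord i : polynomial_fun (fun v => v 0 i).
Proof. by exists (mpoly.mpolyX C (mpoly.mnm1 i)) => v; rewrite mpoly.mevalXU. Qed.
Lemma polynomial_funD f g : polynomial_fun f -> polynomial_fun g -> polynomial_fun (fun v => f v + g v).
Proof. by move=> [F hF] [G hG]; exists (F + G) => v; rewrite mpoly.mevalD hF hG. Qed.
Lemma polynomial_funM f g : polynomial_fun f -> polynomial_fun g -> polynomial_fun (fun v => f v * g v).
Proof. by move=> [F hF] [G hG]; exists (F * G) => v; rewrite mpoly.mevalM hF hG. Qed.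
Lemma polynomial_funN f : polynomial_fun f -> polynomial_fun (fun v => - f v).
Proof. by move=> [F hF]; exists (- F) => v; rewrite mpoly.mevalN hF. Qed.
Lemma polynomial_funX f k : polynomial_fun f -> polynomial_fun (fun v => f v ^+ k).
Proof.
move=> hf; elim: k => [|k [F hF]]; first exact: (polynomial_fun_cst 1).
by have [G hG] := hf; exists (G * F) => v; rewrite mpoly.mevalM exprS hF hG.
Qed.
Lemma polynomial_fun_horner (p : {poly C}) f : polynomial_fun f -> polynomial_fun (fun v => p.[f v]).
Proof.
move=> hf; elim/poly_ind: p => [|p c [F hF]].
  by have [F hF] := polynomial_fun_cst 0; exists F => v; rewrite horner0 -hF.
have [G hG] := polynomial_funD (polynomial_funM (ex_intro _ F hF) hf) (polynomial_fun_cst c).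
by exists G => v; rewrite -hG hornerMXaddC.
Qed.

Lemma regular_mapP k (V : set 'rV[C]_m) (W : set 'rV[C]_k) (f : 'rV[C]_m -> 'rV[C]_k) :
  (forall v, V v -> W (f v)) -> (forall j, polynomial_fun (fun v => f v 0 j)) -> regular_map V W f.
Proof.
move=> hW hf; split=> //.
have [F hF] : exists F : 'I_k -> mpoly.mpoly m C, forall j v, f v 0 j = mpoly.meval (fun i => v 0 i) (F j).
  by have [F hF] := fin_all_exists hf; exists F.
by exists F => v _ j.
Qed.
End PolynomialMaps.

Lemma polynomial_fun_ext (R : realType) m (f g : 'rV[complexField R]_m -> complexField R) :
  f =1 g -> polynomial_fun f -> polynomial_fun g.
Proof. by move=> e [F hF]; exists F => v; rewrite -e. Qed.

Lemma polynomial_iso (R : realType) m k (V : set 'rV[complexField R]_m) (W : set 'rV[complexField R]_k) f g :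
  (forall v, V v -> W (f v)) -> (forall w, W w -> V (g w)) ->
  (forall v, V v -> g (f v) = v) -> (forall w, W w -> f (g w) = w) ->
  (forall j, polynomial_fun (fun v => f v 0 j)) -> (forall j, polynomial_fun (fun w => g w 0 j)) ->
  algebraically_isomorphic V W.
Proof. by move=> hf hg fK gK pf pg; exists f, g; split=> //; apply: regular_mapP. Qed.

Lemma root_exists (R : realType) (c : complexField R) k : (0 < k)%N -> exists a : complexField R, a ^+ k = c.
Proof. by move=> k0; exists (k.-root (c : closedComplex R)); exact: rootCK. Qed.

Section Row4.
Variable T : Type.
Definition row4 (x y z t : T) : 'rV[T]_4 := \row_(i < 4) tnth [tuple x; y; z; t] i.
End Row4.

Lemma row4_0 (K : nzRingType) (x y z t : K) : row4 x y z t 0 0 = x.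
Proof. by rewrite mxE (tnth_nth 0). Qed.
Lemma row4_1 (K : nzRingType) (x y z t : K) : row4 x y z t 0 1 = y.
Proof. by rewrite mxE (tnth_nth 0). Qed.
Lemma row4_2 (K : nzRingType) (x y z t : K) : row4 x y z t 0 2%:R = z.
Proof. by rewrite mxE (tnth_nth 0). Qed.
Lemma row4_3 (K : nzRingType) (x y z t : K) : row4 x y z t 0 3%:R = t.
Proof. by rewrite mxE (tnth_nth 0). Qed.
Definition row4E := (row4_0, row4_1, row4_2, row4_3).

Lemma row4_eq (K : nzRingType) (v w : 'rV[K]_4) : v 0 0 = w 0 0 -> v 0 1 = w 0 1 ->
  v 0 2%:R = w 0 2%:R -> v 0 3%:R = w 0 3%:R -> v = w.
Proof.
move=> e0 e1 e2 e3; apply/rowP => -[[|[|[|[|]]]] // h].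
- by move: e0; congr (v 0 _ = w 0 _); apply: val_inj.
- by move: e1; congr (v 0 _ = w 0 _); apply: val_inj.
- by move: e2; congr (v 0 _ = w 0 _); apply: val_inj.
- by move: e3; congr (v 0 _ = w 0 _); apply: val_inj.
Qed.

Lemma threefold_row4 (R : realType) n p (x y z t : complexField R) :
  threefold n p (row4 x y z t) = (x ^+ n * y + z ^+ 2 + t ^+ 3 + x * p.[x] = 0).
Proof. by rewrite /threefold /= !row4E. Qed.

Ltac polyfun := repeat first
  [ exact: polynomial_fun_cst | exact: polynomial_fun_coord
  | apply: polynomial_funD | apply: polynomial_funM | apply: polynomial_funN
  | apply: polynomial_funX | apply: polynomial_fun_horner ].

Lemma polynomial_row4 (R : realType) m (f0 f1 f2 f3 : 'rV[complexField R]_m -> complexField R) :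
  polynomial_fun f0 -> polynomial_fun f1 -> polynomial_fun f2 -> polynomial_fun f3 ->
  forall j, polynomial_fun (fun v => row4 (f0 v) (f1 v) (f2 v) (f3 v) 0 j).
Proof.
by move=> h0 h1 h2 h3 [[|[|[|[|]]]] // h];
  [move: h0|move: h1|move: h2|move: h3]; apply: polynomial_fun_ext => v; rewrite mxE (tnth_nth 0).
Qed.

Lemma dvdXnP (K : fieldType) (m : nat) (p : {poly K}) : ('X^m %| p) <-> (forall i, (i < m)%N -> p`_i = 0).
Proof.
split=> [/dvdpP[q ->] i hi|h]; first by rewrite coefMXn hi.
rewrite -(poly_take_drop m p) (_ : take_poly m p = 0) ?add0r ?dvdp_mull //.
by apply/polyP=> i; rewrite coef_take_poly coef0; case: ifP => // /h.
Qed.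

Section AlgebraicClassification.
Variable R : realType.
Local Notation C := (complexField R).
Variables (n : nat) (p1 p2 : {poly C}).
Hypothesis hn : (1 < n)%N.

Lemma alg_iso_forward : algebraically_isomorphic (threefold n p1) (threefold n p2) ->
  exists lam eps : C, [/\ lam != 0, eps != 0 & 'X^(n - 1) %| p2 - eps *: (p1 \Po (lam *: 'X))].
Proof.
move=> [f [g [[hf [F hF]] [hg [G hG]] fK gK]]].
pose S := affine_plane (closedComplex R).
pose ev := @eval_plane (closedComplex R).
have ev_cst z t c : ev z t (pcst S c) = c by exact: evS_cst.
have ev_z z t : ev z t (pz S) = z by exact: evS_z.
have ev_t z t : ev z t (pt S) = t by exact: evS_t.
have ev_vanish s : (forall z t, ev z t s = 0) -> s = 0 by exact: evS_vanish.
have [c hc] := fin_all_exists (fun j => mpoly_poly ev_cst ev_z ev_t (F j)).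
have [d hd] := fin_all_exists (fun j => mpoly_poly ev_cst ev_z ev_t (G j)).
have hfc : maps_to ev n p1 p2 (c 0) (c 1) (c 2%:R) (c 3%:R) (d 0) (d 1) (d 2%:R) (d 3%:R).
  move=> x y z t hV X Y Z T; pose v : 'rV[C]_4 := row4 x y z t.
  have hv : threefold n p1 v by rewrite threefold_row4.
  have fE j : f v 0 j = evP ev x y z t (c j).
    by rewrite hF // hc /v !row4E.
  have gE j : g (f v) 0 j = evP ev X Y Z T (d j) by rewrite hG ?hd ?fE //; exact: hf.
  split; first by have := hf v hv; rewrite /threefold /= !fE.
  by split; rewrite -gE fK ?row4E.
have hgd : maps_to ev n p2 p1 (d 0) (d 1) (d 2%:R) (d 3%:R) (c 0) (c 1) (c 2%:R) (c 3%:R).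
  move=> x y z t hV X Y Z T; pose v : 'rV[C]_4 := row4 x y z t.
  have hv : threefold n p2 v by rewrite threefold_row4.
  have gE j : g v 0 j = evP ev x y z t (d j).
    by rewrite hG // hd /v !row4E.
  have fE j : f (g v) 0 j = evP ev X Y Z T (c j) by rewrite hF ?hc ?gE //; exact: hg.
  split; first by have := hg v hv; rewrite /threefold /= !gE.
  by split; rewrite -fE gK ?row4E.
have [lam [eps [lam0 eps0 h]]] := bridge ev_cst ev_z ev_t ev_vanish hn
  (@tofrac_inj _) (@tofrac_frac _) hfc hgd.
exists lam, eps; split=> //; apply/dvdXnP => i; rewrite subn1 => /h e.
by rewrite coefB coefZ coef_comp_scale e mulrA subrr.
Qed.

(** With a^6 = lam / eps, scale x, z, t by lam, a^3, a^2; the translation of y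
   by q accounts for the difference of the two equations, a multiple of x^n. *)
Lemma alg_iso_backward (lam eps : C) : lam != 0 -> eps != 0 ->
  'X^(n - 1) %| p2 - eps *: (p1 \Po (lam *: 'X)) ->
  algebraically_isomorphic (threefold n p1) (threefold n p2).
Proof.
move=> lam0 eps0 /dvdpP[q hq]; have hn0 : (0 < n)%N by exact: ltnW.
have [a ha] := root_exists (lam / eps) (isT : (0 < 6)%N).
have a0 : a != 0.
  by apply/eqP=> a0; move: ha => /eqP; rewrite a0 expr0n eq_sym mulf_eq0 invr_eq0 (negPf lam0) (negPf eps0).
have epsE : eps = lam / a ^+ 6 by rewrite ha invf_div mulrCA mulfV ?mulr1.
have xn x : x ^+ n = x * x ^+ n.-1 by rewrite -exprS prednK.
have p2E x : x * p2.[x] = lam / a ^+ 6 * (x * p1.[lam * x]) + q.[x] * x ^+ n.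
  have -> : p2 = eps *: (p1 \Po (lam *: 'X)) + q * 'X^(n - 1) by rewrite -hq; ring.
  by rewrite hornerD hornerZ hornerM hornerXn horner_comp hornerZ hornerX subn1 epsE xn; ring.
apply: (polynomial_iso
  (f := fun v => row4 (lam^-1 * v 0 0) (lam ^+ n / a ^+ 6 * v 0 1 - q.[lam^-1 * v 0 0])
    (a ^- 3 * v 0 2%:R) (a ^- 2 * v 0 3%:R))
  (g := fun v => row4 (lam * v 0 0) (lam ^- n * a ^+ 6 * (v 0 1 + q.[v 0 0]))
    (a ^+ 3 * v 0 2%:R) (a ^+ 2 * v 0 3%:R))).
- move=> v; rewrite [threefold _ _ v]/threefold threefold_row4 /=.
  move: (v 0 0) (v 0 1) (v 0 2%:R) (v 0 3%:R) => x y z t.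
  have [u ->] : exists u, x = lam * u by exists (lam^-1 * x); rewrite mulVKf.
  rewrite mulKf // => hv; rewrite p2E exprMn in hv *.
  rewrite -[RHS](mulr0 (a ^- 6)) -hv; field; exact: a0.
- move=> v; rewrite [threefold _ _ v]/threefold threefold_row4 /=.
  move: (v 0 0) (v 0 1) (v 0 2%:R) (v 0 3%:R) => x y z t; rewrite p2E exprMn => hv.
  rewrite -[RHS](mulr0 (a ^+ 6)) -hv; field; rewrite ?a0 ?expf_neq0 //.
- by move=> v _; rewrite !row4E; apply: row4_eq; rewrite !row4E; field; rewrite ?a0 ?lam0 ?expf_neq0.
- move=> v _; rewrite !row4E mulKf //.
  by apply: row4_eq; rewrite !row4E //; field; rewrite ?a0 ?lam0 ?expf_neq0.
- by apply: polynomial_row4; polyfun.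
- by apply: polynomial_row4; polyfun.
Qed.
End AlgebraicClassification.

(** * Isomorphisms of cylinders *)

Section Hensel.
Variable K : numFieldType.
Implicit Types (p q F : {poly K}).

Lemma comp_poly_taylor1 F q h : exists r,
  F \Po (q + h) = F \Po q + h * (F^`() \Po q) + h ^+ 2 * r.
Proof.
elim/poly_ind: F => [|F c [r IH]]; first by exists 0; rewrite !(comp_poly0, deriv0); ring.
exists ((F^`() \Po q) + r * (q + h)).
rewrite derivMXaddC !(comp_polyD, comp_polyM, comp_polyX, comp_polyC) IH; ring.
Qed.

Lemma dvdXp p : ('X %| p) = (p.[0] == 0).
Proof. by rewrite -['X]subr0 -polyC0 dvdp_XsubCl. Qed.

(** Newton's approximation. The derivative is invertible at the origin, so each
   step determines one more coefficient of q. *)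
Lemma hensel p1 p2 F (q0 : K) m : p1.[0] != 0 -> F.[q0] * p1.[0] = p2.[0] -> F^`().[q0] != 0 ->
  exists q, q.[0] = q0 /\ 'X^m %| p2 - (F \Po q) * p1.
Proof.
move=> p10 h0 h1; suff [q [hq hd]] : exists q, q.[0] = q0 /\ 'X^(m.+1) %| p2 - (F \Po q) * p1.
  by exists q; split=> //; apply: dvdp_trans hd; rewrite dvdp_exp2l.
elim: m => [|m [q [hq /dvdpP[s hs]]]].
  by exists q0%:P; rewrite hornerC expr1 dvdXp hornerD hornerN hornerM horner_comp hornerC h0 subrr.
pose c := s.[0] / (F^`().[q0] * p1.[0]).
have [r hr] := comp_poly_taylor1 F q (c *: 'X^(m.+1)).
exists (q + c *: 'X^(m.+1)); split; first by rewrite hornerD hornerZ hornerXn expr0n mulr0 addr0.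
have [d hd] : exists d, s - c *: ((F^`() \Po q) * p1) = d * 'X.
  apply/dvdpP; rewrite dvdXp hornerD hornerN hornerZ hornerM horner_comp hq /c divfK ?subrr //.
  by rewrite mulf_neq0.
apply/dvdpP; exists (d - c ^+ 2 *: ('X^m * r * p1)).
have -> : p2 - (F \Po (q + c *: 'X^(m.+1))) * p1 = (s - c *: ((F^`() \Po q) * p1)) * 'X^(m.+1) - c ^+ 2 *: ('X^(m.+1) ^+ 2 * r * p1).
  rewrite hr; have -> : p2 = s * 'X^(m.+1) + (F \Po q) * p1 by rewrite -hs; ring.
  rewrite -!mul_polyC rmorphXn /=; ring.
rewrite hd -!mul_polyC !exprS; ring.
Qed.
End Hensel.

Section Cylinder.
Variable R : realType.
Local Notation C := (complexField R).

Definition row5 (x y z t w : C) : 'rV[C]_(4 + 1) := row_mx (row4 x y z t) (const_mx w).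
Definition c5 (v : 'rV[C]_(4 + 1)) j := lsubmx v 0 j.
Definition cw (v : 'rV[C]_(4 + 1)) := rsubmx v 0 0.

Lemma row5_0 x y z t w : c5 (row5 x y z t w) 0 = x. Proof. by rewrite /c5 row_mxKl row4E. Qed.
Lemma row5_1 x y z t w : c5 (row5 x y z t w) 1 = y. Proof. by rewrite /c5 row_mxKl row4E. Qed.
Lemma row5_2 x y z t w : c5 (row5 x y z t w) 2%:R = z. Proof. by rewrite /c5 row_mxKl row4E. Qed.
Lemma row5_3 x y z t w : c5 (row5 x y z t w) 3%:R = t. Proof. by rewrite /c5 row_mxKl row4E. Qed.
Lemma row5_4 x y z t w : cw (row5 x y z t w) = w. Proof. by rewrite /cw row_mxKr mxE. Qed.
Definition row5E := (row5_0, row5_1, row5_2, row5_3, row5_4).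

Lemma row5_eta v : row5 (c5 v 0) (c5 v 1) (c5 v 2%:R) (c5 v 3%:R) (cw v) = v.
Proof.
rewrite -[RHS]hsubmxK; congr row_mx; first by apply: row4_eq; rewrite row4E.
by apply/rowP => i; rewrite mxE /cw ord1.
Qed.

Lemma polynomial_c5 j : polynomial_fun (c5^~ j).
Proof. by apply: (polynomial_fun_ext _ (polynomial_fun_coord R (lshift 1 j))) => v; rewrite /c5 mxE. Qed.
Lemma polynomial_cw : polynomial_fun cw.
Proof. by apply: (polynomial_fun_ext _ (polynomial_fun_coord R (rshift 4 0))) => v; rewrite /cw mxE. Qed.

Lemma polynomial_row5 (f0 f1 f2 f3 f4 : 'rV[C]_(4 + 1) -> C) :
  polynomial_fun f0 -> polynomial_fun f1 -> polynomial_fun f2 -> polynomial_fun f3 -> polynomial_fun f4 ->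
  forall j, polynomial_fun (fun v => row5 (f0 v) (f1 v) (f2 v) (f3 v) (f4 v) 0 j).
Proof.
move=> h0 h1 h2 h3 h4 j; case: (splitP j) => k hk.
  have -> : j = lshift 1 k by apply: val_inj.
  by apply: (polynomial_fun_ext _ (polynomial_row4 h0 h1 h2 h3 k)) => v; rewrite row_mxEl.
have -> : j = rshift 4 k by apply: val_inj.
by apply: (polynomial_fun_ext _ h4) => v; rewrite row_mxEr mxE.
Qed.

Lemma cylinder_row5 n p x y z t w : cylinder (threefold n p) (row5 x y z t w) =
  (x ^+ n * y + z ^+ 2 + t ^+ 3 + x * p.[x] = 0).
Proof. by rewrite /cylinder /= row_mxKl threefold_row4. Qed.

End Cylinder.

Section CylinderShear.
Variable K : comNzRingType.
Implicit Types (X a b e r s : K).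

(** In this section X stands for x^n, and a, b, e for values of polynomials with
   a b = 1 - X^2 e. The elements E2, E3, E6 complete the powers of a b:
   a^k b^k = 1 - X^2 Ek. *)
Definition E2 X e : K := 2%:R * e - X ^+ 2 * e ^+ 2.
Definition E3 X e : K := 3%:R * e - 3%:R * X ^+ 2 * e ^+ 2 + X ^+ 4 * e ^+ 3.
Definition E6 X e : K := E2 X (E3 X e).

(** The terms of (a^3 z - X w)^2 + (a^2 t - X m)^3 other than a^6 (z^2 + t^3),
   divided by X, together with the difference r of the terms in x alone; the
   coordinate y has to absorb it. *)
Definition defect X a r z t w m : K := r - 2%:R * a ^+ 3 * z * w + X * w ^+ 2
  - 3%:R * a ^+ 4 * t ^+ 2 * m + 3%:R * a ^+ 2 * t * X * m ^+ 2 - X ^+ 2 * m ^+ 3.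

(** The map is the composition of two linear maps of determinant 1 with
   coefficients in x: (z, w) |-> ([fz], [mid]), with rows (a^3, - X) and
   (X E3, b^3), then (t, m) |-> ([ft], [fw]), with rows (a^2, - X) and
   (X E2, b^2), where m is the value of [mid]. *)
Definition mid X b e z w : K := X * E3 X e * z + b ^+ 3 * w.
Definition fz X a z w : K := a ^+ 3 * z - X * w.
Definition ft X a t m : K := a ^+ 2 * t - X * m.
Definition fw X b e t m : K := X * E2 X e * t + b ^+ 2 * m.
Definition fy X a r y z t w m : K := a ^+ 6 * y - defect X a r z t w m.

(** The two matrices are inverted in the opposite order. Recovering y takes a
   division by a^6, which is only invertible modulo X^2; the second term of [gy]
   is the correction, by means of X y = - (z^2 + t^3 + s). *)
Definition mid' X a e t w : K := a ^+ 2 * w - X * E2 X e * t.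
Definition gt X b t w : K := b ^+ 2 * t + X * w.
Definition gz X b z m : K := b ^+ 3 * z + X * m.
Definition gw X a e z m : K := a ^+ 3 * m - X * E3 X e * z.
Definition gy X a b e r s y z t w m : K :=
  b ^+ 6 * (y + defect X a r z t w m) - X * E6 X e * (z ^+ 2 + t ^+ 3 + s).

Variables (X a b e r s1 s2 : K).
Hypothesis hab : a * b = 1 - X ^+ 2 * e.
Hypothesis hs : s2 = a ^+ 6 * s1 + X * r.

Lemma E2P : a ^+ 2 * b ^+ 2 = 1 - X ^+ 2 * E2 X e.
Proof. by rewrite -exprMn hab /E2; ring. Qed.
Lemma E3P : a ^+ 3 * b ^+ 3 = 1 - X ^+ 2 * E3 X e.
Proof. by rewrite -exprMn hab /E3; ring. Qed.
Lemma E6P : a ^+ 6 * b ^+ 6 = 1 - X ^+ 2 * E6 X e.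
Proof. by rewrite (exprM a 3 2) (exprM b 3 2) -exprMn E3P /E6 /E2; ring. Qed.

Lemma shear_equation y z t w m :
  X * fy X a r y z t w m + fz X a z w ^+ 2 + ft X a t m ^+ 3 + s2 =
  a ^+ 6 * (X * y + z ^+ 2 + t ^+ 3 + s1).
Proof. by rewrite hs /fy /fz /ft /defect; ring. Qed.

Lemma mid'K t m : mid' X a e (ft X a t m) (fw X b e t m) = m.
Proof.
transitivity ((a ^+ 2 * b ^+ 2 + X ^+ 2 * E2 X e) * m); first by rewrite /mid' /ft /fw; ring.
by rewrite E2P subrK mul1r.
Qed.
Lemma gtK t m : gt X b (ft X a t m) (fw X b e t m) = t.
Proof.
transitivity ((a ^+ 2 * b ^+ 2 + X ^+ 2 * E2 X e) * t); first by rewrite /gt /ft /fw; ring.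
by rewrite E2P subrK mul1r.
Qed.
Lemma gzK z w : gz X b (fz X a z w) (mid X b e z w) = z.
Proof.
transitivity ((a ^+ 3 * b ^+ 3 + X ^+ 2 * E3 X e) * z); first by rewrite /gz /fz /mid; ring.
by rewrite E3P subrK mul1r.
Qed.
Lemma gwK z w : gw X a e (fz X a z w) (mid X b e z w) = w.
Proof.
transitivity ((a ^+ 3 * b ^+ 3 + X ^+ 2 * E3 X e) * w); first by rewrite /gw /fz /mid; ring.
by rewrite E3P subrK mul1r.
Qed.
Lemma ftK t w : ft X a (gt X b t w) (mid' X a e t w) = t.
Proof.
transitivity ((a ^+ 2 * b ^+ 2 + X ^+ 2 * E2 X e) * t); first by rewrite /gt /ft /mid'; ring.
by rewrite E2P subrK mul1r.
Qed.
Lemma fwK t w : fw X b e (gt X b t w) (mid' X a e t w) = w.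
Proof.
transitivity ((a ^+ 2 * b ^+ 2 + X ^+ 2 * E2 X e) * w); first by rewrite /gt /fw /mid'; ring.
by rewrite E2P subrK mul1r.
Qed.
Lemma fzK z m : fz X a (gz X b z m) (gw X a e z m) = z.
Proof.
transitivity ((a ^+ 3 * b ^+ 3 + X ^+ 2 * E3 X e) * z); first by rewrite /gz /fz /gw; ring.
by rewrite E3P subrK mul1r.
Qed.
Lemma midK z m : mid X b e (gz X b z m) (gw X a e z m) = m.
Proof.
transitivity ((a ^+ 3 * b ^+ 3 + X ^+ 2 * E3 X e) * m); first by rewrite /gz /mid /gw; ring.
by rewrite E3P subrK mul1r.
Qed.

Lemma gyK y z t w m : X * y + z ^+ 2 + t ^+ 3 + s1 = 0 ->
  gy X a b e r s1 (fy X a r y z t w m) z t w m = y.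
Proof.
rewrite -!addrA addrC => /eqP; rewrite addr_eq0 addrA => /eqP hv.
rewrite /gy /fy subrK mulrA (mulrC (b ^+ 6)) E6P hv; ring.
Qed.

Lemma shear_inverse y z t w : X * y + z ^+ 2 + t ^+ 3 + s2 = 0 ->
  let m := mid' X a e t w in let z' := gz X b z m in
  let t' := gt X b t w in let w' := gw X a e z m in
  let y' := gy X a b e r s1 y z' t' w' m in
  X * y' + z' ^+ 2 + t' ^+ 3 + s1 = 0 /\ fy X a r y' z' t' w' m = y.
Proof.
move=> + m z' t' w' /=.
have <- : fz X a z' w' = z by exact: fzK.
have <- : ft X a t' m = t by exact: ftK.
move: m z' t' w' => m {}z {}t {}w.
pose rho := y + defect X a r z t w m; pose S := z ^+ 2 + t ^+ 3 + s1.
have -> : X * y + fz X a z w ^+ 2 + ft X a t m ^+ 3 + s2 = X * rho + a ^+ 6 * S.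
  by rewrite hs /fz /ft /rho /S /defect; ring.
move=> /eqP; rewrite addr_eq0 => /eqP hr; rewrite /gy -/rho -/S; split.
  transitivity (b ^+ 6 * (X * rho) - X ^+ 2 * E6 X e * S + S); first by rewrite /S; ring.
  by rewrite hr mulrN mulrA (mulrC (b ^+ 6)) E6P; ring.
transitivity (a ^+ 6 * b ^+ 6 * rho - X * E6 X e * (a ^+ 6 * S) - defect X a r z t w m).
  by rewrite /fy; ring.
have -> : a ^+ 6 * S = - (X * rho) by rewrite hr opprK.
by rewrite E6P /rho; ring.
Qed.
End CylinderShear.

Section CylinderIso.
Variables (R : realType) (n : nat).
Local Notation C := (complexField R).

(** The polynomial a satisfies a^6 p1 = p2 modulo x^n, and c is its inverse
   modulo x^(2n). *)
Theorem cylinder_iso (p1 p2 : {poly C}) : p1.[0] != 0 -> p2.[0] != 0 ->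
  algebraically_isomorphic (cylinder (threefold n p1)) (cylinder (threefold n p2)).
Proof.
move=> p10 p20; have [k hk] := root_exists (p2.[0] / p1.[0]) (isT : (0 < 6)%N).
have k0 : k != 0.
  by apply/eqP=> k0; move: hk => /eqP; rewrite k0 expr0n eq_sym mulf_eq0 invr_eq0 (negPf p10) (negPf p20).
have [||a [a0 /dvdpP[r hr]]] := @hensel _ p1 p2 'X^6 k n p10.
- by rewrite hornerXn hk divfK.
- by rewrite derivXn hornerMn hornerXn mulrn_eq0 expf_eq0 (negPf k0).
have [[c d] /= hcd] : exists u : {poly C} * {poly C}, u.1 * a + u.2 * 'X^(2 * n) = 1.
  apply/Bezout_eq1_coprimepP; by apply: coprimep_expr; rewrite coprimepX /root a0.
have hab x : a.[x] * c.[x] = 1 - (x ^+ n) ^+ 2 * d.[x].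
  have -> : (x ^+ n) ^+ 2 * d.[x] = (d * 'X^(2 * n)).[x] by rewrite hornerM hornerXn -exprM mulnC mulrC.
  by rewrite -hornerM -[X in X - _](hornerC 1 x) -hornerN -hornerD; congr horner; rewrite polyC1 -hcd; ring.
have hs x : x * p2.[x] = a.[x] ^+ 6 * (x * p1.[x]) + x ^+ n * (x * r.[x]).
  have -> : p2 = (a ^+ 6) * p1 + r * 'X^n by rewrite -hr comp_Xn_poly; ring.
  by rewrite !(hornerD, hornerM, hornerXn, horner_exp); ring.
apply: (polynomial_iso
  (f := fun v => let x := c5 v 0 in let X := x ^+ n in let y := c5 v 1 in let z := c5 v 2%:R in
    let t := c5 v 3%:R in let w := cw v in let m := mid X c.[x] d.[x] z w in
    row5 x (fy X a.[x] (x * r.[x]) y z t w m) (fz X a.[x] z w) (ft X a.[x] t m) (fw X c.[x] d.[x] t m))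
  (g := fun v => let x := c5 v 0 in let X := x ^+ n in let y' := c5 v 1 in let z' := c5 v 2%:R in
    let t' := c5 v 3%:R in let w' := cw v in let m := mid' X a.[x] d.[x] t' w' in
    let z := gz X c.[x] z' m in let t := gt X c.[x] t' w' in let w := gw X a.[x] d.[x] z' m in
    row5 x (gy X a.[x] c.[x] d.[x] (x * r.[x]) (x * p1.[x]) y' z t w m) z t w)).
- move=> v; rewrite -{1}[v]row5_eta !cylinder_row5 => hv.
  by rewrite (shear_equation (hs _)) hv mulr0.
- move=> v; rewrite -{1}[v]row5_eta !cylinder_row5 => hv.
  by have [] := shear_inverse (hab _) (hs _) (cw v) hv.
- move=> v; rewrite -{1}[v]row5_eta !cylinder_row5 => hv.
  rewrite !row5E /= (mid'K (hab _)) (gtK (hab _)) (gzK (hab _)) (gwK (hab _)) (gyK _ (hab _)) //.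
  exact: row5_eta.
- move=> v; rewrite -{1}[v]row5_eta !cylinder_row5 => hv.
  have [_ e] := shear_inverse (hab _) (hs _) (cw v) hv.
  rewrite !row5E /= (midK (hab _)) e (fzK (hab _)) (ftK (hab _)) (fwK (hab _)).
  exact: row5_eta.
- by apply: polynomial_row5; rewrite /fy /fz /ft /fw /mid /defect /E3 /E2; polyfun; (exact: polynomial_c5 || exact: polynomial_cw).
- by apply: polynomial_row5; rewrite /gy /gz /gt /gw /mid' /defect /E6 /E3 /E2; polyfun; (exact: polynomial_c5 || exact: polynomial_cw).
Qed.
End CylinderIso.

(** * The complex exponential *)

Local Open Scope classical_set_scope.
Local Open Scope complex_scope.

Section RealTaylor.
Variable R : realType.

Lemma mean_value_bound (f df : R -> R) (M : R) : (forall s : R, is_derive s (1 : R) f (df s)) ->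
  f 0 = 0 -> (forall s, 0 <= s <= 1 -> `|df s| <= M) -> forall s, 0 <= s <= 1 -> `|f s| <= M.
Proof.
move=> hd f0 hM s /andP[s0 s1]; have [->|s0'] := eqVneq s 0.
  by rewrite f0 normr0; apply: le_trans (hM 0 _); rewrite ?lexx ?ler01.
have sp : 0 < s by rewrite lt_def s0' s0.
have hc0 : {within `[0, s], continuous f}.
  by apply: derivable_within_continuous => x _; exact: (@ex_derive _ _ _ _ _ _ _ (hd x)).
have [c hc] := MVT sp (fun x _ => hd x) hc0.
rewrite f0 !subr0 => ->; rewrite in_itv /= in hc; have /andP[c0 c1] := hc.
rewrite normrM (ger0_norm s0) -[M]mulr1; apply: ler_pM => //.
by apply: hM; rewrite (ltW c0) (le_trans (ltW c1)).
Qed.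

Variables (a b rho : R).
Hypotheses (ha : `|a| <= rho) (hb : `|b| <= rho).
Variables U W : nat -> {poly R}.
Hypotheses (U0 : U 0%N = 0) (W0 : W 0%N = 0).
Hypotheses (US0 : forall k, (U k.+1).[0] = 1) (WS0 : forall k, (W k.+1).[0] = 0).
Hypothesis dU : forall k, deriv (U k.+1) = a *: U k - b *: W k.
Hypothesis dW : forall k, deriv (W k.+1) = a *: W k + b *: U k.

Let u s := expR (a * s) * cos (b * s).
Let w s := expR (a * s) * sin (b * s).

Let du (s : R) : is_derive s (1 : R) u (a * u s - b * w s).
Proof.
rewrite /u /w; apply: is_derive_eq; rewrite /GRing.scale /=; ring.
Qed.
Let dw (s : R) : is_derive s (1 : R) w (a * w s + b * u s).
Proof.
rewrite /u /w; apply: is_derive_eq; rewrite /GRing.scale /=; ring.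
Qed.

(** U k + i W k is the Taylor polynomial of s |-> exp((a + i b) s) with k terms.
   The derivative of a remainder is a + i b times the previous remainder; by the
   mean value theorem each step gains a factor 2 rho. *)
Lemma exp_remainder k s : 0 <= s <= 1 ->
  `|u s - (U k).[s]| <= (2%:R * rho) ^+ k * expR rho /\ `|w s - (W k).[s]| <= (2%:R * rho) ^+ k * expR rho.
Proof.
have rho0 : 0 <= rho by apply: le_trans ha.
elim: k s => [|k IH] s hs.
  have [s0 s1] := andP hs.
  have h : expR (a * s) <= expR rho.
    rewrite ler_expR; apply: le_trans (ler_norm _) _; rewrite normrM (ger0_norm s0).
    by rewrite -[rho]mulr1; apply: ler_pM.
  rewrite U0 W0 !horner0 !subr0 expr0 mul1r /u /w !normrM !(ger0_norm (expR_ge0 _)).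
  by split; rewrite -[expR rho]mulr1; apply: ler_pM; rewrite ?expR_ge0 ?cos_max ?sin_max.
pose M := (2%:R * rho) ^+ k.+1 * expR rho.
have bnd c d c' d' : `|c| <= rho -> `|d| <= rho -> `|c'| <= (2%:R * rho) ^+ k * expR rho ->
    `|d'| <= (2%:R * rho) ^+ k * expR rho -> `|c * c' + d * d'| <= M.
  move=> hc hd hc' hd'; apply: le_trans (ler_normD _ _) _; rewrite !normrM.
  have -> : M = rho * ((2%:R * rho) ^+ k * expR rho) + rho * ((2%:R * rho) ^+ k * expR rho).
    by rewrite /M exprS; ring.
  by apply: lerD; apply: ler_pM.
split.
  apply: (mean_value_bound (f := fun s => u s - (U k.+1).[s])
    (df := fun s => a * (u s - (U k).[s]) + - b * (w s - (W k).[s]))) => // [t||t /IH[h1 h2]].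
  - have -> : a * (u t - (U k).[t]) + - b * (w t - (W k).[t]) = (a * u t - b * w t) - (deriv (U k.+1)).[t].
      by rewrite dU hornerD hornerN !hornerZ; ring.
    exact: is_deriveB.
  - by rewrite US0 /u !mulr0 expR0 cos0 mulr1 subrr.
  - by apply: bnd => //; rewrite normrN.
apply: (mean_value_bound (f := fun s => w s - (W k.+1).[s])
    (df := fun s => a * (w s - (W k).[s]) + b * (u s - (U k).[s]))) => // [t||t /IH[h1 h2]].
- have -> : a * (w t - (W k).[t]) + b * (u t - (U k).[t]) = (a * w t + b * u t) - (deriv (W k.+1)).[t].
    by rewrite dW hornerD !hornerZ; ring.
  exact: is_deriveB.
- by rewrite WS0 /w !mulr0 expR0 sin0 mulr0 subrr.
- exact: bnd.
Qed.
End RealTaylor.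

Section ComplexExponential.
Variable R : realType.
Local Notation C := (complexField R).
Local Notation Re := complex.Re.
Local Notation Im := complex.Im.
Local Notation normc := Normc.normc.
Implicit Types (z w h : C).

Definition cexp z : C := (expR (Re z) * cos (Im z)) +i* (expR (Re z) * sin (Im z)).

Lemma cexp0 : cexp 0 = 1.
Proof. by rewrite /cexp /= expR0 cos0 sin0 mulr1 mulr0. Qed.
Lemma cexpD z w : cexp (z + w) = cexp z * cexp w.
Proof.
case: z w => [a b] [c d]; rewrite /cexp /= expRD cosD sinD.
by apply/eqP; rewrite eq_complex /=; apply/andP; split; apply/eqP; ring.
Qed.
Lemma cexpNK z : cexp (- z) * cexp z = 1.
Proof. by rewrite -cexpD addNr cexp0. Qed.
Lemma cexpMn z k : cexp (z *+ k) = cexp z ^+ k.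
Proof. by elim: k => [|k IH]; rewrite ?cexp0 // mulrS cexpD IH exprS. Qed.

Lemma norm_normc z : `|z| = (normc z)%:C. Proof. by []. Qed.
Lemma Re_le_normc z : `|Re z| <= normc z.
Proof. by case: z => a b /=; rewrite -sqrtr_sqr; apply: ler_wsqrtr; rewrite lerDl sqr_ge0. Qed.
Lemma Im_le_normc z : `|Im z| <= normc z.
Proof. by case: z => a b /=; rewrite -sqrtr_sqr; apply: ler_wsqrtr; rewrite lerDr sqr_ge0. Qed.
Lemma normc_le z : normc z <= `|Re z| + `|Im z|.
Proof.
case: z => a b /=; rewrite -[leRHS]ger0_norm ?addr_ge0 // -sqrtr_sqr; apply: ler_wsqrtr.
by rewrite sqrrD !real_normK ?num_real // addrAC lerDl mulrn_wge0 ?mulr_ge0.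
Qed.
Lemma ReD z w : Re (z + w) = Re z + Re w. Proof. by case: z w => [a b] [c d]. Qed.
Lemma ImD z w : Im (z + w) = Im z + Im w. Proof. by case: z w => [a b] [c d]. Qed.
Lemma Re_sum k (F : 'I_k -> C) : Re (\sum_j F j) = \sum_j Re (F j).
Proof. exact: (big_morph _ ReD). Qed.
Lemma Im_sum k (F : 'I_k -> C) : Im (\sum_j F j) = \sum_j Im (F j).
Proof. exact: (big_morph _ ImD). Qed.

Definition exp_poly N : {poly C} := \poly_(j < N) (j`!%:R)^-1.

(** The remainder estimate along the ray s |-> s h, at s = 1. *)
Lemma cexp_taylor N (B : R) : exists2 M : R, 0 <= M &
  forall h, normc h <= B -> normc (cexp h - (exp_poly N).[h]) <= M * normc h ^+ N.
Proof.
exists (2%:R * 2%:R ^+ N * expR B); first by rewrite !mulr_ge0 ?exprn_ge0 ?expR_ge0.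
move=> h hB; pose c j : C := h ^+ j / j`!%:R.
have cS j : c j.+1 *+ j.+1 = h * c j.
  rewrite /c factS natrM -mulr_natr exprS; field.
  by rewrite -(natrD _ 1) !pnatr_eq0 -lt0n fact_gt0.
have ReMn z k : Re (z *+ k) = Re z *+ k by elim: k => // k IH; rewrite !mulrS ReD IH.
have ImMn z k : Im (z *+ k) = Im z *+ k by elim: k => // k IH; rewrite !mulrS ImD IH.
have [] := @exp_remainder R (Re h) (Im h) (normc h) (Re_le_normc h) (Im_le_normc h)
  (fun k => \poly_(j < k) Re (c j)) (fun k => \poly_(j < k) Im (c j)) _ _ _ _ _ _ N 1 _.
- by apply/polyP => i; rewrite coef_poly coef0.
- by apply/polyP => i; rewrite coef_poly coef0.
- by move=> k; rewrite horner_coef0 coef_poly /c expr0 fact0 divr1.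
- by move=> k; rewrite horner_coef0 coef_poly /c expr0 fact0 divr1.
- move=> k; apply/polyP => i; rewrite coef_deriv coefB !coefZ !coef_poly ltnS.
  case: ifP => _; last by rewrite !mulr0 subr0 mul0rn.
  by rewrite -ReMn cS; case: (h) (c i) => [a b] [a' b'].
- move=> k; apply/polyP => i; rewrite coef_deriv coefD !coefZ !coef_poly ltnS.
  case: ifP => _; last by rewrite !mulr0 addr0 mul0rn.
  by rewrite -ImMn cS; case: (h) (c i) => [a b] [a' b'].
- by rewrite ler01 lexx.
rewrite !mulr1 => h1 h2.
have eR : Re (exp_poly N).[h] = (\poly_(j < N) Re (c j)).[1].
  rewrite !horner_poly Re_sum; apply: eq_bigr => j _; rewrite expr1n mulr1; congr Re; exact: mulrC.
have eI : Im (exp_poly N).[h] = (\poly_(j < N) Im (c j)).[1].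
  rewrite !horner_poly Im_sum; apply: eq_bigr => j _; rewrite expr1n mulr1; congr Im; exact: mulrC.
have ReB z w : Re (z - w) = Re z - Re w by case: z w => [a b] [a' b'].
have ImB z w : Im (z - w) = Im z - Im w by case: z w => [a b] [a' b'].
apply: le_trans (normc_le _) _; rewrite ReB ImB eR eI.
apply: le_trans (lerD h1 h2) _.
rewrite exprMn -mulr2n -[leLHS]mulr_natl.
rewrite [leRHS](_ : _ = 2%:R * (2%:R ^+ N * normc h ^+ N * expR B)); last by ring.
have nc0 : 0 <= normc h by apply: le_trans (Re_le_normc h).
by rewrite !ler_wpM2l ?mulr_ge0 ?exprn_ge0 ?ler_expR.
Qed.
End ComplexExponential.

(** * Complex differentiable maps *)

Section Differentiability.
Variable R : realType.
Local Notation C := (complexField R).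

Lemma cexp_taylorC N (B : C) : 0 <= B -> exists2 M : C, 0 <= M &
  forall h : C, `|h| <= B -> `|cexp h - (exp_poly R N).[h]| <= M * `|h| ^+ N.
Proof.
move=> B0; have BE : (complex.Re B)%:C = B :> C by apply: RRe_real; exact: ger0_real.
have [M M0 hM] := cexp_taylor N (complex.Re B).
exists (M%:C : C) => [|h]; first by rewrite ler0c.
rewrite -BE !norm_normc lecR => /hM; rewrite -lecR => h1.
by apply: le_trans h1 _; rewrite rmorphM rmorphXn.
Qed.

Lemma poly_bounded (p : {poly C}) : exists2 M : C, 0 <= M & forall h : C, `|h| <= 1 -> `|p.[h]| <= M.
Proof.
elim/poly_ind: p => [|p c [M M0 hM]]; first by exists 0 => // h _; rewrite horner0 normr0.
exists (M + `|c|) => [|h h1]; first by rewrite addr_ge0.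
rewrite hornerMXaddC; apply: le_trans (ler_normD _ _) _; rewrite lerD2r normrM -[M]mulr1.
by apply: ler_pM => //; exact: hM.
Qed.

Lemma quadratic_differentiable (f : C -> C) (a d M : C) : 0 <= M ->
  (forall h, `|h| <= 1 -> `|f (h + a) - f a - d * h| <= M * `|h| ^+ 2) -> differentiable f a.
Proof.
move=> M0 hf; apply/derivable1_diffP/cvg_ex; exists d; apply/cvgrPdist_le => eps e0.
near=> h.
have h0 : h != 0 by near: h; exact: nbhs_dnbhs_neq.
have h1 : `|h| <= 1 by near: h; apply: dnbhs0_le; exact: ltr01.
have h2 : `|h| <= eps / (M + 1) by near: h; apply: dnbhs0_le; rewrite divr_gt0 ?ltr_wpDl.
rewrite /= distrC /GRing.scale /= mulr1.
have -> : h^-1 * (f (h + a) - f a) - d = h^-1 * (f (h + a) - f a - d * h) by field.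
rewrite normrM normfV; apply: (@le_trans _ _ (`|h|^-1 * (M * `|h| ^+ 2))).
  by rewrite ler_wpM2l ?invr_ge0 // hf.
have -> : `|h|^-1 * (M * `|h| ^+ 2) = M * `|h| by rewrite expr2 mulrCA mulKf ?normr_eq0.
apply: (@le_trans _ _ ((M + 1) * `|h|)); first by rewrite ler_wpM2r // lerDl ler01.
by rewrite -ler_pdivlMl ?ltr_wpDl // mulrC.
Unshelve. all: by end_near. Qed.

Lemma differentiable_horner (V : normedModType C) (p : {poly C}) (f : V -> C) v :
  differentiable f v -> differentiable (fun w => p.[f w]) v.
Proof.
move=> hf; elim/poly_ind: p => [|p c IH].
  by rewrite (_ : (fun _ => _) = functions.cst 0) //; apply/funext => w; rewrite horner0.
rewrite (_ : (fun _ => _) = (fun w => p.[f w]) * f + functions.cst c); last first.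
  by apply/funext => w; rewrite hornerMXaddC.
by apply: differentiableD => //; apply: differentiableM.
Qed.

(** By the addition formula the expansion at 0 is enough. *)
Lemma cexp_differentiable (a : C) : differentiable (@cexp R) a.
Proof.
have [M M0 hM] := cexp_taylorC 2 (ler01 : 0 <= (1 : C)).
apply: (@quadratic_differentiable _ _ (cexp a) (`|cexp a| * M)); first by rewrite mulr_ge0.
move=> h h1; rewrite cexpD.
have -> : cexp h * cexp a - cexp a - cexp a * h = cexp a * (cexp h - (exp_poly R 2).[h]).
  by rewrite horner_poly !big_ord_recr big_ord0 /= invr1 expr0 expr1; ring.
by rewrite normrM -mulrA ler_wpM2l // hM.
Qed.

Lemma differentiable_cexp (V : normedModType C) (f : V -> C) v :
  differentiable f v -> differentiable (fun w => cexp (f w)) v.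
Proof. by move=> hf; apply: differentiable_comp hf _; exact: cexp_differentiable. Qed.

Lemma differentiable_row4 (V : normedModType C) (f0 f1 f2 f3 : V -> C) v :
  differentiable f0 v -> differentiable f1 v -> differentiable f2 v -> differentiable f3 v ->
  differentiable (fun w => row4 (f0 w) (f1 w) (f2 w) (f3 w)) v.
Proof.
move=> h0 h1 h2 h3.
rewrite (_ : (fun _ => _) = (fun w => f0 w *: delta_mx 0 0) + (fun w => f1 w *: delta_mx 0 1)
   + (fun w => f2 w *: delta_mx 0 2%:R) + (fun w => f3 w *: delta_mx 0 3%:R)); last first.
  apply/funext => w; apply: row4_eq; rewrite !mxE /= ?(tnth_nth 0) /=; ring.
by repeat apply: differentiableD; apply: differentiableZl.
Qed.
End Differentiability.

(** * Analytic isomorphisms *)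

Section Submanifold.
Variable R : realType.
Local Notation C := (complexField R).
Implicit Types v w : 'rV[C]_4.

Lemma is_diff_coord v (j : 'I_4) : is_diff v (fun w => w 0 j : C) (fun w => w 0 j).
Proof.
have @f : {linear 'rV[C]_4 -> C}.
  by exists (fun N : 'rV[C]_4 => N 0 j); do 2![eexists]; do ?[constructor];
     rewrite ?mxE// => ? *; rewrite ?mxE//; move=> ?; rewrite !mxE.
rewrite (_ : (fun _ => _) = f) //; apply: DiffDef.
  exact/linear_differentiable/coord_continuous.
by rewrite diff_lin //; exact: coord_continuous.
Qed.

Lemma is_diff_horner (p : {poly C}) (f df : 'rV[C]_4 -> C) v :
  is_diff v f df -> is_diff v (fun w => p.[f w]) (fun w => (deriv p).[f v] * df w).
Proof.
move=> hf; elim/poly_ind: p => [|p c IH].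
  rewrite (_ : (fun _ => _) = functions.cst 0); last by apply/funext => w; rewrite horner0.
  by apply: is_diff_eq; apply/funext => w; rewrite deriv0 horner0 mul0r.
rewrite (_ : (fun w => _.[f w]) = (fun w => p.[f w]) * f + functions.cst c); last first.
  by apply/funext => w; rewrite hornerMXaddC.
apply: is_diff_eq; apply/funext => w; rewrite derivMXaddC !hornerE /=.
rewrite addrfctE !scalrfctE /GRing.scale /=; ring.
Qed.

Definition equation n (p : {poly C}) : 'rV[C]_4 -> C := fun v =>
  v 0 0 ^+ n * v 0 1 + v 0 2%:R ^+ 2 + v 0 3%:R ^+ 3 + v 0 0 * p.[v 0 0].

Lemma is_diff_equation m (p : {poly C}) v : is_diff v (equation m.+2 p) (fun w =>
  v 0 0 ^+ m.+2 * w 0 1 + v 0 1 * (m.+2%:R * v 0 0 ^+ m.+1 * w 0 0)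
  + 2%:R * v 0 2%:R * w 0 2%:R + 3%:R * v 0 3%:R ^+ 2 * w 0 3%:R
  + (v 0 0 * ((deriv p).[v 0 0] * w 0 0) + p.[v 0 0] * w 0 0)).
Proof.
have h j := is_diff_coord v j; have hp := is_diff_horner p (h 0).
pose x j w := w 0 j : C.
rewrite (_ : equation _ _ = x 0 ^+ m.+2 * x 1 + x 2%:R ^+ 2 + x 3%:R ^+ 3 + x 0 * (fun w => p.[w 0 0])); last first.
  by apply/funext => w; rewrite /equation !addrfctE !mulrfctE !exprfctE.
apply: (is_diff_eq (is_diffD (is_diffD (is_diffD (is_diffM (is_diffX m.+1 (h 0)) (h 1))
  (is_diffX 1 (h 2%:R))) (is_diffX 2 (h 3%:R))) (is_diffM (h 0) hp))).
by apply/funext => w; rewrite !addrfctE !scalrfctE /GRing.scale /= !exprfctE /x expr1.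
Qed.

(** The partial derivative in y is x^n. Where x = 0, the one in x is p(0), since
   x^(n-1) y vanishes there for n >= 2. *)
Lemma threefold_submanifold m (p : {poly C}) : p.[0] != 0 -> complex_submanifold 3 (threefold m.+2 p).
Proof.
move=> p0; split=> // a _; pose one : 'rV[C]_(4 - 3) := const_mx 1.
have one0 : one != 0 by apply/eqP => /rowP/(_ 0)/eqP; rewrite !mxE oner_eq0.
have hd v : differentiable (equation m.+2 p) v by have := is_diff_equation m p v.
exists setT, (fun v => equation m.+2 p v *: one); split=> //.
- by split=> [|v _]; [exact: openT|apply: differentiableZl].
- apply/seteqP; split=> v /=.
    by move=> [hv _]; split=> //; rewrite [equation _ _ _]hv scale0r.
  by move=> [_ /eqP]; rewrite scaler_eq0 (negPf one0) orbF => /eqP hv; split.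
- move=> v [hv _]; apply/seteqP; split=> // r _ /=.
  have [w hw] : exists w, 'd (equation m.+2 p) v w = r 0 0.
    have hdv := is_diff_equation m p v; rewrite diff_val; have [x0|x0] := eqVneq (v 0 0) 0.
      exists (row4 (r 0 0 / p.[0]) 0 0 0); rewrite /= !row4E x0.
      by rewrite !(mulr0, mul0r, expr0n, add0r, addr0) /= mulrC divfK.
    exists (row4 0 (r 0 0 / v 0 0 ^+ m.+2) 0 0); rewrite /= !row4E !mulr0 !addr0.
    by rewrite mulrC divfK ?expf_neq0.
  exists w => //; rewrite diffZl // hw; apply/rowP => i; rewrite !mxE mulr1.
  by congr (r 0 _); apply/val_inj => /=; case: i => -[].
Qed.
End Submanifold.

Section AnalyticIso.
Variable R : realType.
Local Notation C := (complexField R).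

(** Choose q so that p2 = k^6 exp(q) p1 modulo x^m when a Taylor polynomial stands
   for exp. The quotient u is differentiable away from 0 as a quotient, and at 0
   because the Taylor remainder contributes O(x^2) to it. The factor 1/6 extracts the sixth root. *)
Lemma analytic_unit m (p1 p2 : {poly C}) : p1.[0] != 0 -> p2.[0] != 0 ->
  exists (k : C) (q : {poly C}) (u : C -> C), [/\ k != 0, forall x, differentiable u x &
    forall x, x ^+ m * u x = p2.[x] - (k * cexp q.[x]) ^+ 6 * p1.[x]].
Proof.
move=> p10 p20; have [k hk] := root_exists (p2.[0] / p1.[0]) (isT : (0 < 6)%N).
have k0 : k != 0.
  by apply/eqP=> k0; move: hk => /eqP; rewrite k0 expr0n eq_sym mulf_eq0 invr_eq0 (negPf p10) (negPf p20).
(* two terms beyond the order m, so that the remainder divided by x^m is O(x^2) *)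
pose N := m.+2.
have [||q [q0 /dvdpP[P hP]]] := @hensel _ p1 p2 (k ^+ 6 *: exp_poly R N) 0 m p10.
- by rewrite hornerZ (horner_coef0 (exp_poly R N)) coef_poly /= fact0 invr1 mulr1 hk divfK.
- by rewrite derivZ hornerZ horner_coef0 coef_deriv coef_poly /= mulf_neq0 ?expf_neq0 // invr1 oner_eq0.
have hPx x : p2.[x] = P.[x] * x ^+ m + k ^+ 6 * (exp_poly R N).[q.[x]] * p1.[x].
  have -> : p2 = P * 'X^m + ((k ^+ 6 *: exp_poly R N) \Po q) * p1 by rewrite -hP; ring.
  by rewrite !(hornerD, hornerM, hornerXn, horner_comp, hornerZ).
have [q1 hq1] : exists q1, q = q1 * 'X by apply/dvdpP; rewrite dvdXp q0.
pose H x := p2.[x] - k ^+ 6 * cexp q.[x] * p1.[x].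
pose u x := if x == 0 then P.[0] else H x / x ^+ m.
exists k, ((6%:R)^-1 *: q), u; split=> // x; last first.
  have -> : (k * cexp ((6%:R)^-1 *: q).[x]) ^+ 6 = k ^+ 6 * cexp q.[x].
    by rewrite exprMn -cexpMn hornerZ -[X in cexp X]mulr_natl mulrA mulfV ?mul1r // pnatr_eq0.
  rewrite /u; case: eqVneq => [->|x0]; last by rewrite mulrC divfK ?expf_neq0.
  by rewrite q0 cexp0 hPx q0 (horner_coef0 (exp_poly R N)) coef_poly /= fact0 invr1; ring.
have [->|x0] := eqVneq x 0; last first.
  apply/derivable1_diffP; apply: (near_eq_derivable (f := fun y => H y * (y ^+ m)^-1)).
    near=> y; rewrite /u ifN_eq //; near: y.
    apply/nbhs_normP; exists `|x|; first by rewrite /= normr_gt0.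
    by move=> y /= hy; apply/eqP => y0; move: hy; rewrite y0 subr0 ltxx.
  apply/derivable1_diffP; apply: differentiableM.
    apply: differentiableB; first exact: differentiable_horner.
    apply: differentiableM; last exact: differentiable_horner.
    apply: differentiableM => //; apply: differentiable_cexp; exact: differentiable_horner.
  apply: differentiableV; last exact: expf_neq0.
  rewrite (_ : (fun _ => _) = (fun y => 'X^m.[y])); first exact: differentiable_horner.
  by apply/funext => y; rewrite hornerXn.
have [r hr] := comp_poly_taylor1 P 0 'X.
have [M1 M10 hM1] := poly_bounded r.
have [M2 M20 hM2] := poly_bounded p1.
have [M4 M40 hM4] := poly_bounded q1.
have [M3 M30 hM3] := cexp_taylorC N M40.
pose M5 := `|k| ^+ 6 * M3 * M4 ^+ N * M2.
have M50 : 0 <= M5.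
  apply: mulr_ge0 => //; apply: mulr_ge0; last exact: exprn_ge0.
  by apply: mulr_ge0 => //; exact: exprn_ge0.
apply: (@quadratic_differentiable _ _ 0 (deriv P).[0] (M1 + M5)); first exact: addr_ge0.
move=> h h1; rewrite addr0 /u eqxx; case: eqVneq => [->|h0].
  rewrite subrr mulr0 subrr normr0; apply: mulr_ge0; first exact: addr_ge0.
  exact: exprn_ge0.
have hq : `|q.[h]| <= M4 * `|h| by rewrite hq1 hornerMX normrM ler_wpM2r // hM4.
have -> : H h / h ^+ m - P.[0] - (deriv P).[0] * h =
    h ^+ 2 * r.[h] - k ^+ 6 * (cexp q.[h] - (exp_poly R N).[q.[h]]) * p1.[h] / h ^+ m.
  have -> : P.[0] = P.[h] - h * (deriv P).[0] - h ^+ 2 * r.[h].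
    move: hr => /(congr1 (fun p : {poly C} => p.[h])).
    by rewrite add0r comp_polyXr !(hornerD, hornerM, hornerXn, horner_comp, hornerX, horner0) => ->; ring.
  by rewrite /H hPx; field; rewrite expf_neq0.
apply: le_trans (ler_normB _ _) _; rewrite mulrDl; apply: lerD.
  by rewrite normrM normrX mulrC ler_wpM2r ?exprn_ge0 // hM1.
rewrite normrM normfV (normrX m) normrM (normrM (k ^+ 6)) (normrX 6) ler_pdivrMr ?exprn_gt0 ?normr_gt0 //.
have -> : M5 * `|h| ^+ 2 * `|h| ^+ m = `|k| ^+ 6 * (M3 * (M4 * `|h|) ^+ N) * M2.
  by rewrite /M5 /N exprMn !exprS; ring.
apply: ler_pM => //; [by apply: mulr_ge0; rewrite ?exprn_ge0|apply: ler_wpM2l; first exact: exprn_ge0|exact: hM2].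
apply: le_trans (hM3 _ _) _.
  by apply: le_trans hq _; rewrite -[leRHS]mulr1 ler_wpM2l.
by rewrite ler_wpM2l // lerXn2r ?nnegrE ?mulr_ge0.
Unshelve. all: by end_near. Qed.

Lemma differentiable_exp (V : normedModType C) (f : V -> C) j v :
  differentiable f v -> differentiable (fun w => f w ^+ j) v.
Proof.
move=> hf; elim: j => [|j IH]; first exact: differentiable_cst.
by rewrite (_ : (fun w => _) = f * (fun w => f w ^+ j)); [apply: differentiableM|
  apply/funext => w; rewrite exprS].
Qed.

Lemma holomorphic_on_space n (p1 p2 : {poly C}) (f : 'rV[C]_4 -> 'rV[C]_4) :
  (forall v, threefold n p1 v -> threefold n p2 (f v)) -> (forall v, differentiable f v) ->
  holomorphic_map (threefold n p1) (threefold n p2) f.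
Proof. by move=> hf df; split=> // a _; exists setT, f; split=> //; split=> [|v _]; first exact: openT. Qed.

(** The scaling by the unit A of [analytic_unit], with weights 6, 3, 2 for y, z, t,
   followed by the translation of y by u, multiplies the equation by A^6. *)
Theorem analytic_iso n (p1 p2 : {poly C}) : (1 < n)%N -> p1.[0] != 0 -> p2.[0] != 0 ->
  analytically_isomorphic 3 (threefold n p1) (threefold n p2).
Proof.
case: n => [|[|m]] // _ p10 p20; split; [exact: threefold_submanifold|exact: threefold_submanifold|].
have [k [q [u [k0 du hu]]]] := analytic_unit m.+1 p10 p20.
pose A x := k * cexp q.[x]; pose B x := k^-1 * cexp (- q).[x].
have AB x : A x * B x = 1 by rewrite /A /B mulrACA mulfV // mul1r hornerN mulrC cexpNK.
have ABn j x : A x ^+ j * B x ^+ j = 1 by rewrite -exprMn AB expr1n.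
have BAn j x : B x ^+ j * A x ^+ j = 1 by rewrite mulrC ABn.
have ABK j x y : A x ^+ j * (B x ^+ j * y) = y by rewrite mulrA ABn mul1r.
have BAK j x y : B x ^+ j * (A x ^+ j * y) = y by rewrite mulrA BAn mul1r.
have p2E x : x * p2.[x] = x ^+ m.+2 * u x + A x ^+ 6 * (x * p1.[x]).
  by rewrite exprS -mulrA hu -/(A x); ring.
have dx v (j : 'I_4) : differentiable (fun w : 'rV[C]_4 => w 0 j : C) v := differentiable_coord v 0 j.
have dA v : differentiable (fun w : 'rV[C]_4 => A (w 0 0)) v.
  apply: (@differentiableM _ _ (functions.cst k)) => //.
  by apply: differentiable_cexp; apply: differentiable_horner; exact: dx.
have dB v : differentiable (fun w : 'rV[C]_4 => B (w 0 0)) v.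
  apply: (@differentiableM _ _ (functions.cst k^-1)) => //.
  by apply: differentiable_cexp; apply: differentiable_horner; exact: dx.
have duv v : differentiable (fun w : 'rV[C]_4 => u (w 0 0)) v.
  by apply: (@differentiable_comp _ _ _ _ _ u); [exact: dx|exact: du].
exists (fun v => row4 (v 0 0) (A (v 0 0) ^+ 6 * v 0 1 - u (v 0 0))
  (A (v 0 0) ^+ 3 * v 0 2%:R) (A (v 0 0) ^+ 2 * v 0 3%:R)).
exists (fun v => row4 (v 0 0) (B (v 0 0) ^+ 6 * (v 0 1 + u (v 0 0)))
  (B (v 0 0) ^+ 3 * v 0 2%:R) (B (v 0 0) ^+ 2 * v 0 3%:R)).
split.
- apply: holomorphic_on_space => v.
    rewrite threefold_row4 /threefold /= p2E => hv.
    by rewrite -[RHS](mulr0 (A (v 0 0) ^+ 6)) -hv; ring.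
  apply: differentiable_row4; first exact: dx.
  + apply: differentiableB; last exact: duv.
    by apply: differentiableM; [exact: differentiable_exp|exact: dx].
  + by apply: differentiableM; [exact: differentiable_exp|exact: dx].
  + by apply: differentiableM; [exact: differentiable_exp|exact: dx].
- apply: holomorphic_on_space => v.
    rewrite threefold_row4 /threefold /= p2E => hv.
    have -> : v 0 0 * p1.[v 0 0] = B (v 0 0) ^+ 6 * (A (v 0 0) ^+ 6 * (v 0 0 * p1.[v 0 0])).
      by rewrite BAK.
    rewrite -[RHS](mulr0 (B (v 0 0) ^+ 6)) -hv; ring.
  apply: differentiable_row4; first exact: dx.
  + apply: differentiableM; first exact: differentiable_exp.
    by apply: differentiableD; [exact: dx|exact: duv].
  + by apply: differentiableM; [exact: differentiable_exp|exact: dx].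
  + by apply: differentiableM; [exact: differentiable_exp|exact: dx].
- by move=> v _; rewrite !row4E subrK !BAK; apply: row4_eq; rewrite !row4E.
- by move=> v _; rewrite !row4E !ABK addrK; apply: row4_eq; rewrite !row4E.
Qed.
End AnalyticIso.

(** * The classification *)

Theorem theorem3 (R : realType) (n : nat) (hn : (2 <= n)%N) :
  (forall p1 p2 : {poly complexField R}, p1.[0] != 0 -> p2.[0] != 0 ->
     (algebraically_isomorphic (threefold n p1) (threefold n p2) <->
      exists lam eps : complexField R,
        [/\ lam != 0, eps != 0 &
            'X^(n - 1) %| p2 - eps *: (p1 \Po (lam *: 'X))])) /\
  (forall p1 p2 : {poly complexField R}, p1.[0] != 0 -> p2.[0] != 0 ->
     algebraically_isomorphic (cylinder (threefold n p1))
                              (cylinder (threefold n p2))) /\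
  (forall p1 p2 : {poly complexField R}, p1.[0] != 0 -> p2.[0] != 0 ->
     analytically_isomorphic 3 (threefold n p1) (threefold n p2)).
Proof.
split; [|split] => p1 p2 p10 p20.
- split=> [|[lam [eps [lam0 eps0 h]]]]; first exact: alg_iso_forward.
  exact: alg_iso_backward lam0 eps0 h.
- exact: cylinder_iso.
- exact: analytic_iso.
Qed.
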